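(* Let $G_1, G_2$ be countable subgroups of $\mathrm{Homeo}_+(S^1)$ such that neither the action of $G_1$ on $S^1$ nor the action of $G_2$ on $S^1$ admits an invariant probability measure, and let $\mu_1,\mu_2$ be nondegenerate probability measures on $G_1, G_2$ respectively. Then for $\mathbb{P}_1\otimes\mathbb{P}_2$-almost every $(\omega,\omega')\in\Omega_1\times\Omega_2$, the set of $n\in\mathbb{N}$ such that $f^n_\omega, f^n_{\omega'}$ are a ping-pong pair has density $1$, that is, \[ \lim_{N\to\infty}\frac{1}{N}\left|\{0\leq n\leq N \mid f^n_\omega, f^n_{\omega'} \text{ are a ping-pong pair}\}\right| = 1. \]
   Context: $\mathrm{Homeo}_+(S^1)$ is the group of orientation-preserving homeomorphisms of $S^1$. A probability measure $\mu$ on a group $G$ is nondegenerate if the semigroup generated by its support is $G$. $(\Omega_i,\mathbb{P}_i)=(G_i^{\mathbb{N}},\mu_i^{\otimes\mathbb{N}})$; for $\omega=(f_{\omega_k})_{k\in\mathbb{N}}\in\Omega_1$, $f^n_\omega=f_{\omega_n}\circ f_{\omega_{n-1}}\circ\cdots\circ f_{\omega_0}$, and similarly for $\omega'\in\Omega_2$. Two homeomorphisms $f,g$ of $S^1$ are a ping-pong pair if there exist pairwise disjoint open subsets $U_1,U_2,V_1,V_2\subseteq S^1$ with $f(S^1\setminus U_1)\subseteq V_1$ and $g(S^1\setminus U_2)\subseteq V_2$. *)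

(* Defs.v *)
From HB Require Import structures.
From mathcomp Require Import all_boot all_order all_algebra.
From mathcomp Require Import all_classical all_reals all_analysis.
Set Implicit Arguments. Unset Strict Implicit. Unset Printing Implicit Defensive.
Import Order.TTheory GRing.Theory Num.Theory.
Import numFieldNormedType.Exports.
Local Open Scope classical_set_scope.
Local Open Scope ring_scope.

Section Circle.
Variable R : realType.

Definition circle_set : set (R * R) := [set p | p.1 ^+ 2 + p.2 ^+ 2 = 1].
Definition S1 : Type := set_type circle_set.

Lemma circle_pt : circle_set (1, 0).
Proof. by rewrite /circle_set /= expr1n expr0n addr0. Qed.

HB.instance Definition _ := Topological.on S1.
HB.instance Definition _ := isPointed.Build S1 (exist _ (1, 0) (mem_set circle_pt)).

Definition CircMap : Type := S1 -> S1.

Definition cpt (x : S1) : R * R := set_val x.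

(** (a, b, c) is in strict counterclockwise cyclic order on the circle:
    the triangle abc is positively oriented. *)
Definition ccw (a b c : S1) : Prop :=
  0 < ((cpt b).1 - (cpt a).1) * ((cpt c).2 - (cpt a).2)
      - ((cpt b).2 - (cpt a).2) * ((cpt c).1 - (cpt a).1).

Definition circle_homeo (f : CircMap) : Prop :=
  continuous f /\ exists g : CircMap, [/\ continuous g, cancel f g & cancel g f].

Definition homeo_plus (f : CircMap) : Prop :=
  circle_homeo f /\ forall a b c, ccw a b c -> ccw (f a) (f b) (f c).

Definition homeo_plus_subgroup (G : set CircMap) : Prop :=
  [/\ (forall g, G g -> homeo_plus g),
      G id,
      (forall g h, G g -> G h -> G (g \o h)) &
      (forall g, G g -> exists h, [/\ G h, cancel g h & cancel h g])].

Definition S1B := g_sigma_algebraType (@open S1).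

Definition has_invariant_probability (G : set CircMap) : Prop :=
  exists nu : probability S1B R,
    forall g : CircMap, G g -> forall A : set S1B, measurable A ->
      nu (g @^-1` A) = nu A.

(** mu : CircMap -> R is the mass function of a probability measure on the
    countable group G (supported in G). *)
Definition prob_on (G : set CircMap) (mu : CircMap -> R) : Prop :=
  [/\ (forall g, 0 <= mu g), (forall g, ~ G g -> mu g = 0) &
      (\esum_(g in G) (mu g)%:E = 1)%E].

Definition mass_support (mu : CircMap -> R) : set CircMap := [set g | 0 < mu g].

Inductive gen_semigroup (S : set CircMap) : CircMap -> Prop :=
  | gs_base g : S g -> gen_semigroup S g
  | gs_comp g h : gen_semigroup S g -> gen_semigroup S h ->
                  gen_semigroup S (g \o h).

Definition nondegenerate_on (G : set CircMap) (mu : CircMap -> R) : Prop :=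
  gen_semigroup (mass_support mu) = G.

(** Sample space Omega_1 x Omega_2 : pairs of sequences, with the product
    sigma-algebra generated by the (joint) cylinder sets. *)
Definition cyl (n : nat) (a b : nat -> CircMap) : set ((nat -> CircMap) * (nat -> CircMap)) :=
  [set x | forall k, (k < n)%N -> x.1 k = a k /\ x.2 k = b k].

Definition cylinders : set (set ((nat -> CircMap) * (nat -> CircMap))) :=
  [set C | exists n a b, C = cyl n a b].

Definition Omega := g_sigma_algebraType cylinders.

(** P is the product measure P_1 (x) P_2, P_i = mu_i^{(x) N} *)
Definition is_iid_product (mu1 mu2 : CircMap -> R) (P : probability Omega R) : Prop :=
  forall n (a b : nat -> CircMap),
    P (cyl n a b) = (\prod_(k < n) (mu1 (a k) * mu2 (b k)))%:E.

Fixpoint fcomp (w : nat -> CircMap) (n : nat) : CircMap :=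
  match n with
  | 0 => w 0%N
  | m.+1 => w m.+1 \o fcomp w m
  end.

Definition ping_pong (f g : CircMap) : Prop :=
  exists U1 U2 V1 V2 : set S1,
    [/\ open U1, open U2, open V1 & open V2] /\
    [/\ U1 `&` U2 = set0, U1 `&` V1 = set0 & U1 `&` V2 = set0] /\
    [/\ U2 `&` V1 = set0, U2 `&` V2 = set0 & V1 `&` V2 = set0] /\
    f @` (~` U1) `<=` V1 /\ g @` (~` U2) `<=` V2.

Definition density_one (Q : nat -> Prop) : Prop :=
  (fun N : nat => (\sum_(n < N.+1) (if asbool (Q n) then 1 else 0 : R)) / N%:R)
    @ \oo --> (1 : R).

End Circle.

(* Main.v *)
(** Lift each walk to the line. The walk has a stationary law for its inverse,
    without atoms because there is no finite orbit; let h be the lift of its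
    distribution function, so that h(f^n t) - h(f^n s) is a bounded martingale.
    Since no probability is invariant, the gaps of size in [eta, c] are visited
    summably often, hence every arc of a fine subdivision of the circle is
    almost surely either "heavy" (its h-mass eventually exceeds c) or has mass
    tending to 0. There are at most 1/c heavy arcs. Take U to be a neighbourhood
    of the heavy arcs and V a neighbourhood of the images of their right
    endpoints: as the light arcs are contracted, f^n maps the complement of U
    into V as soon as no image of a light arc is long.

    The n-step law of a point does not charge small intervals by more than a
    given 1/q, uniformly in the point and the interval (by equidistribution and
    contraction), so by a Chernoff bound the frequency of the times at which U
    and V, or the V of one walk and the V of the other, are not disjoint is
    O(1/q). Finally, by Markov's inequality for the two independent martingales,
    the heavy arcs of the two walks are close to each other with probability
    O(1/q). Letting q tend to infinity gives density one. *)

Require Import Defs.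
From HB Require Import structures.
From mathcomp Require Import all_boot all_order all_algebra.
From mathcomp Require Import all_classical all_reals all_analysis.
From mathcomp Require Import measurable_realfun ring lra zify.
Set Implicit Arguments. Unset Strict Implicit. Unset Printing Implicit Defensive.
Import Order.TTheory GRing.Theory Num.Theory.
Import numFieldNormedType.Exports.
Local Open Scope classical_set_scope.
Local Open Scope ring_scope.

(** * Ultralimits and discrete expectations *)

(** Measures on the circle are handled as degree-one functions on the line, and their weak limits as
    pointwise limits along one fixed ultrafilter; existence of stationary laws and all uniform
    estimates are then compactness arguments about bounded real sequences. The action need not be
    minimal, so [h] may be constant on intervals. The lifts are therefore pushed to the quotient
    that collapses the level sets of [h]: there length itself is stationary, a step of mass [p k]
    expands by at most [1 / p k], and orbits are dense. The constant [c] comes from this quotient: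
    if arbitrarily small gaps were changed by no word, density of orbits would make every step a
    translation, and Lebesgue measure would push forward to an invariant probability. The delicate
    quantifier is the mesh [1 / N]: it is chosen after [q], whereas the number of conditions in the
    final union bound must not depend on it. Closeness of heavy arcs is an event about the whole
    path: it has small probability, not small frequency, and each path avoids it for infinitely many
    [q] only. *)

Section UltraLimit.
Variable R : realType.
Implicit Types u v : nat -> R.

Lemma ultra_oo_ex : exists G : set_system nat, UltraFilter G /\ \oo `<=` G.
Proof. exact: ultraFilterLemma. Qed.

(** One fixed ultrafilter finer than [\oo], so that all bounded sequences have limits at once and no
    subsequence has to be extracted for uncountably many parameters. *)
Definition uoo : set_system nat := projT1 (cid ultra_oo_ex).

Lemma uoo_ultra : UltraFilter uoo.
Proof. by rewrite /uoo; case: cid => G []. Qed.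

Lemma uoo_oo : \oo `<=` uoo.
Proof. by rewrite /uoo; case: cid => G []. Qed.

#[local] Instance uoo_proper : ProperFilter uoo.
Proof. exact: (@ultra_proper _ _ uoo_ultra). Qed.

Definition ulim u : R := lim (u @ uoo).

Definition bnd (T : Type) (f : T -> R) := exists B : R, forall x, `|f x| <= B.

Lemma ulim_cvg u : bnd u -> u @ uoo --> ulim u.
Proof.
move=> [B uB].
have := @segment_compact R (- B) B.
rewrite compact_ultra => /(_ (u @ uoo)).
case.
- split; first exact: fmap_proper_filter.
  (* An image of an ultrafilter is an ultrafilter: a set of [G] whose preimage is not in [uoo] would
     have its complement in [G] too. *)
  move=> G GF sG; rewrite predeqE => A; split; last exact: sG.
  move=> GA; have [//|nA] := in_ultra_setVsetC (u @^-1` A) uoo_ultra.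
  have GnA : G (~` A) by apply: sG.
  have FG : Filter G by exact: filter_filter.
  by have := @filterI _ G FG _ _ GA GnA; rewrite setICr => /filter_ex[].
- apply: (@filterE _ uoo _ (u @^-1` `[- B, B])) => n /=; by rewrite in_itv /= -ler_norml.
- by move=> l [_ /= ul]; rewrite /ulim (cvg_lim _ ul).
Qed.

Lemma ulimE u (l : R) : u @ uoo --> l -> ulim u = l.
Proof. by move=> /cvg_lim; exact. Qed.

Lemma cvg_uoo u (l : R) : u @ \oo --> l -> u @ uoo --> l.
Proof. by move=> ul A /ul; exact: uoo_oo. Qed.

Lemma ulim_near u e : bnd u -> 0 < e -> uoo [set i | `|ulim u - u i| < e].
Proof. by move=> /ulim_cvg /cvgrPdist_lt; exact. Qed.

Lemma uoo_ex (A : set nat) : uoo A -> exists i, A i.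
Proof. by move=> /filter_ex. Qed.

Lemma uoo_ge n : uoo [set i | (n <= i)%N].
Proof. by apply: uoo_oo; exists n. Qed.

Lemma ulim_le u v : bnd u -> bnd v -> uoo [set i | u i <= v i] ->
  ulim u <= ulim v.
Proof. by move=> /ulim_cvg uu /ulim_cvg vv; exact: ler_cvg_to. Qed.

Lemma ulim_cst c : ulim (fun=> c) = c.
Proof. by apply: ulimE; exact: cvg_cst. Qed.

Lemma ulimD u v : bnd u -> bnd v -> ulim (fun i => u i + v i) = ulim u + ulim v.
Proof. by move=> /ulim_cvg uu /ulim_cvg vv; apply: ulimE; exact: cvgD. Qed.

Lemma ulimB u v : bnd u -> bnd v -> ulim (fun i => u i - v i) = ulim u - ulim v.
Proof. by move=> /ulim_cvg uu /ulim_cvg vv; apply: ulimE; exact: cvgB. Qed.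

Lemma ulim_itv u a b : (forall i, a <= u i <= b) -> a <= ulim u <= b.
Proof.
move=> uab.
have ub : bnd u.
  exists (`|a| + `|b|) => i; have /andP[au ub] := uab i.
  rewrite ler_norml; have := ler_norm a; have := ler_norm b.
  have := ler_norm (- a); have := ler_norm (- b); rewrite !normrN; lra.
have cb c : bnd (fun _ : nat => c) by exists `|c|.
apply/andP; split.
  rewrite -(ulim_cst a); apply: ulim_le => //.
  by apply: filterE => i; have /andP[] := uab i.
rewrite -(ulim_cst b); apply: ulim_le => //.
by apply: filterE => i; have /andP[] := uab i.
Qed.

End UltraLimit.
#[global] Existing Instance uoo_proper.

Section Mean.
Variable R : realType.

(* Expectations are only ever applied to bounded functions, so that no
   summability condition has to be carried along. *)
Record mean (T : Type) := Mean {
  expect :> (T -> R) -> R ;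
  expectD : forall f g, bnd f -> bnd g ->
    expect (fun x => f x + g x) = expect f + expect g ;
  expectZ : forall c f, bnd f -> expect (fun x => c * f x) = c * expect f ;
  expect_le : forall f g, bnd f -> bnd g -> (forall x, f x <= g x) ->
    expect f <= expect g ;
  expect_cst : forall c, expect (fun=> c) = c }.

Lemma ind_itv (b : bool) : 0 <= (b%:R : R) <= 1.
Proof. by case: b; rewrite /= ?lexx ?ler01. Qed.

Section BndTheory.
Variable T : Type.
Implicit Types f g : T -> R.

Lemma bnd_cst c : bnd (fun _ : T => c : R).
Proof. by exists `|c|. Qed.

Lemma bndD f g : bnd f -> bnd g -> bnd (fun x => f x + g x).
Proof.
move=> [B fB] [C gC]; exists (B + C) => x.
by rewrite (le_trans (ler_normD _ _)) // lerD.
Qed.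

Lemma bndM f g : bnd f -> bnd g -> bnd (fun x => f x * g x).
Proof.
move=> [B fB] [C gC]; exists (B * C) => x.
by rewrite normrM ler_pM.
Qed.

Lemma bndZ c f : bnd f -> bnd (fun x => c * f x).
Proof. by apply: bndM; exact: bnd_cst. Qed.

Lemma bndB f g : bnd f -> bnd g -> bnd (fun x => f x - g x).
Proof.
move=> [B fB] [C gC]; exists (B + C) => x.
by rewrite (le_trans (ler_normB _ _)) // lerD.
Qed.

Lemma bnd_itv a b f : (forall x, a <= f x <= b) -> bnd f.
Proof.
move=> uab; exists (`|a| + `|b|) => i; have /andP[au ub] := uab i.
rewrite ler_norml; have := ler_norm a; have := ler_norm b.
have := ler_norm (- a); have := ler_norm (- b); rewrite !normrN; lra.
Qed.

Lemma bnd_bool (A : T -> bool) : bnd (fun x => (A x)%:R : R).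
Proof. by apply: (@bnd_itv 0 1) => x; exact: ind_itv. Qed.

Lemma bnd_comp (S : Type) (h : S -> T) f : bnd f -> bnd (fun x => f (h x)).
Proof. by move=> [B fB]; exists B => x. Qed.

Lemma bnd_sum n (F : nat -> T -> R) : (forall k, bnd (F k)) ->
  bnd (fun x => \sum_(k < n) F k x).
Proof.
move=> Fb; elim: n => [|n IH].
  have -> : (fun x => \sum_(k < 0) F k x) = fun=> 0.
    by apply/funext => x; rewrite big_ord0.
  exact: bnd_cst.
have -> : (fun x => \sum_(k < n.+1) F k x) =
          (fun x => \sum_(k < n) F k x + F n x).
  by apply/funext => x; rewrite big_ord_recr.
exact: bndD.
Qed.

End BndTheory.

Section MeanTheory.
Variables (T : Type) (E : mean T).
Implicit Types f g : T -> R.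

Lemma expectB f g : bnd f -> bnd g -> E (fun x => f x - g x) = E f - E g.
Proof.
move=> fb gb; rewrite -[- E g]mulN1r -expectZ // -expectD //; last exact: bndZ.
by congr (expect E _); apply/funext => x; rewrite mulN1r.
Qed.

Lemma expect_itv a b f : (forall x, a <= f x <= b) -> a <= E f <= b.
Proof.
move=> fab; have fb := bnd_itv fab.
apply/andP; split.
  rewrite -[leLHS](@expect_cst T E); apply: expect_le => //; first exact: bnd_cst.
  by move=> x; case/andP: (fab x).
rewrite -[leRHS](@expect_cst T E); apply: expect_le => //; first exact: bnd_cst.
by move=> x; case/andP: (fab x).
Qed.

Lemma expect_norm B f : (forall x, `|f x| <= B) -> `|E f| <= B.
Proof.
move=> fB; rewrite ler_norml; apply: expect_itv => x.
by rewrite -ler_norml.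
Qed.

Lemma expect_sum n (F : nat -> T -> R) : (forall k, bnd (F k)) ->
  E (fun x => \sum_(k < n) F k x) = \sum_(k < n) E (F k).
Proof.
move=> Fb; elim: n => [|n IH].
  rewrite big_ord0 -[RHS](@expect_cst T E); congr (expect E _).
  by apply/funext => x; rewrite big_ord0.
rewrite big_ord_recr /= -IH -expectD //; last exact: bnd_sum.
by congr (expect E _); apply/funext => x; rewrite big_ord_recr.
Qed.

End MeanTheory.

Section DiscreteMean.
Variable p : nat -> R.
Hypothesis p_ge0 : forall k, 0 <= p k.
Hypothesis p_sum : series p @ \oo --> (1 : R).

Definition dexp (f : nat -> R) : R := limn (series (fun k => p k * f k)).

Let wf (f : nat -> R) k := p k * f k.

Lemma dexp_is_cvg f : bnd f -> cvgn (series (wf f)).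
Proof.
move=> [B fB]; apply: normed_cvg; apply: (@series_le_cvg _ _ (fun k => B * p k)).
- by move=> n; exact: normr_ge0.
- by move=> n; rewrite mulr_ge0 // (le_trans _ (fB n)).
- by move=> n; rewrite /= /wf; rewrite normrM ger0_norm // mulrC ler_wpM2r.
- apply: (@is_cvg_seriesZ _ p B).
  exact: cvgP p_sum.
Qed.

Lemma dexp_cvg f : bnd f -> series (wf f) @ \oo --> dexp f.
Proof. exact: dexp_is_cvg. Qed.

Lemma dexp_uniq f l : series (wf f) @ \oo --> l -> dexp f = l.
Proof. by move=> /cvg_lim; exact. Qed.

Lemma dexp_D f g : bnd f -> bnd g ->
  dexp (fun x => f x + g x) = dexp f + dexp g.
Proof.
move=> /dexp_cvg fl /dexp_cvg gl; apply: dexp_uniq.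
have -> : wf (fun x => f x + g x) = wf f + wf g.
  by apply/funext => k; rewrite /wf mulrDr.
by rewrite seriesD; exact: cvgD.
Qed.

Lemma dexp_Z c f : bnd f -> dexp (fun x => c * f x) = c * dexp f.
Proof.
move=> /dexp_cvg fl; apply: dexp_uniq.
have -> : series (wf (fun x => c * f x)) = (fun n => c * series (wf f) n).
  apply/funext => n; rewrite !seriesEord /= mulr_sumr.
  by apply: eq_bigr => k _; rewrite /wf mulrCA.
by apply: cvgM => //; exact: cvg_cst.
Qed.

Lemma dexp_cst c : dexp (fun=> c) = c.
Proof.
apply: dexp_uniq.
have -> : series (wf (fun=> c)) = (fun n => series p n * c).
  by apply/funext => n; rewrite !seriesEord /= mulr_suml.
by rewrite -[X in _ --> X]mul1r; apply: cvgM => //; exact: cvg_cst.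
Qed.

Lemma dexp_le f g : bnd f -> bnd g -> (forall x, f x <= g x) ->
  dexp f <= dexp g.
Proof.
move=> fb gb fg; apply: lim_series_le; [exact: dexp_is_cvg..|].
by move=> n; rewrite ler_wpM2l.
Qed.

Definition dmean : mean nat := Mean dexp_D dexp_Z dexp_le dexp_cst.

Lemma dexp_ge_term f k : bnd f -> (forall x, 0 <= f x) ->
  p k * f k <= dexp f.
Proof.
move=> fb f0; have wf0 n : 0 <= wf f n by rewrite mulr_ge0.
apply: (@le_trans _ _ (series (wf f) k.+1)).
  rewrite seriesEord /= big_ord_recr /= lerDr; exact: sumr_ge0.
apply: nondecreasing_cvgn_le; last exact: dexp_is_cvg.
by apply/nondecreasing_seqP => n; rewrite seriesSr lerDl.
Qed.

Lemma dexp_tail f B n : (forall k, `|f k| <= B) ->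
  `|dexp f - \sum_(k < n) p k * f k| <= B * (1 - \sum_(k < n) p k).
Proof.
move=> fB; have fb : bnd f by exists B.
have l1 : (fun m => `|series (wf f) m - \sum_(k < n) p k * f k|) @ \oo -->
    `|dexp f - \sum_(k < n) p k * f k|.
  by apply: cvg_norm; apply: cvgB; [exact: dexp_cvg | exact: cvg_cst].
have l2 : (fun m => B * (series p m - \sum_(k < n) p k)) @ \oo -->
    B * (1 - \sum_(k < n) p k).
  apply: cvgM; first exact: cvg_cst.
  by apply: cvgB => //; exact: cvg_cst.
apply: (ler_cvg_to l1 l2); exists n => // m /= nm.
have -> : \sum_(k < n) p k * f k = series (wf f) n by rewrite seriesEord.
have -> : \sum_(k < n) p k = series p n by rewrite seriesEord.
rewrite !sub_series_geq //.
rewrite (le_trans (ler_norm_sum _ _ _)) // mulr_sumr ler_sum // => k _.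
by rewrite normrM ger0_norm // mulrC ler_wpM2r.
Qed.

(** The bound [B] makes the tails of the sums small uniformly in [i], and the finite part commutes
    with [ulim]. *)
Lemma dexp_ulim (f : nat -> nat -> R) B : (forall i k, `|f i k| <= B) ->
  dexp (fun k => ulim (fun i => f i k)) = ulim (fun i => dexp (f i)).
Proof.
move=> fB; apply/esym; apply: ulimE; apply/cvgrPdist_lt => e e0.
have B0 : 0 <= B by exact: le_trans (fB 0%N 0%N).
have gB k : `|ulim (fun i => f i k)| <= B.
  by rewrite ler_norml; apply: ulim_itv => i; rewrite -ler_norml.
(* The two tails and the finite part get [e / 3] each; [B + 1] covers the case [B = 0]. *)
have e1 : 0 < e / (4 * (B + 1)) by rewrite divr_gt0 //; lra.
have /cvgrPdist_lt/(_ _ e1)[n _ /(_ n (leqnn n)) /=] := p_sum.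
rewrite seriesEord /= => tail.
have {}tail : B * (1 - \sum_(k < n) p k) < e / 3.
  apply: (@le_lt_trans _ _ (B * (e / (4 * (B + 1))))).
    by rewrite ler_wpM2l // (le_trans (ler_norm _)) // ltW.
  rewrite mulrA ltr_pdivrMr; last lra.
  nra.
have fin : (fun i => \sum_(k < n) p k * f i k) @ uoo -->
    \sum_(k < n) p k * ulim (fun i => f i k).
  elim: n {tail} => [|n IH].
    rewrite big_ord0; under eq_fun do rewrite big_ord0; exact: cvg_cst.
  rewrite big_ord_recr /=; under eq_fun do rewrite big_ord_recr.
  apply: cvgD => //; apply: cvgM; first exact: cvg_cst.
  by apply: ulim_cvg; exists B.
move/cvgrPdist_lt : fin => /(_ (e / 3)) fin.
near=> i.
have h1 := dexp_tail n gB.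
have h2 := dexp_tail n (fB i).
have h3 : `|\sum_(k < n) p k * ulim (fun i => f i k) - \sum_(k < n) p k * f i k| < e / 3.
  by near: i; apply: fin; lra.
have := tail; move: h1 h2 h3; rewrite !ler_norml !ltr_norml; lra.
Unshelve. all: by end_near. Qed.

End DiscreteMean.

(** Fubini: the inner series is the ultralimit of its partial sums, so [dexp_ulim] moves the outer
    expectation inside. *)
Lemma dexp_exchange (p r : nat -> R) (f : nat -> nat -> R) B :
  (forall k, 0 <= p k) -> series p @ \oo --> (1 : R) ->
  (forall k, 0 <= r k) -> series r @ \oo --> (1 : R) ->
  (forall i k, `|f i k| <= B) ->
  dexp p (fun i => dexp r (f i)) = dexp r (fun k => dexp p (fun i => f i k)).
Proof.
move=> p0 p1 r0 r1 fB; have B0 : 0 <= B by exact: le_trans (fB 0%N 0%N).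
have fb i : bnd (f i) by exists B.
have fb' k : bnd (fun i => f i k) by exists B.
have -> : (fun i => dexp r (f i)) =
    (fun i => ulim (fun n => series (fun k => r k * f i k) n)).
  apply/funext => i; apply/esym/ulimE; apply: cvg_uoo; exact: (dexp_cvg r0 r1).
rewrite (@dexp_ulim _ p0 p1 _ B).
  apply: ulimE; apply: cvg_uoo.
  have -> : (fun n => dexp p (fun i => series (fun k => r k * f i k) n)) =
      series (fun k => r k * dexp p (fun i => f i k)).
    apply/funext => n; rewrite seriesEord /=.
    have -> : (fun i => series (fun k => r k * f i k) n) = (fun i => \sum_(k < n) r k * f i k).
      by apply/funext => i; rewrite seriesEord.
    have /= -> := @expect_sum _ (dmean p0 p1) n (fun k i => r k * f i k).
      by apply: eq_bigr => k _; exact: (@expectZ _ (dmean p0 p1)).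
    by move=> k; exact: bndZ.
  apply: (dexp_cvg r0 r1); exists B => k; exact: (@expect_norm _ (dmean p0 p1)).
move=> n i; rewrite seriesEord /= (le_trans (ler_norm_sum _ _ _)) //.
apply: (@le_trans _ _ (\sum_(k < n) r k * B)).
  by apply: ler_sum => k _; rewrite normrM ger0_norm // ler_wpM2l.
rewrite -mulr_suml ler_piMl //.
have -> : \sum_(k < n) r k = series r n by rewrite seriesEord.
rewrite -[leRHS](cvg_lim _ r1) //; apply: nondecreasing_cvgn_le.
  by apply/nondecreasing_seqP => m; rewrite seriesSr lerDl.
exact: cvgP r1.
Qed.

End Mean.

(** * Random walks *)

Section Walk.
Variables (R : realType) (T X : Type) (E : mean R T) (act : T -> X -> X).
Implicit Types f g : X -> R.

(** The [n]-th power of the Markov operator. No path space is involved; paths enter only through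
    [run] on finite words. *)
Fixpoint walk n f (x : X) : R :=
  if n is m.+1 then E (fun k => walk m f (act k x)) else f x.

Definition run (x : X) (w : seq T) : X := foldl (fun y k => act k y) x w.

Lemma run_rcons x w k : run x (rcons w k) = act k (run x w).
Proof. by rewrite /run foldl_rcons. Qed.

Lemma run_cat x v w : run x (v ++ w) = run (run x v) w.
Proof. exact: foldl_cat. Qed.

Lemma walk_norm B n f x : (forall y, `|f y| <= B) -> `|walk n f x| <= B.
Proof.
move=> fB; elim: n x => [|n IH] x //=; exact: expect_norm.
Qed.

Lemma walk_bnd n f : bnd f -> bnd (walk n f).
Proof. by move=> [B fB]; exists B => x; exact: walk_norm. Qed.

Lemma walk_bnd_act n f x : bnd f -> bnd (fun k => walk n f (act k x)).
Proof. by move=> fb; apply: (@bnd_comp _ _ _ (act^~ x)); exact: walk_bnd. Qed.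

Lemma walkD n f g x : bnd f -> bnd g ->
  walk n (fun y => f y + g y) x = walk n f x + walk n g x.
Proof.
move=> fb gb; elim: n x => [|n IH] x //=.
rewrite -expectD; [|exact: walk_bnd_act..].
by congr (expect E _); apply/funext => k.
Qed.

Lemma walkZ n c f x : bnd f -> walk n (fun y => c * f y) x = c * walk n f x.
Proof.
move=> fb; elim: n x => [|n IH] x //=.
rewrite -expectZ; last exact: walk_bnd_act.
by congr (expect E _); apply/funext => k.
Qed.

Lemma walk_cst n c x : walk n (fun=> c) x = c.
Proof.
elim: n x => [|n IH] x //=; rewrite -[RHS](@expect_cst _ _ E).
by congr (expect E _); apply/funext.
Qed.

Lemma walkB n f g x : bnd f -> bnd g ->
  walk n (fun y => f y - g y) x = walk n f x - walk n g x.
Proof.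
move=> fb gb; elim: n x => [|n IH] x //=.
rewrite -expectB; [|exact: walk_bnd_act..].
by congr (expect E _); apply/funext => k.
Qed.

(** The comparison is needed only on a set that the steps preserve, such as the pairs of points at
    distance at most 1. *)
Lemma walk_le_on (S : set X) n f g : (forall k x, S x -> S (act k x)) ->
  bnd f -> bnd g -> (forall y, S y -> f y <= g y) ->
  forall x, S x -> walk n f x <= walk n g x.
Proof.
move=> Sact fb gb fg; elim: n => [|n IH] x Sx /=; first exact: fg.
apply: expect_le; [exact: walk_bnd_act..|].
by move=> k; apply: IH; exact: Sact.
Qed.

Lemma walk_le n f g x : bnd f -> bnd g -> (forall y, f y <= g y) ->
  walk n f x <= walk n g x.
Proof. by move=> fb gb fg; apply: (@walk_le_on setT). Qed.

Lemma walk_eq_on (S : set X) n f g : (forall k x, S x -> S (act k x)) ->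
  (forall y, S y -> f y = g y) -> forall x, S x -> walk n f x = walk n g x.
Proof.
move=> Sact fg; elim: n => [|n IH] x Sx /=; first exact: fg.
by congr (expect E _); apply/funext => k; apply: IH; exact: Sact.
Qed.

Lemma walk_itv c d n f x : (forall y, c <= f y <= d) -> c <= walk n f x <= d.
Proof. by move=> fcd; elim: n x => [|n IH] x //=; exact: expect_itv. Qed.

Lemma walk_add m n f x : walk (m + n) f x = walk m (walk n f) x.
Proof.
elim: m x => [|m IH] x //=.
by congr (expect E _); apply/funext => k.
Qed.

Lemma walk_sum n N (F : nat -> X -> R) x : (forall k, bnd (F k)) ->
  walk n (fun y => \sum_(k < N) F k y) x = \sum_(k < N) walk n (F k) x.
Proof.
move=> Fb; elim: N => [|N IH].
  rewrite big_ord0 -[RHS](walk_cst n 0 x).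
  by apply: (@walk_eq_on setT) => // y _; rewrite big_ord0.
rewrite big_ord_recr /= -IH -walkD //; last exact: bnd_sum.
by apply: (@walk_eq_on setT) => // y _; rewrite big_ord_recr.
Qed.

End Walk.

(** An equivariant map sends walk to walk; this moves estimates between points, pairs, words and the
    quotient. *)
Lemma walk_map (R : realType) (T X Y : Type) (E : mean R T) (actX : T -> X -> X)
  (actY : T -> Y -> Y) (m : X -> Y) (f : Y -> R) n x :
  (forall k x, m (actX k x) = actY k (m x)) ->
  walk E actX n (fun x => f (m x)) x = walk E actY n f (m x).
Proof.
move=> mact; elim: n x => [|n IH] x //=.
by congr (expect E _); apply/funext => k; rewrite IH mact.
Qed.

Section DiscreteWalk.
Variables (R : realType) (p : nat -> R).
Hypothesis p_ge0 : forall k, 0 <= p k.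
Hypothesis p_sum : series p @ \oo --> (1 : R).
Variables (X : Type) (act : nat -> X -> X).

Lemma walk_ge_word w (f : X -> R) x : bnd f -> (forall y, 0 <= f y) ->
  (\prod_(k <- w) p k) * f (run act x w) <=
  walk (dmean p_ge0 p_sum) act (size w) f x.
Proof.
move=> fb f0; elim: w x => [|k w IH] x /=; first by rewrite big_nil mul1r.
rewrite big_cons -mulrA.
apply: (@le_trans _ _ (p k * walk (dmean p_ge0 p_sum) act (size w) f (act k x))).
  by rewrite ler_wpM2l // IH.
apply: (@dexp_ge_term _ _ _ _ (fun k => walk (dmean p_ge0 p_sum) act (size w) f (act k x))) => //.
  exact: walk_bnd_act.
move=> i; rewrite -(walk_cst (dmean p_ge0 p_sum) act (size w) 0 (act i x)).
by apply: walk_le => //; exact: bnd_cst.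
Qed.

End DiscreteWalk.

Lemma walk_exchange (R : realType) (p r : nat -> R)
  (p0 : forall k, 0 <= p k) (p1 : series p @ \oo --> (1 : R))
  (r0 : forall k, 0 <= r k) (r1 : series r @ \oo --> (1 : R))
  (X : Type) (act : nat -> X -> X) n x (f : nat -> X -> R) B :
  (forall k y, `|f k y| <= B) ->
  dmean p0 p1 (fun k => walk (dmean r0 r1) act n (f k) x) =
  walk (dmean r0 r1) act n (fun y => dmean p0 p1 (f ^~ y)) x.
Proof.
move=> fB; elim: n x => [|n IH] x //=.
rewrite (dexp_exchange (B := B)) //.
  by congr (dexp r _); apply/funext => k; exact: IH.
by move=> i k; exact: walk_norm.
Qed.

(** * Degree-one maps of the line and stationary functions *)

Lemma inj_finite_set (T U : Type) (A : set T) (B : set U) (f : T -> U) :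
  finite_set B -> (forall x, A x -> B (f x)) ->
  (forall x y, A x -> A y -> f x = f y -> x = y) -> finite_set A.
Proof.
move=> Bfin AB finj.
have fA : {in A &, injective f}.
  by move=> x y /set_mem Ax /set_mem Ay; exact: finj.
rewrite -(eq_finite_set (inj_card_eq fA)).
by apply: sub_finite_set Bfin => _ [x Ax <-]; exact: AB.
Qed.

Section Equivariant.
Variable R : realType.
Implicit Types h : R -> R.

Definition degree_one h := (forall s t, s <= t -> h s <= h t) /\
  (forall t, h (t + 1) = h t + 1).

Section Theory.
Variable h : R -> R.
Hypothesis h1 : degree_one h.

Lemma degree_one_le s t : s <= t -> h s <= h t.
Proof. by case: h1 => + _; apply. Qed.

Lemma degree_oneDn t n : h (t + n%:R) = h t + n%:R.
Proof.
elim: n => [|n IH]; first by rewrite !addr0.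
by rewrite -natr1 !addrA (proj2 h1) IH.
Qed.

Lemma degree_oneDz t (z : int) : h (t + z%:~R) = h t + z%:~R.
Proof.
case: z => n; first exact: degree_oneDn.
rewrite NegzE mulrNz; apply: (addIr (n.+1%:R)).
rewrite -[n.+1%:~R]/(n.+1%:R) -degree_oneDn; by rewrite !subrK.
Qed.

Lemma degree_one_diff s t n : s <= t -> t <= s + n%:R -> 0 <= h t - h s <= n%:R.
Proof.
move=> st tsn; rewrite subr_ge0 degree_one_le //=.
by rewrite lerBlDl -degree_oneDn degree_one_le.
Qed.

Lemma degree_one_bound t : `|h t - h 0| <= `|t| + 1.
Proof.
have [t0|t0] := leP 0 t.
  have /andP[k1 k2] := truncn_itv t0.
  have : 0 <= h t - h 0 <= (Num.truncn t).+1%:R.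
    by apply: degree_one_diff => //; rewrite add0r ltW.
  by move=> /andP[? ?]; rewrite !ger0_norm //; lra.
have t0' : 0 <= - t by lra.
have /andP[k1 k2] := truncn_itv t0'.
have : 0 <= h 0 - h t <= (Num.truncn (- t)).+1%:R.
  by apply: degree_one_diff; lra.
by move=> /andP[? ?]; rewrite (ltr0_norm t0) distrC ger0_norm //; lra.
Qed.

End Theory.

Lemma degree_one_id : degree_one id.
Proof. by split. Qed.

Lemma degree_one_comp h h' : degree_one h -> degree_one h' -> degree_one (h \o h').
Proof.
move=> [m1 d1] [m2 d2]; split=> [s t st|t] /=; first by rewrite m1 // m2.
by rewrite d2 d1.
Qed.

End Equivariant.

Definition posword (R : realType) (p : nat -> R) (w : seq nat) :=
  all (fun k => 0 < p k) w.

(** Lifts of the steps and of their inverses. [ls_inv] is what nondegeneracy gives: up to an integer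
    translation, the inverse of a step of positive mass is a product of such steps, so that forward
    invariance can be turned into invariance. *)
Record line_system (R : realType) (p : nat -> R) (a b : nat -> R -> R) : Prop :=
  LineSystem {
    ls_a : forall k, degree_one (a k) ;
    ls_b : forall k, degree_one (b k) ;
    ls_ab : forall k t, a k (b k t) = t ;
    ls_ba : forall k t, b k (a k t) = t ;
    ls_inv : forall k, 0 < p k -> exists w (z : int), posword p w /\
      forall t, b k t = run a t w + z%:~R }.

(** The preimage in the line of a finite invariant set of the circle. *)
Definition finite_invariant (R : realType) (p : nat -> R) (a : nat -> R -> R)
    (F : set R) :=
  [/\ F !=set0, finite_set (F `&` `[0, 1[), (forall t, F (t + 1) <-> F t) &
      forall k, 0 < p k -> forall t, F (a k t) <-> F t].

(** Only increments of [h] are averaged: the lifts [a k] may translate by unbounded amounts, whereas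
    the increments are bounded in [k]. *)
Definition stationary (R : realType) (p : nat -> R) (a : nat -> R -> R) (h : R -> R) :=
  forall s t, dexp p (fun k => h (a k t) - h (a k s)) = h t - h s.

Section System.
Variables (R : realType) (p : nat -> R) (a b : nat -> R -> R).
Hypothesis S : line_system p a b.

Lemma run_rev w t : run b (run a t w) (rev w) = t.
Proof.
elim: w t => [|k w IH] t //=.
by rewrite rev_cons run_rcons IH (ls_ba S).
Qed.

Lemma run_b_degree_one w : degree_one (fun t => run b t w).
Proof.
elim: w => [|k w IH]; first exact: degree_one_id.
exact: (degree_one_comp IH (ls_b S k)).
Qed.

(** Reading the word for [b k] backwards expresses [a k] through the inverses. *)
Lemma line_systemC : line_system p b a.
Proof.
split; [exact: ls_b S|exact: ls_a S|exact: ls_ba S|exact: ls_ab S|].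
move=> k pk; have [w [z [pw bw]]] := ls_inv S pk.
exists (rev w), (- z); split; first by rewrite /posword all_rev.
move=> t; have := bw (a k t); rewrite (ls_ba S) => e.
rewrite mulrNz; apply: (addIr (z%:~R)); rewrite subrK.
by rewrite {2}e (degree_oneDz (run_b_degree_one _)) run_rev.
Qed.

Lemma finite_invariantC F : finite_invariant p b F -> finite_invariant p a F.
Proof.
by move=> [F0 Ff Fp Fb]; split => // k pk t; rewrite -(Fb k pk) (ls_ba S).
Qed.

Lemma ls_a_cont k t e : 0 < e -> exists2 r, 0 < r &
  forall s, `|s - t| < r -> `|a k s - a k t| < e.
Proof.
move=> e0; have e2 : 0 < e / 2 by lra.
have b1 := ls_b S k; have a1 := ls_a S k.
have lt1 : t < b k (a k t + e / 2).
  rewrite ltNge; apply/negP => /(degree_one_le a1); rewrite (ls_ab S); lra.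
have lt2 : b k (a k t - e / 2) < t.
  rewrite ltNge; apply/negP => /(degree_one_le a1); rewrite (ls_ab S); lra.
exists (Num.min (b k (a k t + e / 2) - t) (t - b k (a k t - e / 2))).
  by rewrite lt_min; apply/andP; split; lra.
move=> s; rewrite lt_min !ltr_norml => /andP[/andP[s1 s2] /andP[s3 s4]].
have := degree_one_le a1 (_ : s <= b k (a k t + e / 2)).
have := degree_one_le a1 (_ : b k (a k t - e / 2) <= s).
by rewrite !(ls_ab S) => h1 h2; have := h1 ltac:(lra); have := h2 ltac:(lra); lra.
Qed.

Lemma run_cont w x e : 0 < e -> exists2 r, 0 < r &
  forall y, `|y - x| < r -> `|run a y w - run a x w| < e.
Proof.
elim: w x e => [|k w IH] x e e0 /=; first by exists e.
have [r r0 rP] := IH (a k x) e e0.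
have [r' r'0 r'P] := ls_a_cont k x r0.
by exists r' => // y yx; apply: rP; exact: r'P.
Qed.

End System.

Lemma posword_gt0 (R : realType) (p : nat -> R) w : posword p w ->
  0 < \prod_(k <- w) p k.
Proof.
elim: w => [|k w IH] /=; first by rewrite big_nil.
by move=> /andP[pk pw]; rewrite big_cons mulr_gt0 // IH.
Qed.

Lemma sum_shift (R : realType) (d : nat -> R) m :
  \sum_(n < m) d n.+1 = \sum_(n < m) d n + (d m - d 0%N).
Proof. by elim: m => [|m IH]; rewrite ?big_ord0 ?big_ord_recr /= ?IH; lra. Qed.

(** * Atoms of stationary functions and their absence *)

Section Jump.
Variables (R : realType) (h : R -> R).
Hypothesis h1 : degree_one h.

Definition invS (i : nat) : R := i.+1%:R^-1.

Lemma invS_gt0 i : 0 < invS i.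
Proof. by rewrite invr_gt0. Qed.

Lemma invS_le1 i : invS i <= 1.
Proof. by rewrite invf_le1 // ler1n. Qed.

Lemma uoo_invS (e : R) : 0 < e -> uoo [set i | invS i < e].
Proof.
move=> e0; apply: uoo_oo; have := near_infty_natSinv_lt (PosNum e0).
exact.
Qed.

(** The mass of the atom at [t] of the measure with distribution function [h]. *)
Definition jump t := ulim (fun i => h (t + invS i) - h (t - invS i)).

Lemma jump_itv t i : 0 <= h (t + invS i) - h (t - invS i) <= 2.
Proof.
have i0 := invS_gt0 i; have i1 := invS_le1 i.
by apply: (degree_one_diff h1 (n := 2)); lra.
Qed.

Lemma jump_bnd t : bnd (fun i => h (t + invS i) - h (t - invS i)).
Proof. exact: bnd_itv (jump_itv t). Qed.

Lemma jump_ge0_le2 t : 0 <= jump t <= 2.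
Proof. exact: ulim_itv (jump_itv t). Qed.

Lemma jump_le t r : 0 < r -> jump t <= h (t + r) - h (t - r).
Proof.
move=> r0; rewrite -[leRHS](ulim_cst); apply: ulim_le; [exact: jump_bnd|exact: bnd_cst|].
apply: filterS (uoo_invS r0) => i /= ir.
by apply: lerB; apply: degree_one_le => //; lra.
Qed.

Lemma jump_ge t x : (forall r, 0 < r -> x <= h (t + r) - h (t - r)) -> x <= jump t.
Proof.
move=> xr; rewrite -[leLHS](ulim_cst); apply: ulim_le; [exact: bnd_cst|exact: jump_bnd|].
by apply: filterE => i; exact: xr (invS_gt0 i).
Qed.

Lemma jump_per t : jump (t + 1) = jump t.
Proof.
rewrite /jump; congr (ulim _); apply/funext => i.
rewrite [t + 1 + _]addrAC [t + 1 - _]addrAC !(proj2 h1); lra.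
Qed.

Lemma jump_perz t (z : int) : jump (t + z%:~R) = jump t.
Proof.
rewrite /jump; congr (ulim _); apply/funext => i.
rewrite [t + _ + invS _]addrAC [t + _ - _]addrAC !(degree_oneDz h1); lra.
Qed.

Lemma jump_usc (u : nat -> R) x : bnd u -> uoo [set i | x <= jump (u i)] ->
  x <= jump (ulim u).
Proof.
move=> ub ux; apply: jump_ge => r r0.
have r2 : 0 < r / 2 by lra.
have [i /= [xi ui]] := uoo_ex (filterI ux (ulim_near ub r2)).
apply: (le_trans xi); apply: (le_trans (jump_le _ r2)).
by move: ui; rewrite ltr_norml => ui; apply: lerB; apply: degree_one_le => //; lra.
Qed.

End Jump.

Lemma frac_part (R : realType) (t : R) : exists z : int, 0 <= t + z%:~R < 1.
Proof.
exists (- Num.floor t); have := floor_itv t; rewrite mulrNz intrD.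
by move=> /andP[? ?]; apply/andP; split; lra.
Qed.

Section Continuity.
Variables (R : realType) (p : nat -> R) (a b : nat -> R -> R).
Hypothesis p_ge0 : forall k, 0 <= p k.
Hypothesis p_sum : series p @ \oo --> (1 : R).
Hypothesis S : line_system p a b.
Hypothesis noF : forall F, ~ finite_invariant p a F.
Variable h : R -> R.
Hypothesis h1 : degree_one h.
Hypothesis hstat : stationary p a h.

Let J := jump h.

Let ajump_itv t i k : 0 <= h (a k (t + invS R i)) - h (a k (t - invS R i)) <= 2.
Proof.
apply: (degree_one_diff (degree_one_comp h1 (ls_a S k)) (n := 2));
  have := invS_gt0 R i; have := invS_le1 R i; lra.
Qed.

(** Stationarity for the intervals of radius [invS i] around [t], then the limit in [i]; by
    continuity each [a k] maps small intervals into small ones. *)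
Let Jsub t : J t <= dexp p (fun k => J (a k t)).
Proof.
have -> : J t = dexp p (fun k =>
    ulim (fun i => h (a k (t + invS R i)) - h (a k (t - invS R i)))).
  rewrite (@dexp_ulim _ _ p_ge0 p_sum _ 2).
    by rewrite /J /jump; congr ulim; apply/funext => i; rewrite hstat.
  by move=> i k; have /andP[? ?] := ajump_itv t i k; rewrite ger0_norm.
have bb k : bnd (fun i => h (a k (t + invS R i)) - h (a k (t - invS R i))).
  by apply: (@bnd_itv _ _ 0 2) => i.
apply: (dexp_le p_ge0 p_sum).
- by apply: (@bnd_itv _ _ 0 2) => k; apply: ulim_itv => i.
- by apply: (@bnd_itv _ _ 0 2) => k; exact: jump_ge0_le2.
- move=> k; apply: jump_ge => // r r0.
  rewrite -[leRHS](ulim_cst); apply: ulim_le => //; first exact: bnd_cst.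
  have [r' r'0 ar] := ls_a_cont S k t r0.
  apply: filterS (uoo_invS r'0) => i /= ir.
  have i0 := invS_gt0 R i.
  have := ar (t + invS R i); have := ar (t - invS R i).
  rewrite !ltr_norml => h2 h3; apply: lerB; apply: degree_one_le => //.
    have := h3 ltac:(lra); lra.
  have := h2 ltac:(lra); lra.
Qed.

Let M := sup (range J).

Let hsM : has_sup (range J).
Proof.
split; first by exists (J 0), 0.
by exists 2 => _ [t _ <-]; have /andP[] := jump_ge0_le2 h1 t.
Qed.

Let J_le t : J t <= M.
Proof. by apply: sup_upper_bound => //; exists t. Qed.

(** Upper semicontinuity: the ultralimit of a maximising sequence taken in one period attains the
    supremum. *)
Let J_max : exists t, J t = M.
Proof.
have ex i : exists t, 0 <= t <= 1 /\ M - invS R i < J t.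
  have [_ [t _ <-] Jt] := sup_adherent (invS_gt0 R i) hsM.
  have [z tz] := frac_part t; exists (t + z%:~R); split; first lra.
  by rewrite /J jump_perz.
have [u uP] := choice ex.
have ub : bnd u by apply: (@bnd_itv _ _ 0 1) => i; have [] := uP i.
exists (ulim u); apply/eqP; rewrite eq_le J_le /=; apply/ler_addgt0Pr => e e0.
rewrite -lerBlDr; apply: jump_usc => //.
apply: filterS (uoo_invS e0) => i /= ie; have [_ /ltW] := uP i.
by apply: le_trans; lra.
Qed.

Let F := [set t | J t = M].

(** Maximum principle: by [Jsub], at a maximum no step of positive mass can lead to a smaller
    atom. *)
Let F_fwd k t : 0 < p k -> F t -> F (a k t).
Proof.
move=> pk Ft; apply/eqP; rewrite eq_le J_le /=.
have Jb : bnd (fun k => J (a k t)).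
  by apply: (@bnd_itv _ _ 0 2) => i; exact: jump_ge0_le2.
have := @dexp_ge_term _ _ p_ge0 p_sum (fun k => M - J (a k t)) k.
move=> /(_ (bndB (bnd_cst _ _) Jb)) /(_ (fun i => ltac:(by rewrite subr_ge0))).
have /= -> := @expectB _ _ (dmean p_ge0 p_sum) (fun=> M) _ (bnd_cst _ _) Jb.
have /= -> := @expect_cst _ _ (dmean p_ge0 p_sum) M.
have := Jsub t; rewrite Ft; nra.
Qed.

Let F_word w t : posword p w -> F t -> F (run a t w).
Proof.
elim: w t => [|k w IH] t //= /andP[pk pw] Ft.
by apply: IH => //; exact: F_fwd.
Qed.

Let F_fin : 0 < M -> finite_set (F `&` `[0, 1[).
Proof.
move=> M0.
(* The right limit of [h] grows by at least [M] at each atom of [F], so the integer part of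
   [(kap t - h 0) / M] separates the points of [F] in a period. *)
pose kap t := ulim (fun i => h (t + invS R i)).
have kb t : bnd (fun i => h (t + invS R i)).
  apply: (@bnd_itv _ _ (h t) (h (t + 1))) => i.
  by rewrite !(degree_one_le h1) //; have := invS_gt0 R i; have := invS_le1 R i; lra.
have kap_itv t : h t <= kap t <= h (t + 1).
  apply: ulim_itv => i.
  by rewrite !(degree_one_le h1) //; have := invS_gt0 R i; have := invS_le1 R i; lra.
have ksep s t : s < t -> F t -> M <= kap t - kap s.
  move=> st Ft; pose c := (s + t) / 2.
  have st2 : 0 < (t - s) / 2 by lra.
  have u1 : kap s <= h c.
    rewrite -[leRHS](ulim_cst); apply: ulim_le => //; first exact: bnd_cst.
    apply: filterS (uoo_invS st2) => i /= ie.
    by apply: degree_one_le => //; rewrite /c; lra.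
  have u2 : h c + M <= kap t.
    rewrite -[leLHS](ulim_cst); apply: ulim_le => //; first exact: bnd_cst.
    apply: filterS (uoo_invS st2) => i /= ie.
    have := jump_le h1 t (invS_gt0 R i); rewrite -/(J t) Ft.
    have : h c <= h (t - invS R i) by apply: degree_one_le => //; rewrite /c; lra.
    lra.
  lra.
pose f t := Num.truncn ((kap t - h 0) / M).
have pos t : (F `&` `[0, 1[) t -> 0 <= (kap t - h 0) / M <= 2 / M.
  move=> [_ /=]; rewrite in_itv /= => /andP[t0 t1].
  have /andP[k1 k2] := kap_itv t.
  have m1 := degree_one_le h1 t0.
  have m2 : h (t + 1) <= h 2 by apply: degree_one_le => //; lra.
  have e2 : h 2 = h 0 + 2 by rewrite -(degree_oneDn h1) add0r.
  by apply/andP; split; [apply: divr_ge0 | rewrite ler_pM2r ?invr_gt0 //]; lra.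
apply: (@inj_finite_set _ _ _ `I_(Num.truncn (2 / M)).+1 f).
- exact: finite_II.
- move=> t Ft; rewrite /= ltnS; apply: le_truncn.
  by have /andP[] := pos t Ft.
- move=> s t Fs Ft fst.
  wlog : s t Fs Ft fst / s < t.
    move=> W; have [st|ts|//] := ltgtP s t; first exact: W.
    by apply/esym; apply: W.
  move=> st; exfalso.
  have /andP[s0 _] := pos s Fs; have /andP[t0 _] := pos t Ft.
  have /andP[s1 s2] := truncn_itv s0; have /andP[t1 t2] := truncn_itv t0.
  move: s1 s2 t1 t2; rewrite -/(f s) -/(f t) fst -natr1 => s1 s2 t1 t2.
  have := ksep _ _ st (proj1 Ft).
  have : (kap t - h 0) / M - (kap s - h 0) / M < 1 by lra.
  rewrite -mulrBl ltr_pdivrMr // mul1r; lra.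
Qed.

(** Otherwise the largest atoms would form a finite invariant set, since the total mass of a period
    is finite. *)
Lemma stationary_cont t e : 0 < e -> exists2 r, 0 < r & h (t + r) - h (t - r) < e.
Proof.
move=> e0; apply: contrapT => nex.
have M0 : 0 < M.
  apply: (lt_le_trans e0); apply: le_trans (J_le t); apply: jump_ge => // r r0.
  by rewrite leNgt; apply/negP => hr; apply: nex; exists r.
apply: (noF (F := F)); split.
- by have [s Js] := J_max; exists s.
- exact: F_fin.
- by move=> s; rewrite /F /= /J jump_per.
- move=> k pk s; split; last exact: F_fwd.
  (* The inverse step is a forward word up to an integer, so forward invariance gives invariance. *)
  move=> Fs; have [w [z [pw bw]]] := ls_inv S pk.
  have := F_word pw Fs; rewrite -[in X in _ -> X](ls_ba S k s) bw /F /=.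
  by rewrite /J jump_perz.
Qed.

Lemma stationary_ucont e : 0 < e ->
  exists2 r, 0 < r & forall t, h (t + r) - h (t - r) < e.
Proof.
move=> e0; apply: contrapT => nex.
have ex i : exists t, 0 <= t <= 1 /\ e <= h (t + invS R i) - h (t - invS R i).
  apply: contrapT => nt; apply: nex; exists (invS R i) => [|t]; first exact: invS_gt0.
  rewrite ltNge; apply/negP => et; apply: nt.
  have [z tz] := frac_part t; exists (t + z%:~R); split; first lra.
  by rewrite ![t + z%:~R + _]addrAC !(degree_oneDz h1); lra.
have [u uP] := choice ex.
have ub : bnd u by apply: (@bnd_itv _ _ 0 1) => i; have [] := uP i.
have [r r0] := stationary_cont (ulim u) e0; rewrite ltNge => /negP; apply.
have r2 : 0 < r / 2 by lra.
have [i /= [ir]] := uoo_ex (filterI (uoo_invS r2) (ulim_near ub r2)).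
rewrite ltr_norml => ui; have [_ ei] := uP i; apply: (le_trans ei).
by apply: lerB; apply: degree_one_le => //; lra.
Qed.

End Continuity.

Lemma ls_a_lt (R : realType) (p : nat -> R) a b (S : line_system p a b) k s t :
  (a k s < a k t) = (s < t).
Proof.
apply/idP/idP; rewrite !ltNge; apply: contra; first exact: degree_one_le (ls_a S k) _ _.
by move=> /(degree_one_le (ls_b S k)); rewrite !(ls_ba S).
Qed.

Lemma degree_one_surj (R : realType) (h : R -> R) : degree_one h ->
  (forall t e, 0 < e -> exists2 r, 0 < r & h (t + r) - h (t - r) < e) ->
  forall u, exists t, h t = u.
Proof.
move=> h1 hc u.
have hcont : continuous h.
  move=> t; apply/cvgrPdist_lt => e e0; have [r r0 hr] := hc t e e0.
  near=> s.
  have ts : `|t - s| < r by near: s; apply: cvgr_dist_lt.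
  move: ts; rewrite ltr_norml => /andP[? ?].
  have l1 : h (t - r) <= h s by apply: degree_one_le => //; lra.
  have l2 : h s <= h (t + r) by apply: degree_one_le => //; lra.
  have l3 : h (t - r) <= h t by apply: degree_one_le => //; lra.
  have l4 : h t <= h (t + r) by apply: degree_one_le => //; lra.
  by rewrite ltr_norml; lra.
pose n := (Num.truncn `|u - h 0|).+1.
have /andP[_] := truncn_itv (normr_ge0 (u - h 0)); rewrite -/n => un.
have e1 : h n%:R = h 0 + n%:R by rewrite -(degree_oneDn h1) add0r.
have e2 : h (- n%:R) = h 0 - n%:R.
  by apply: (addIr n%:R); rewrite -(degree_oneDn h1) subrK addNr.
have n0 : 0 <= n%:R :> R by [].
have [|||t _ ht] := @IVT _ h (- n%:R) n%:R u; last by exists t.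
- by lra.
- exact: continuous_subspaceT.
- move: un; rewrite e1 e2 ltr_norml ge_min le_max => /andP[? ?].
  by apply/andP; split; apply/orP; [left|right]; lra.
Unshelve. all: by end_near. Qed.

(** * Existence of a stationary function *)

Section StationaryExists.
Variables (R : realType) (p : nat -> R) (a b : nat -> R -> R).
Hypothesis p_ge0 : forall k, 0 <= p k.
Hypothesis p_sum : series p @ \oo --> (1 : R).
Hypothesis S : line_system p a b.

Let E := dmean p_ge0 p_sum.

(** Iterated pullback of Lebesgue measure, normalised to vanish at [0] so that the integrand stays
    bounded. *)
Fixpoint pull n (t : R) : R :=
  if n is m.+1 then dexp p (fun k => pull m (a k t) - pull m (a k 0)) else t.

Lemma degree_one_bound2 (h : R -> R) s t : degree_one h ->
  `|h t - h s| <= `|t| + `|s| + 2.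
Proof.
move=> h1; have := degree_one_bound h1 t; have := degree_one_bound h1 s.
by rewrite !ler_norml; have := normr_ge0 t; have := normr_ge0 s; lra.
Qed.

Let pull_bnd h t s : degree_one h -> bnd (fun k => h (a k t) - h (a k s)).
Proof.
move=> h1; exists (`|t| + `|s| + 2) => k.
exact: degree_one_bound2 (degree_one_comp h1 (ls_a S k)).
Qed.

Lemma pull_degree_one n : degree_one (pull n).
Proof.
elim: n => [|n IH]; first exact: degree_one_id.
split=> [s t st|t] /=.
  apply: (dexp_le p_ge0 p_sum); [exact: pull_bnd..|] => k.
  by rewrite lerB //; do 2! apply: degree_one_le => //; exact: ls_a S _.
rewrite -[X in _ = _ + X](@expect_cst _ _ E) -[X in _ = X + _]/(E _).
rewrite -expectD; [|exact: pull_bnd|exact: bnd_cst].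
congr (dexp p _); apply/funext => k.
by rewrite (proj2 (ls_a S k)) (proj2 IH); lra.
Qed.

Lemma pull_bound n t : `|pull n t| <= `|t| + 1.
Proof.
have := degree_one_bound (pull_degree_one n) t.
suff -> : pull n 0 = 0 by rewrite subr0.
case: n => //= n; rewrite -[RHS](@expect_cst _ _ E).
by congr (dexp p _); apply/funext => k; rewrite subrr.
Qed.

Lemma pull_stat n s t :
  dexp p (fun k => pull n (a k t) - pull n (a k s)) = pull n.+1 t - pull n.+1 s.
Proof.
rewrite /= -[RHS]/(E _ - E _) -expectB; [|exact: pull_bnd (pull_degree_one _)..].
by congr (dexp p _); apply/funext => k; lra.
Qed.

Let ces N t := N.+1%:R^-1 * \sum_(n < N.+1) pull n t.

Let ces_degree_one N : degree_one (ces N).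
Proof.
split=> [s t st|t].
  rewrite ler_pM2l ?invr_gt0 //; apply: ler_sum => n _.
  exact: degree_one_le (pull_degree_one n) _ _ st.
rewrite /ces; under eq_bigr do rewrite (proj2 (pull_degree_one _)).
rewrite big_split /= sumr_const card_ord mulrDr; congr (_ + _).
by rewrite -[1 *+ _]/(N.+1%:R) mulVf.
Qed.

Let ces_bound N t : `|ces N t| <= `|t| + 1.
Proof.
rewrite normrM ger0_norm ?invr_ge0 // mulrC ler_pdivrMr //.
rewrite (le_trans (ler_norm_sum _ _ _)) //.
apply: (@le_trans _ _ (\sum_(n < N.+1) (`|t| + 1))).
  by apply: ler_sum => n _; exact: pull_bound.
by rewrite sumr_const card_ord -[leLHS]mulr_natr.
Qed.

Let ces_bnd t : bnd (ces^~ t).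
Proof. by exists (`|t| + 1) => N; exact: ces_bound. Qed.

(** Krylov-Bogolyubov: a limit of Cesaro means of the pullbacks. *)
Definition shape t := ulim (ces^~ t).

Lemma shape_degree_one : degree_one shape.
Proof.
split=> [s t st|t].
  apply: ulim_le => //; apply: filterE => N.
  exact: degree_one_le (ces_degree_one N) _ _ st.
rewrite /shape -[X in _ = _ + X]ulim_cst -ulimD //; last exact: bnd_cst.
by congr ulim; apply/funext => N; rewrite (proj2 (ces_degree_one N)).
Qed.

Lemma shape_stationary : stationary p a shape.
Proof.
move=> s t.
have -> : (fun k => shape (a k t) - shape (a k s)) =
    (fun k => ulim (fun N => ces N (a k t) - ces N (a k s))).
  by apply/funext => k; rewrite ulimB.
rewrite (@dexp_ulim _ _ p_ge0 p_sum _ (`|t| + `|s| + 2)); last first.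
  move=> N k.
  exact: degree_one_bound2 (degree_one_comp (ces_degree_one N) (ls_a S k)).
(* One more pullback shifts the averaged sum by one index, which costs only the two end terms
   divided by [N.+1]; [pull 0] is the identity. *)
pose err N := N.+1%:R^-1 * ((pull N.+1 t - t) - (pull N.+1 s - s)).
have -> : (fun N => dexp p (fun k => ces N (a k t) - ces N (a k s))) =
    (fun N => (ces N t - ces N s) + err N).
  apply/funext => N.
  have -> : (fun k => ces N (a k t) - ces N (a k s)) =
      (fun k => N.+1%:R^-1 * \sum_(n < N.+1) (pull n (a k t) - pull n (a k s))).
    by apply/funext => k; rewrite -mulrBr -sumrB.
  have pb n := pull_bnd t s (pull_degree_one n).
  rewrite -[LHS]/(E _) expectZ; last exact: (bnd_sum N.+1 pb).
  rewrite (@expect_sum _ _ E N.+1 (fun n k => pull n (a k t) - pull n (a k s))) //.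
  rewrite -mulrBr -sumrB -mulrDr; congr (_ * _).
  under eq_bigr do rewrite [E _]pull_stat.
  rewrite (sum_shift (fun n => pull n t - pull n s)) sumrB; congr (_ + _).
  by rewrite [pull 0 _]/= [pull 0 _]/=; lra.
rewrite ulimD; last 1 first.
- exists (2 * (`|t| + `|s| + 2)) => N.
  rewrite /err normrM ger0_norm ?invr_ge0 // -[leRHS]mul1r ler_pM ?invr_ge0 //.
    exact: invS_le1.
  have := pull_bound N.+1 t; have := pull_bound N.+1 s.
  rewrite !ler_norml; have := ler_norm t; have := ler_norm s.
  have := ler_norm (- t); have := ler_norm (- s); rewrite !normrN; lra.
- rewrite ulimB //; suff -> : ulim err = 0 by rewrite addr0.
  apply: ulimE; apply/cvgrPdist_lt => e e0.
  pose c := 2 * (`|t| + `|s| + 2) + 1.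
  have c0 : 0 < c by have := normr_ge0 t; have := normr_ge0 s; rewrite /c; lra.
  have ec : 0 < e / c by rewrite divr_gt0.
  apply: filterS (uoo_invS ec) => N /= Ne.
  rewrite sub0r normrN /err normrM ger0_norm ?invr_ge0 //.
  rewrite -/(invS R N).
  have : `|pull N.+1 t - t - (pull N.+1 s - s)| <= c.
    have := pull_bound N.+1 t; have := pull_bound N.+1 s.
    rewrite /c !ler_norml; have := ler_norm t; have := ler_norm s.
    have := ler_norm (- t); have := ler_norm (- s); rewrite !normrN; lra.
  move=> bc; apply: (@le_lt_trans _ _ (invS R N * c)).
    by rewrite ler_wpM2l // ltW // invS_gt0.
  by rewrite -ltr_pdivlMr.
- exact: bndB.
Qed.

End StationaryExists.

(** * The quotient by the level sets of a stationary function *)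

Section Quotient.
Variables (R : realType) (p : nat -> R) (a b : nat -> R -> R).
Hypothesis p_ge0 : forall k, 0 <= p k.
Hypothesis p_sum : series p @ \oo --> (1 : R).
Hypothesis S : line_system p a b.
Hypothesis a_null : forall k t, ~ 0 < p k -> a k t = t.
Variable h : R -> R.
Hypothesis h1 : degree_one h.
Hypothesis hstat : stationary p a h.
Hypothesis hcont : forall t e, 0 < e -> exists2 r, 0 < r & h (t + r) - h (t - r) < e.

(** The left end of the fibre of [h] over [u]: a section of [h] that is compatible with the
    steps. *)
Definition leftmost u := inf [set t | u <= h t].

Let lm_has_inf u : has_inf [set t | u <= h t].
Proof.
have [t ht] := degree_one_surj h1 hcont u.
split; first by exists t; rewrite /= ht.
exists (t - 1) => s /= us; rewrite leNgt; apply/negP => st.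
have := degree_one_le h1 (ltW st).
have := degree_oneDn h1 (t - 1) 1; rewrite subrK; lra.
Qed.

Lemma leftmostK u : h (leftmost u) = u.
Proof.
apply/eqP; rewrite eq_le; apply/andP; split.
  have [t ht] := degree_one_surj h1 hcont u.
  rewrite -[leRHS]ht; apply: degree_one_le => //; apply: ge_inf.
    by have [] := lm_has_inf u.
  by rewrite /= ht.
apply/ler_addgt0Pr => e e0; have [r r0 hr] := hcont (leftmost u) e0.
have [t /= ut tl] := inf_adherent r0 (lm_has_inf u).
have := degree_one_le h1 (ltW tl).
have : h (leftmost u - r) <= h (leftmost u) by apply: degree_one_le => //; lra.
rewrite -/(leftmost u); lra.
Qed.

Lemma leftmost_lt u s : s < leftmost u -> h s < u.
Proof.
rewrite ltNge => /negP sl; rewrite ltNge; apply/negP => us; apply: sl.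
by apply: ge_inf => //; have [] := lm_has_inf u.
Qed.

Lemma leftmost_uniq t : (forall s, s < t -> h s < h t) -> leftmost (h t) = t.
Proof.
move=> lt; apply/eqP; rewrite eq_le !leNgt; apply/andP; split; apply/negP.
  by move=> /leftmost_lt; rewrite ltxx.
by move=> /lt; rewrite leftmostK ltxx.
Qed.

(** A fibre has mass zero, hence by stationarity so has its image under a step of positive mass; the
    other steps are the identity. *)
Let fiber k s t : h s = h t -> h (a k s) = h (a k t).
Proof.
wlog st : s t / s <= t.
  by move=> W; case: (leP s t) => [/W //|/ltW ts /esym /(W _ _ ts)].
move=> hst; have [pk|pk] := pselect (0 < p k); last by rewrite !a_null.
have am i : h (a i s) <= h (a i t).
  by do 2! apply: degree_one_le => //; exact: ls_a S i.
have := @dexp_ge_term _ _ p_ge0 p_sum (fun i => h (a i t) - h (a i s)) k.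
rewrite hstat hst subrr => /(_ _ _) H.
have : p k * (h (a k t) - h (a k s)) <= 0.
  apply: H => [|i]; last by rewrite subr_ge0.
  exists (`|t| + `|s| + 2) => i.
  exact: degree_one_bound2 (degree_one_comp h1 (ls_a S i)).
by have := am k; nra.
Qed.

Let fiber_run w s t : h s = h t -> h (run a s w) = h (run a t w).
Proof. by elim: w s t => [|k w IH] s t //= hst; apply: IH; exact: fiber. Qed.

Let fiberb k s t : h s = h t -> h (b k s) = h (b k t).
Proof.
move=> hst; have [pk|pk] := pselect (0 < p k).
  have [w [z [_ bw]]] := ls_inv S pk.
  by rewrite !bw !(degree_oneDz h1) (fiber_run w hst).
have bE x : b k x = x by rewrite -{2}(ls_ab S k x) a_null.
by rewrite !bE.
Qed.

Definition qa k u := h (a k (leftmost u)).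
Definition qb k u := h (b k (leftmost u)).

Lemma qaE k t : qa k (h t) = h (a k t).
Proof. by apply: fiber; rewrite leftmostK. Qed.

Lemma qbE k t : qb k (h t) = h (b k t).
Proof. by apply: fiberb; rewrite leftmostK. Qed.

Lemma run_qaE w t : run qa (h t) w = h (run a t w).
Proof. by elim: w t => [|k w IH] t //=; rewrite qaE IH. Qed.

Let q_degree_one (c : R -> R) (qc : R -> R) : degree_one c ->
  (forall t, qc (h t) = h (c t)) -> degree_one qc.
Proof.
move=> c1 qcE; split=> [u v uv|u].
  rewrite -(leftmostK u) -(leftmostK v) !qcE.
  have [l|l] := leP (leftmost u) (leftmost v).
    by do 2! apply: degree_one_le => //.
  have uv' : u = v.
    apply/eqP; rewrite eq_le uv /= -(leftmostK u) -(leftmostK v).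
    exact: degree_one_le (ltW l).
  by rewrite uv'.
rewrite -{1}(leftmostK u) -(proj2 h1) qcE (proj2 c1) (proj2 h1) -qcE.
by rewrite leftmostK.
Qed.

Lemma quotient_system : line_system p qa qb.
Proof.
split.
- by move=> k; apply: (q_degree_one (ls_a S k)); exact: qaE.
- by move=> k; apply: (q_degree_one (ls_b S k)); exact: qbE.
- by move=> k u; rewrite -(leftmostK u) qbE qaE (ls_ab S).
- by move=> k u; rewrite -(leftmostK u) qaE qbE (ls_ba S).
- move=> k pk; have [w [z [pw bw]]] := ls_inv S pk; exists w, z; split => // u.
  by rewrite -(leftmostK u) qbE run_qaE bw (degree_oneDz h1).
Qed.

Lemma quotient_stationary : stationary p qa id.
Proof.
by move=> u v; rewrite -[in RHS](leftmostK u) -[in RHS](leftmostK v) -hstat.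
Qed.

Lemma leftmost_act k t : (forall s, s < a k t -> h s < h (a k t)) <->
  (forall s, s < t -> h s < h t).
Proof.
split=> L s st.
  by rewrite -(ls_a_lt quotient_system k) !qaE; apply: L; rewrite (ls_a_lt S).
rewrite -(ls_ab S k s) -!qaE (ls_a_lt quotient_system); apply: L.
by rewrite -(ls_a_lt S k) (ls_ab S).
Qed.

Lemma leftmost_qa k u : a k (leftmost u) = leftmost (qa k u).
Proof.
rewrite /qa [RHS]leftmost_uniq //; apply/leftmost_act => s.
by rewrite leftmostK; exact: leftmost_lt.
Qed.

Lemma leftmostDz u (z : int) : leftmost (u + z%:~R) = leftmost u + z%:~R.
Proof.
rewrite -{1}(leftmostK u) -(degree_oneDz h1) leftmost_uniq // => s su.
rewrite (degree_oneDz h1) leftmostK -ltrBlDr -mulrNz -(degree_oneDz h1) mulrNz.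
by apply: leftmost_lt; lra.
Qed.

(** The left ends of the fibres over a finite invariant set are finitely many modulo 1 and again
    invariant; the full preimage might contain intervals. *)
Lemma quotient_no_finite : (forall F, ~ finite_invariant p a F) ->
  forall F, ~ finite_invariant p qa F.
Proof.
move=> noF F [[u0 Fu0] Ff Fp Fa].
have Fz t (z : int) : F (t + z%:~R) <-> F t.
  have Fn (n : nat) x : F (x + n%:R) <-> F x.
    by elim: n => [|n IH]; rewrite ?addr0 // -natr1 addrA Fp.
  case: z => n; first exact: Fn.
  by rewrite NegzE mulrNz -(Fn n.+1) subrK.
apply: (noF [set t | F (h t) /\ forall s, s < t -> h s < h t]); split.
- by exists (leftmost u0); split=> [|s] /=; rewrite leftmostK //; exact: leftmost_lt.
- have [fr frP] := choice (@frac_part R).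
  apply: (@inj_finite_set _ _ _ _ (fun t => h t + (fr (h t))%:~R) Ff).
    move=> t [[Ft _] _]; split; first by rewrite Fz.
    by rewrite /= in_itv /=; exact: frP.
  move=> s t [[_ Ls] s01] [[_ Lt] t01] e.
  have {}e : h s = h t + (fr (h t) - fr (h s))%:~R by rewrite intrD mulrNz; lra.
  move: e; set z := fr _ - _ => e.
  (* Two left ends with the same value modulo 1 differ by an integer, which is 0 inside a period. *)
  have est : s = t + z%:~R.
    by rewrite -[LHS](leftmost_uniq Ls) e leftmostDz (leftmost_uniq Lt).
  move: s01 t01; rewrite /= !in_itv /= => s01 t01; move: est s01.
  move=> ->; case: (ltgtP z 0) => [z0|z0|->]; last by rewrite addr0.
  - have : z%:~R <= (-1)%:~R :> R by rewrite ler_int; move: z0; rewrite -ltzD1 addNr.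
    rewrite mulrNz; lra.
  - have : 1%:~R <= z%:~R :> R by rewrite ler_int -gtz0_ge1.
    lra.
- move=> t /=; rewrite (proj2 h1) Fp; split=> -[? L]; split=> // s st.
    by have := L (s + 1); rewrite (proj2 h1) => /(_ ltac:(lra)); lra.
  have := L (s - 1); have := proj2 h1 (s - 1); rewrite subrK => -> /(_ ltac:(lra)).
  lra.
- move=> k pk t /=; rewrite -(Fa k pk (h t)) qaE.
  by split=> -[? L]; split=> //; apply/(leftmost_act k t).
Qed.

End Quotient.

Lemma dexp_ext (R : realType) (p : nat -> R) (f g : nat -> R) :
  (forall k, 0 <= p k) -> (forall k, 0 < p k -> f k = g k) -> dexp p f = dexp p g.
Proof.
move=> p0 fg; rewrite /dexp; congr (limn (series _)); apply/funext => k.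
have := p0 k; rewrite le_eqVlt => /orP[/eqP <-|/fg -> //].
by rewrite !mul0r.
Qed.

(** * Dense orbits and rigidity when length is stationary *)

Section Minimal.
Variables (R : realType) (p : nat -> R) (a b : nat -> R -> R).
Hypothesis p_ge0 : forall k, 0 <= p k.
Hypothesis p_sum : series p @ \oo --> (1 : R).
Hypothesis S : line_system p a b.
Hypothesis noF : forall F, ~ finite_invariant p a F.
Hypothesis leb : stationary p a id.

Section Orbit.
Variable s : R.

(** The closure of the orbit of [s] modulo 1. *)
Let K := [set t | forall e, 0 < e -> exists w (z : int),
  posword p w /\ `|run a s w + z%:~R - t| < e].

Let Ks : K s.
Proof. by move=> e e0; exists [::], 0; rewrite /= addr0 subrr normr0. Qed.

Let Kz t (z : int) : K t -> K (t + z%:~R).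
Proof.
move=> Kt e /Kt[w [z' [pw h]]]; exists w, (z' + z); split => //.
by rewrite intrD; have -> : run a s w + (z'%:~R + z%:~R) - (t + z%:~R) =
  run a s w + z'%:~R - t by ring.
Qed.

Let Kclosed t : (forall e, 0 < e -> exists2 t', K t' & `|t' - t| < e) -> K t.
Proof.
move=> Kt e e0; have e2 : 0 < e / 2 by lra.
have [t' Kt' tt'] := Kt _ e2; have [w [z [pw h]]] := Kt' _ e2.
by exists w, z; split => //; move: h tt'; rewrite !ltr_norml; lra.
Qed.

Let Ka k t : 0 < p k -> K t -> K (a k t).
Proof.
move=> pk Kt e e0; have [r r0 ar] := ls_a_cont S k t e0.
have [w [z [pw h]]] := Kt _ r0; exists (rcons w k), z; split.
  by rewrite /posword all_rcons pk.
by rewrite run_rcons -(degree_oneDz (ls_a S k)) ar.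
Qed.

Let Kb k t : 0 < p k -> K t -> K (b k t).
Proof.
move=> pk Kt; have [w [z [pw ->]]] := ls_inv S pk; apply: Kz.
by elim: w t pw Kt => [|i w IH] t //= /andP[pi pw] Kt; apply: IH => //; exact: Ka.
Qed.

(** The nearest point of [K] on the left. As [K] is invariant, the steps commute with [proj]. *)
Let proj t := sup (K `&` [set x | x <= t]).

Let proj_has_sup t : has_sup (K `&` [set x | x <= t]).
Proof.
split; last by exists t => x [].
have [z /andP[_ tz]] := frac_part (s - t).
exists (s + (z - 1)%:~R); split; first exact: Kz.
by rewrite /= intrD mulrNz; lra.
Qed.

Let proj_le t : proj t <= t.
Proof. by apply: ge_sup => [|x []//]; have [] := proj_has_sup t. Qed.

Let proj_max t x : K x -> x <= t -> x <= proj t.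
Proof. by move=> Kx xt; apply: sup_upper_bound. Qed.

Let proj_K t : K (proj t).
Proof.
apply: Kclosed => e e0; have [x [Kx xt] ex] := sup_adherent e0 (proj_has_sup t).
exists x => //; have := proj_max Kx xt; rewrite ltr_norml /proj; lra.
Qed.

Let proj_uniq t x : K x -> x <= t -> (forall y, K y -> y <= t -> y <= x) ->
  proj t = x.
Proof.
move=> Kx xt xm; apply/eqP; rewrite eq_le (proj_max Kx xt) andbT.
by apply: xm; [exact: proj_K|exact: proj_le].
Qed.

Let proj_degree_one : degree_one proj.
Proof.
split=> [x y xy|t].
  by apply: proj_max; [exact: proj_K|apply: le_trans xy; exact: proj_le].
apply: proj_uniq; first exact: (Kz 1 (proj_K t)).
  by rewrite lerD2r proj_le.
move=> y Ky yt; rewrite -lerBlDr; apply: proj_max; last lra.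
exact: (Kz (-1) Ky).
Qed.

Let proj_a k t : 0 < p k -> proj (a k t) = a k (proj t).
Proof.
move=> pk; apply: proj_uniq; first exact: Ka (proj_K t).
  by apply: degree_one_le (proj_le t); exact: ls_a S k.
move=> y Ky ya; rewrite -(ls_ab S k y); apply: degree_one_le; first exact: ls_a S k.
apply: proj_max; first exact: Kb.
by rewrite -(ls_ba S k t); apply: degree_one_le => //; exact: ls_b S k.
Qed.

(** [proj] is stationary because length is and the steps commute with it; so it is continuous, hence
    onto, while its values lie in [K]. *)
Lemma orbit_dense t e : 0 < e -> exists w (z : int),
  posword p w /\ `|run a s w + z%:~R - t| < e.
Proof.
suff : K t by exact.
have pst : stationary p a proj.
  move=> x y; rewrite -leb; apply: dexp_ext => // k pk.
  by rewrite !proj_a.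
have pc := stationary_cont p_ge0 p_sum S noF proj_degree_one pst.
by have [t' <-] := degree_one_surj proj_degree_one pc t; exact: proj_K.
Qed.

End Orbit.

Lemma leb_lip k s t : s <= t -> p k * (a k t - a k s) <= t - s.
Proof.
move=> st; rewrite -[leRHS](leb s t); apply: (@dexp_ge_term _ _ p_ge0 p_sum (fun k => a k t - a k s)).
  exists (`|t| + `|s| + 2) => i; exact: degree_one_bound2 (ls_a S i).
by move=> i; rewrite subr_ge0; apply: degree_one_le st; exact: ls_a S i.
Qed.

Lemma leb_lip_norm k s t : 0 < p k -> `|a k t - a k s| <= `|t - s| / p k.
Proof.
move=> pk; rewrite ler_pdivlMr //.
wlog st : s t / s <= t.
  move=> W; have [/W //|/ltW /W] := leP s t.
  by rewrite distrC [`|s - t|]distrC.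
have am := degree_one_le (ls_a S k) st.
by rewrite !ger0_norm ?subr_ge0 // mulrC leb_lip.
Qed.

Hypothesis not_translations :
  ~ forall k, 0 < p k -> exists c, forall t, a k t = t + c.

Let commutes th s := forall w, posword p w -> run a (s + th) w = run a s w + th.

(** The relation holds along the orbit of [s], which is dense, and [a k] is Lipschitz. *)
Let commutes_all th s k t : commutes th s -> 0 < p k -> a k (t + th) = a k t + th.
Proof.
move=> cs pk; apply/eqP; rewrite -subr_eq0 -normr_le0; apply/ler_addgt0Pr => e e0.
rewrite add0r.
(* The Lipschitz constant is [1 / p k], so each of the two errors is at most [e / 2]. *)
have ep : 0 < e * p k / 2 by rewrite divr_gt0 // mulr_gt0.
have [w [z [pw tw]]] := orbit_dense s t ep.
pose y := run a s w + z%:~R.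
have ey : a k (y + th) = a k y + th.
  have := cs (rcons w k); rewrite !run_rcons /posword all_rcons pk => /(_ pw).
  rewrite cs // /y addrAC !(degree_oneDz (ls_a S k)) => ->; ring.
have l1 := leb_lip_norm (y + th) (t + th) pk; have l2 := leb_lip_norm t y pk.
have e1 : `|y - t| / p k <= e / 2.
  by rewrite ler_pdivrMr //; rewrite -/y in tw; lra.
have -> : a k (t + th) - (a k t + th) =
  (a k (t + th) - a k (y + th)) + (a k y - a k t) by rewrite ey; ring.
rewrite (le_trans (ler_normD _ _)) //.
move: l1; have -> : t + th - (y + th) = - (y - t) by ring.
rewrite normrN; lra.
Qed.

Let commutes_n th s k t n : commutes th s -> 0 < p k ->
  a k (t + th *+ n) = a k t + th *+ n.
Proof.
move=> cs pk; elim: n => [|n IH]; first by rewrite !mulr0n !addr0.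
by rewrite mulrSr addrA (commutes_all _ cs) // IH addrA.
Qed.

(** Otherwise each step of positive mass commutes with arbitrarily small translations, then with
    their multiples, and is itself a translation by monotonicity. *)
Lemma rigid_gap : exists2 c : R, 0 < c <= 1 & forall th s : R, 0 < th <= c ->
  exists2 w, posword p w & run a (s + th) w <> run a s w + th.
Proof.
apply: contrapT => nex; apply: not_translations => k pk.
exists (a k 0) => t.
have small e : 0 < e -> exists th s, [/\ 0 < th, th < e & commutes th s].
  move=> e0; apply: contrapT => nth; apply: nex.
  exists (Num.min 1 (e / 2)).
    by rewrite lt_min ge_min ltr01 lexx /=; lra.
  move=> th s /andP[th0]; rewrite le_min => /andP[_ the].
  apply: contrapT => nw; apply: nth; exists th, s; split=> //; first lra.
  by move=> w pw; apply: contrapT => nq; apply: nw; exists w.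
have main u v : 0 <= v -> a k (u + v) = a k u + v.
  move=> v0; apply/eqP; rewrite -subr_eq0 -normr_le0; apply/ler_addgt0Pr => e e0.
  rewrite add0r; have [th [s [th0 the cs]]] := small e e0.
  have := truncn_itv (divr_ge0 v0 (ltW th0)); set n := Num.truncn _.
  rewrite ler_pdivlMr // ltr_pdivrMr // => /andP[n1 n2].
  have m1 : a k u + th *+ n <= a k (u + v).
    rewrite -(commutes_n _ _ cs) //; apply: degree_one_le; first exact: ls_a S k.
    by rewrite -mulr_natl; lra.
  have m2 : a k (u + v) <= a k u + th *+ n.+1.
    rewrite -(commutes_n _ _ cs) //; apply: degree_one_le; first exact: ls_a S k.
    by rewrite -mulr_natl; lra.
  move: m1 m2 n1 n2; rewrite -[th *+ n]mulr_natl -[th *+ n.+1]mulr_natl -natr1.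
  by rewrite ler_norml; nra.
have [t0|t0] := leP 0 t; first by rewrite -{1}(add0r t) main // addrC.
have := main t (- t); rewrite subrr => ->; [lra|lra].
Qed.

End Minimal.

(** * Contraction of gaps *)

Lemma sqr_perturb (R : realType) (A B d : R) : `|B| <= 4 -> d <= 1 ->
  `|A - B| <= 4 * d -> A ^+ 2 <= B ^+ 2 + 48 * d.
Proof.
move=> B4 d1 AB; rewrite -lerBlDl subr_sqr.
apply: (le_trans (ler_norm _)); rewrite normrM.
have -> : 48 * d = (4 * d) * 12 by ring.
apply: ler_pM => //; have := ler_normD (A - B) (2 * B).
have -> : A - B + 2 * B = A + B by ring.
by rewrite normrM (@ger0_norm _ 2) //; lra.
Qed.

(** The sum telescopes to the last [m] terms minus the first [m]. *)
Lemma sum_increments_le (R : realType) (d : nat -> R) m N :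
  (forall n, 0 <= d n <= 1) -> \sum_(n < N) (d (n + m)%N - d n) <= m%:R.
Proof.
move=> d01; elim: m => [|m IH].
  by rewrite big1 // => n _; rewrite addn0 subrr.
have -> : \sum_(n < N) (d (n + m.+1)%N - d n) =
  \sum_(n < N) (d (n + m)%N - d n) + (d (N + m)%N - d m).
  elim: N {IH} => [|N IH]; first by rewrite !big_ord0 subrr addr0.
  rewrite !big_ord_recr {}IH /=.
  have -> : (N + m.+1 = N.+1 + m)%N by rewrite addnS.
  ring.
have := d01 (N + m)%N; have := d01 m.
by rewrite -natr1; lra.
Qed.

Section PairWalk.
Variables (R : realType) (p : nat -> R) (a b : nat -> R -> R).
Hypothesis p_ge0 : forall k, 0 <= p k.
Hypothesis p_sum : series p @ \oo --> (1 : R).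
Hypothesis S : line_system p a b.
Hypothesis leb : stationary p a id.
Variable c : R.
Hypothesis c01 : 0 < c <= 1.
Hypothesis gapc : forall th s : R, 0 < th <= c ->
  exists2 w, posword p w & run a (s + th) w <> run a s w + th.

Let E := dmean p_ge0 p_sum.

Definition act2 k (x : R * R) := (a k x.1, a k x.2).
Definition short : set (R * R) := [set x | 0 <= x.2 - x.1 <= 1].

(* truncated so as to be bounded on all of R * R *)
Definition gap (x : R * R) : R := Num.min 1 (Num.max 0 (x.2 - x.1)).

Lemma gap_itv x : 0 <= gap x <= 1.
Proof. by rewrite /gap; case: (leP 0 (x.2 - x.1)) => h1;
  case: (leP 1) => h2; lra. Qed.

Lemma gap_short x : short x -> gap x = x.2 - x.1.
Proof.
move=> /andP[x0 x1]; rewrite /gap; case: (leP 0 (x.2 - x.1)) => h1;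
  case: (leP 1) => h2; lra.
Qed.

Lemma gap_bnd : bnd gap.
Proof. exact: bnd_itv gap_itv. Qed.

Lemma short_act2 k x : short x -> short (act2 k x).
Proof.
move=> /andP[x0 x1]; rewrite /short /=.
by apply: (degree_one_diff (ls_a S k) (n := 1)); lra.
Qed.

Lemma short_run w x : short x -> short (run act2 x w).
Proof. by elim: w x => [|k w IH] x //= sx; apply: IH; exact: short_act2. Qed.

Lemma run_act2 w x : run act2 x w = (run a x.1 w, run a x.2 w).
Proof. by elim: w x => [|k w IH] [x y] //=; rewrite IH. Qed.

Let W n f x := walk E act2 n f x.

Lemma expect_gap x : short x -> E (fun k => gap (act2 k x)) = gap x.
Proof.
move=> sx; rewrite (gap_short sx) -[RHS](leb x.1 x.2); congr (dexp p _).
by apply/funext => k; rewrite gap_short //; exact: short_act2.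
Qed.

Lemma walk_gap n x : short x -> W n gap x = gap x.
Proof.
elim: n x => [|n IH] x sx //; rewrite /W /= -[RHS](expect_gap sx).
by congr (expect E _); apply/funext => k; apply: IH; exact: short_act2.
Qed.

Lemma walk_gap_markov n (d : R) x : short x -> 0 < d ->
  W n (fun y => (d <= gap y)%R%:R) x <= gap x / d.
Proof.
move=> sx d0; rewrite mulrC -(walk_gap n sx) -walkZ; last exact: gap_bnd.
apply: walk_le; [exact: bnd_bool|exact: bndZ gap_bnd|] => y.
rewrite mulrC ler_pdivlMr //; have /andP[g0 _] := gap_itv y.
by case: (leP d (gap y)); rewrite /= ?mul1r ?mul0r.
Qed.

Let sq y := gap y ^+ 2.

Let sq_itv y : 0 <= sq y <= 1.
Proof. by have := gap_itv y; rewrite /sq; nra. Qed.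

Let sq_bnd : bnd sq.
Proof. exact: bnd_itv sq_itv. Qed.

Let dev_bnd g : bnd (fun y => (gap y - g) ^+ 2).
Proof.
have -> : (fun y => (gap y - g) ^+ 2) =
  (fun y => (gap y - g) * (gap y - g)) by apply/funext => y; rewrite expr2.
have gb := gap_bnd.
by apply: bndM; apply: bndB => //; exact: bnd_cst.
Qed.

Lemma walk_gap_var n x : short x ->
  W n (fun y => (gap y - gap x) ^+ 2) x = W n sq x - sq x.
Proof.
move=> sx; have gb := gap_bnd.
have -> : (fun y => (gap y - gap x) ^+ 2) =
  (fun y => (sq y - 2 * gap x * gap y) + gap x ^+ 2).
  by apply/funext => y; rewrite /sq; ring.
rewrite /W walkD; [|apply: bndB => //; exact: bndZ|exact: bnd_cst].
rewrite walkB //; last exact: bndZ.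
rewrite walkZ // walk_cst -/(W n gap x) walk_gap // /sq; ring.
Qed.

Lemma walk_sq_ge n x : short x -> sq x <= W n sq x.
Proof.
move=> sx; rewrite -subr_ge0 -walk_gap_var //.
rewrite -[leLHS](walk_cst E act2 n 0 x); apply: walk_le => //; first exact: bnd_cst.
by move=> y; exact: sqr_ge0.
Qed.

Lemma walk_sq_mono m n x : short x -> W m sq x <= W (m + n) sq x.
Proof.
move=> sx; rewrite /W walk_add.
apply: (@walk_le_on _ _ _ E act2 short _ _ _ short_act2) => //; first exact: walk_bnd.
by move=> y; exact: walk_sq_ge.
Qed.

Lemma walk_sq_itv n x : 0 <= W n sq x <= 1.
Proof. exact: walk_itv sq_itv. Qed.

(** Compactness: pairs with variances tending to 0 would accumulate at a pair with gap between [eta]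
    and [c] that no word changes. *)
Lemma variance_ge (eta : R) : 0 < eta -> exists n (kap : R), 0 < kap /\
  forall x, short x -> eta <= gap x <= c -> kap <= W n sq x - sq x.
Proof.
move=> eta0; apply: contrapT => nex.
have ex i : exists x, [/\ 0 <= x.1 <= 1, short x, eta <= gap x <= c &
    W i sq x - sq x < invS R i].
  apply: contrapT => nx; apply: nex; exists i, (invS R i); split.
    exact: invS_gt0.
  move=> x sx gx; rewrite leNgt; apply/negP => lx; apply: nx.
  (* An integer translation brings the pair into a bounded region without changing any gap. *)
  have [z xz] := frac_part x.1.
  pose T (y : R * R) := (y.1 + z%:~R, y.2 + z%:~R).
  have gT y : gap (T y) = gap y by rewrite /gap /=; congr (Num.min _ (Num.max _ _)); ring.
  exists (T x); rewrite gT; split => //=; first lra.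
    by move: sx; rewrite /short /= => /andP[? ?]; apply/andP; split; lra.
  rewrite /sq gT -/(sq x).
  suff -> : W i sq (T x) = W i sq x by [].
  rewrite /W -(@walk_map _ _ _ _ E act2 act2 T sq i x); last first.
    by move=> k y; rewrite /T /act2 /= !(degree_oneDz (ls_a S k)).
  by congr (walk E act2 i _ x); apply/funext => y; rewrite /sq gT.
have [u uP] := choice ex.
pose s i := (u i).1; pose t i := (u i).2.
have sb : bnd s by apply: (@bnd_itv _ _ 0 1) => i; have [] := uP i.
have tb : bnd t.
  apply: (@bnd_itv _ _ 0 2) => i; have [s01 /andP[]] := uP i.
  by rewrite /t; lra.
have gE i : gap (u i) = t i - s i by have [_ su _ _] := uP i; rewrite gap_short.
pose th := ulim t - ulim s.
have thE : th = ulim (fun i => t i - s i) by rewrite ulimB.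
have thc : eta <= th <= c.
  by rewrite thE; apply: ulim_itv => i; rewrite -gE; have [] := uP i.
have [|w pw] := gapc (th := th) (ulim s); first by lra.
apply.
have -> : ulim s + th = ulim t by rewrite /th; ring.
pose q := \prod_(k <- w) p k.
have q0 : 0 < q := posword_gt0 pw.
have cont x e := @run_cont _ _ _ _ S w x e.
(* The word [w] alone contributes [q] times its squared deviation, and the variance grows with time,
   so the bound [invS i] applies once [i] reaches the length of [w]. *)
have dev0 : forall i, (size w <= i)%N ->
    q * (run a (t i) w - run a (s i) w - (t i - s i)) ^+ 2 <= invS R i.
  move=> i wi; have [_ sui _ /ltW ui] := uP i; apply: le_trans ui.
  apply: (@le_trans _ _ (W (size w) sq (u i) - sq (u i))); last first.
    by rewrite lerD2r; have := walk_sq_mono (size w) (i - size w) sui; rewrite subnKC.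
  rewrite -walk_gap_var // -gE.
  have := @walk_ge_word _ _ p_ge0 p_sum _ act2 w
     (fun y => (gap y - gap (u i)) ^+ 2) (u i) (dev_bnd _) (fun y => sqr_ge0 _).
  rewrite -/q -/E gap_short; last exact: short_run.
  by rewrite run_act2.
set z := run a (ulim t) w; set y := run a (ulim s) w.
apply/eqP; rewrite -subr_eq0 -sqrf_eq0; apply/eqP/eqP; rewrite eq_le sqr_ge0 andbT.
rewrite -(ler_pM2l q0) mulr0; apply/ler_addgt0Pr => e e0; rewrite add0r.
(* [sqr_perturb] costs [48 * dl], and [q] times this must stay below [e / 2]. *)
have [dl [dl0 dl1 dle]] : exists dl : R,
    [/\ 0 < dl, dl <= 1 & dl * (100 * (q + 1)) <= e].
  exists (Num.min 1 (e / (100 * (q + 1)))); split.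
  - by rewrite lt_min ltr01 /= divr_gt0 //; lra.
  - by rewrite ge_min lexx.
  - rewrite -ler_pdivlMr; last lra.
    by rewrite ge_min lexx orbT.
have [r1 r10 c1] := cont (ulim s) dl dl0.
have [r2 r20 c2] := cont (ulim t) dl dl0.
have r0 : 0 < Num.min dl (Num.min r1 r2) by rewrite !lt_min dl0 r10.
have e2 : 0 < e / 2 by lra.
have [i [[[us ut] ie] iw]] := uoo_ex (filterI (filterI (filterI
  (ulim_near sb r0) (ulim_near tb r0)) (uoo_invS e2)) (uoo_ge (size w))).
have := dev0 i iw; move: us ut ie => /=; rewrite !lt_min.
move=> /and3P[s1 s2 _] /and3P[t1 _ t3] ie.
have := c1 (s i); rewrite distrC => /(_ s2).
have := c2 (t i); rewrite distrC => /(_ t3).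
rewrite -/z -/y; move: s1 t1 thc; rewrite /th.
set zi := run a (t i) w; set yi := run a (s i) w.
rewrite !ltr_norml => s1 t1 thc z1 y1 dv.
have b1 : `|zi - yi - (t i - s i)| <= 4.
  have [_ sui gc _] := uP i; have := short_run w sui; rewrite run_act2.
  rewrite gE in gc.
  rewrite /short /= -/(t i) -/(s i) -/zi -/yi => zy; rewrite ler_norml.
  by move: (c01) eta0 gc zy; lra.
(* Four points move by less than [dl] each. *)
have b2 : `|(z - (y + (ulim t - ulim s))) - (zi - yi - (t i - s i))| <= 4 * dl.
  by rewrite ler_norml; lra.
have dd : z - (y + th) = z - (y + (ulim t - ulim s)) by [].
rewrite dd; move: b1 b2 dv; set A := z - _; set B := zi - _ - _ => b1 b2 dv.
have := ler_wpM2l (ltW q0) (sqr_perturb b1 dl1 b2); rewrite mulrDr.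
have : q * (48 * dl) <= e / 2.
  have : 0 <= q * dl by rewrite mulr_ge0 // ltW.
  move: dle; rewrite mulrDr mulr1 mulrDr; lra.
clear - dv ie; lra.
Qed.

(** Each visit raises the mean of the squared gap by [kap] over the next [m] steps, while these
    increments sum to at most [m]. *)
Lemma visits_bound (eta : R) : 0 < eta -> exists B, forall x N, short x ->
  \sum_(n < N) W n (fun y => (eta <= gap y <= c)%R%:R) x <= B.
Proof.
move=> eta0; have [m [kap [kap0 kP]]] := variance_ge eta0.
exists (m%:R / kap) => x N sx.
rewrite ler_pdivlMr // mulr_suml.
apply: (@le_trans _ _ (\sum_(n < N) (W (n + m) sq x - W n sq x))).
  apply: ler_sum => n _; rewrite /W walk_add -walkB //; last exact: walk_bnd.
  rewrite mulrC -walkZ; last exact: bnd_bool.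
  apply: (@walk_le_on _ _ _ E act2 short _ _ _ short_act2) => //.
  - by apply: bndZ; exact: bnd_bool.
  - by apply: bndB => //; exact: walk_bnd.
  move=> y sy; case: (boolP (eta <= gap y <= c)) => [gy|_] /=.
    by rewrite mulr1; exact: kP.
  by rewrite mulr0 subr_ge0; exact: walk_sq_ge.
apply: (@sum_increments_le _ (fun n => W n sq x)) => n; exact: walk_sq_itv.
Qed.

(** Martingale increments are orthogonal, so their mean squares add up to at most 1; Chebyshev
    concludes. *)
Lemma jumps_bound (d : R) x N : 0 < d -> short x ->
  \sum_(n < N) W n (fun y => E (fun k => (d <= `|gap (act2 k y) - gap y|)%R%:R)) x
    <= d ^- 2.
Proof.
move=> d0 sx.
have d2 : 0 < d ^+ 2 by rewrite exprn_gt0.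
pose f y := E (fun k => (d <= `|gap (act2 k y) - gap y|)%R%:R).
have fb : bnd f.
  apply: (@bnd_itv _ _ 0 1) => y; apply: expect_itv => k.
  exact: ind_itv.
rewrite -[leRHS]mul1r ler_pdivlMr // mulr_suml.
apply: (@le_trans _ _ (\sum_(n < N) (W n.+1 sq x - W n sq x))).
  apply: ler_sum => n _; have -> : W n.+1 sq x = W n (W 1 sq) x.
    by rewrite /W -[RHS](walk_add E act2 n 1) addn1.
  rewrite -/f /W -walkB //; last exact: walk_bnd.
  rewrite mulrC -walkZ //; apply: (@walk_le_on _ _ _ E act2 short _ _ _ short_act2) => //.
  - exact: bndZ.
  - by apply: bndB => //; exact: walk_bnd.
  move=> y sy; have := walk_gap_var 1 sy; rewrite /W => <- /=.
  rewrite /f -expectZ; last exact: bnd_bool.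
  apply: expect_le => [||k].
  - by apply: bndZ; exact: bnd_bool.
  - exact: (bnd_comp (fun k => act2 k y) (dev_bnd _)).
  case: (leP d) => /= dg; last by rewrite mulr0 sqr_ge0.
  by rewrite mulr1 -[leRHS](real_normK (num_real _)) lerXn2r ?nnegrE // ltW.
elim: N => [|N IH]; first by rewrite big_ord0 ler01.
have -> : forall M, \sum_(n < M) (W n.+1 sq x - W n sq x) = W M sq x - sq x.
  by elim=> [|M IHM]; rewrite ?big_ord0 ?big_ord_recr /= ?IHM /W /=; ring.
by have := walk_sq_itv N.+1 x; have := sq_itv x; lra.
Qed.

(** By [visits_bound] there is an early time at which the gap is unlikely to be in [[e1, c]];
    exceeding [c] is unlikely by Markov, and so is growing from below [e1] to [eta]. Each of the
    three costs [dl]. *)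
Lemma contraction (dl : R) : 0 < dl -> exists rho : R, [/\ 0 < rho,
  rho * 2 <= 1 & forall eta, 0 < eta -> exists N0, forall n x, (N0 <= n)%N ->
  W n (fun y => (eta <= gap y)%R%:R) (x - rho, x + rho) <= 3 * dl].
Proof.
move=> dl0.
have [cpos c1] := andP c01.
(* The arc has length [rho * 2 <= dl * c], so Markov bounds the probability of a gap at least [c] by
   [dl]. *)
pose rho := Num.min (1 / 2) (dl * c / 2).
have rho0 : 0 < rho by rewrite lt_min; apply/andP; split; nra.
have rho1 : rho * 2 <= 1 by rewrite /rho -ler_pdivlMr // ge_min lexx.
have rho2 : rho * 2 <= dl * c by rewrite /rho -ler_pdivlMr // ge_min lexx orbT.
exists rho; split=> // eta eta0.
(* Markov from a gap below [dl * eta] bounds the probability of reaching [eta] by [dl]. *)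
pose e1 := dl * eta; have e10 : 0 < e1 by rewrite mulr_gt0.
have [B BP] := visits_bound e10.
pose N0 := (Num.truncn (`|B| / dl)).+1.
have N0P : B < N0%:R * dl.
  rewrite -ltr_pdivrMr //; have := truncn_itv (divr_ge0 (normr_ge0 B) (ltW dl0)).
  move=> /andP[_]; apply: le_lt_trans.
  by rewrite ler_pM2r ?invr_gt0 ?ler_norm.
exists N0 => n x Nn; set X := (_, _).
have sX : short X by rewrite /short /=; lra.
have gX : gap X = rho * 2 by rewrite gap_short //=; ring.
have ibnd (P : R * R -> bool) : bnd (fun y => (P y)%:R : R) by exact: bnd_bool.
have [m mN0 mP] : exists2 m, (m < N0)%N &
    W m (fun y => (e1 <= gap y <= c)%R%:R) X <= dl.
  apply: contrapT => nm; have := BP X N0 sX; rewrite leNgt => /negP; apply.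
  apply: (lt_le_trans N0P).
  rewrite mulr_natl -[X in _ *+ X]card_ord -sumr_const; apply: ler_sum => m _.
  by rewrite leNgt; apply/negP => /ltW mm; apply: nm; exists m.
have big : W m (fun y => (e1 <= gap y)%R%:R) X <= 2 * dl.
  apply: (@le_trans _ _ (W m (fun y => (e1 <= gap y <= c)%R%:R + (c <= gap y)%R%:R) X)).
    apply: walk_le => //; first exact: bndD.
    move=> y; case: (leP e1) => //= _; last by rewrite addr_ge0.
    by case: (leP (gap y) c) => [_|/ltW ->] /=; rewrite ?lerDl // add0r.
  rewrite /W walkD // -/(W _ _ _).
  have : W m (fun y => (c <= gap y)%R%:R) X <= dl.
    by apply: (le_trans (walk_gap_markov m sX cpos)); rewrite gX ler_pdivrMr.
  by rewrite /W; move: mP; rewrite /W; lra.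
have mn : (m <= n)%N by rewrite (leq_trans (ltnW mN0)).
rewrite -(subnKC mn) /W walk_add.
apply: (@le_trans _ _ (W m (fun y => (e1 <= gap y)%R%:R + dl) X)).
  apply: (@walk_le_on _ _ _ E act2 short _ _ _ short_act2) => //; first exact: walk_bnd.
    by apply: bndD => //; exact: bnd_cst.
  move=> y sy; case: (leP e1 (gap y)) => /= ey.
    have /andP[_ +] : 0 <= walk E act2 (n - m) (fun y => (eta <= gap y)%R%:R) y <= 1.
      by apply: walk_itv => u; exact: ind_itv.
    by move=> h; apply: (le_trans h); rewrite lerDl ltW.
  apply: (le_trans (walk_gap_markov (n - m) sy eta0)); rewrite add0r.
  by rewrite ler_pdivrMr //; apply: ltW.
rewrite /W walkD //; last exact: bnd_cst.
by rewrite walk_cst -/(W _ _ _); lra.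
Qed.

End PairWalk.

(** * Equidistribution *)

Definition hits (R : realType) (v eta x : R) : bool :=
  `[< exists z : int, `|x + z%:~R - v| <= eta >].

Section Equidistribution.
Variables (R : realType) (p : nat -> R) (a b : nat -> R -> R).
Hypothesis p_ge0 : forall k, 0 <= p k.
Hypothesis p_sum : series p @ \oo --> (1 : R).
Hypothesis S : line_system p a b.
Hypothesis noF : forall F, ~ finite_invariant p a F.

Let E := dmean p_ge0 p_sum.

(* number of points of y + Z in [s, t[ *)
Definition count (s t y : R) : R := (Num.ceil (t - y) - Num.ceil (s - y))%:~R.

(** Ceilings locate integer translates, and [b k] carries those of [a k y] to those of [y] in
    order. *)
Lemma ceil_act k t y : Num.ceil (t - a k y) = Num.ceil (b k t - y).
Proof.
suff e z : (Num.ceil (t - a k y) <= z) = (Num.ceil (b k t - y) <= z).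
  by apply/eqP; rewrite eq_le; apply/andP; split; [rewrite e|rewrite -e].
rewrite !ceil_le_int !lerBlDr ![z%:~R + _]addrC -(degree_oneDz (ls_a S k)).
apply/idP/idP => [/(degree_one_le (ls_b S k))|/(degree_one_le (ls_a S k))].
  by rewrite (ls_ba S).
by rewrite (ls_ab S).
Qed.

Lemma count_act k s t y : count s t (a k y) = count (b k s) (b k t) y.
Proof. by rewrite /count !ceil_act. Qed.

Lemma count_degree_one s y : degree_one (count s ^~ y).
Proof.
split=> [t t' tt'|t].
  by rewrite /count ler_int lerD2r le_ceil // lerD2r.
have -> : count s (t + 1) y = (Num.ceil (t - y + 1) - Num.ceil (s - y))%:~R.
  by rewrite /count; congr ((Num.ceil _ - _)%:~R); ring.
by rewrite ceilDrz ?num1 ?rpred1 // ceil1 /count !intrD; ring.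
Qed.

Lemma countB s t u y : count u t y - count u s y = count s t y.
Proof. by rewrite /count !intrD !mulrNz; ring. Qed.

Lemma count_norm s t y : `|count s t y| <= `|t| + `|s| + 2.
Proof. by rewrite -(countB s t 0); exact: degree_one_bound2 (count_degree_one 0 y). Qed.

Lemma count_bnd s t : bnd (count s t).
Proof. by exists (`|t| + `|s| + 2) => y; exact: count_norm. Qed.

Section Limit.
Variables (K : nat -> nat) (x : nat -> R).
Hypothesis Ki : forall i, (i < K i)%N.

(** Distribution function of the law of the walk from [x i], averaged over the times below [K i]. *)
Let avg i t := (K i)%:R^-1 * \sum_(j < K i) walk E a j (count 0 t) (x i).

Let K0 i : 0 < (K i)%:R :> R.
Proof. by rewrite ltr0n (leq_ltn_trans _ (Ki i)). Qed.

Let Kinv0 i : 0 < (K i)%:R^-1 :> R.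
Proof. by rewrite invr_gt0. Qed.

Let avgB i s t : avg i t - avg i s =
  (K i)%:R^-1 * \sum_(j < K i) walk E a j (count s t) (x i).
Proof.
rewrite /avg -mulrBr -sumrB; congr (_ * _); apply: eq_bigr => j _.
rewrite -walkB; [|exact: count_bnd..]; congr (walk E a j _ _).
by apply/funext => y; exact: countB.
Qed.

Let avg_degree_one i : degree_one (avg i).
Proof.
split=> [s t st|t].
  rewrite ler_pM2l ?invr_gt0 //; apply: ler_sum => j _; apply: walk_le.
  - exact: count_bnd.
  - exact: count_bnd.
  by move=> y; exact: degree_one_le (count_degree_one 0 y) _ _ st.
apply/eqP; rewrite [avg i t + 1]addrC -subr_eq avgB; apply/eqP.
have -> : \sum_(j < K i) walk E a j (count t (t + 1)) (x i) = (K i)%:R.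
  rewrite -[RHS]mulr1 mulr_natl -[X in _ *+ X]card_ord -sumr_const.
  apply: eq_bigr => j _; rewrite -[RHS](walk_cst E a j 1 (x i)).
  congr (walk E a j _ _); apply/funext => y.
  by rewrite -(countB _ _ 0) (proj2 (count_degree_one 0 y)); ring.
by rewrite mulVf // gt_eqF.
Qed.

Let avg_norm i t : `|avg i t| <= `|t| + 2.
Proof.
rewrite normrM (gtr0_norm (Kinv0 i)) mulrC ler_pdivrMr //.
rewrite (le_trans (ler_norm_sum _ _ _)) // mulr_natr -[X in _ *+ X]card_ord -sumr_const.
apply: ler_sum => j _; apply: walk_norm => y.
by have := count_norm 0 t y; rewrite normr0 addr0.
Qed.

Let avg_bnd t : bnd (avg ^~ t).
Proof. by exists (`|t| + 2) => i; exact: avg_norm. Qed.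

Definition limit_law t := ulim (avg ^~ t).

Lemma limit_law_degree_one : degree_one limit_law.
Proof.
split=> [s t st|t].
  apply: ulim_le => //; apply: filterE => i.
  exact: degree_one_le (avg_degree_one i) _ _ st.
rewrite /limit_law -[X in _ = _ + X]ulim_cst -ulimD //; last exact: bnd_cst.
by congr ulim; apply/funext => i; rewrite (proj2 (avg_degree_one i)).
Qed.

(** Averaging over [K i] times makes the law invariant up to [O(1 / K i)]. The measure of an
    interval under the stepped law is that of its preimages, which is why [b] appears. *)
Lemma limit_law_stationary : stationary p b limit_law.
Proof.
move=> s t.
have -> : (fun k => limit_law (b k t) - limit_law (b k s)) =
    (fun k => ulim (fun i => avg i (b k t) - avg i (b k s))).
  by apply/funext => k; rewrite ulimB.
rewrite (@dexp_ulim _ _ p_ge0 p_sum _ (`|t| + `|s| + 2)); last first.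
  move=> i k.
  exact: degree_one_bound2 (degree_one_comp (avg_degree_one i) (ls_b S k)).
pose d i := walk E a (K i) (count s t) (x i) - count s t (x i).
have cab k y : `|count (b k s) (b k t) y| <= `|t| + `|s| + 2.
  by rewrite -count_act; exact: count_norm.
have -> : (fun i => dexp p (fun k => avg i (b k t) - avg i (b k s))) =
    (fun i => (avg i t - avg i s) + (K i)%:R^-1 * d i).
  apply/funext => i; under eq_fun do rewrite avgB.
  rewrite -[LHS]/(E _) expectZ; last first.
    apply: (bnd_sum (K i) (F := fun j k => walk E a j (count (b k s) (b k t)) (x i))) => j.
    by exists (`|t| + `|s| + 2) => k; exact: walk_norm.
  rewrite (@expect_sum _ _ E (K i)
    (fun j k => walk E a j (count (b k s) (b k t)) (x i))); last first.
    by move=> j; exists (`|t| + `|s| + 2) => k; exact: walk_norm.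
  rewrite avgB -mulrDr; congr (_ * _).
  rewrite -(sum_shift (fun j => walk E a j (count s t) (x i))).
  apply: eq_bigr => j _; rewrite (walk_exchange p_ge0 p_sum p_ge0 p_sum a j (x i) cab) -addn1 walk_add.
  congr (walk E a j _ _); apply/funext => y /=.
  by congr (expect E _); apply/funext => k; rewrite count_act.
pose B := 2 * (`|t| + `|s| + 2).
have B0 : 0 < B by have := normr_ge0 t; have := normr_ge0 s; rewrite /B; lra.
have db i : `|d i| <= B.
  have := walk_norm E a (K i) (x i) (count_norm s t); have := count_norm s t (x i).
  by rewrite !ler_norml /d /B; lra.
have Kinv i : (K i)%:R^-1 <= invS R i by rewrite lef_pV2 ?posrE // ler_nat.
rewrite ulimD; last 1 first.
- exists B => i.
  rewrite normrM (gtr0_norm (Kinv0 i)) -[leRHS]mul1r ler_pM ?invr_ge0 //.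
  exact: le_trans (Kinv i) (invS_le1 R i).
- rewrite ulimB //; suff -> : ulim (fun i => (K i)%:R^-1 * d i) = 0 by rewrite addr0.
  apply: ulimE; apply/cvgrPdist_lt => e e0.
  have eB : 0 < e / B by rewrite divr_gt0.
  apply: filterS (uoo_invS eB) => i /= ie.
  rewrite sub0r normrN normrM (gtr0_norm (Kinv0 i)).
  apply: (@le_lt_trans _ _ (invS R i * B)); first by rewrite ler_pM ?invr_ge0.
  by rewrite -ltr_pdivlMr.
- exact: bndB.
Qed.

(** For [uoo]-most [i] the window around [v i] lies in the fixed window of radius [s] around the
    limit, whose mass is below [dl]. *)
Lemma limit_law_hits s (dl : R) (v : nat -> R) : bnd v -> 0 < dl ->
  limit_law (ulim v + s) - limit_law (ulim v - s) < dl -> 0 < s ->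
  exists i, \sum_(j < K i) walk E a j (fun y => (hits (v i) (invS R i) y)%:R) (x i)
    <= dl * (K i)%:R.
Proof.
move=> vb dl0 small s0; set v' := ulim v in small *.
apply: contrapT => nex.
suff : dl <= limit_law (v' + s) - limit_law (v' - s) by lra.
rewrite -ulimB // -[leLHS]ulim_cst; apply: ulim_le; [exact: bnd_cst|exact: bndB|].
have s2 : 0 < s / 2 by lra.
apply: filterS (filterI (ulim_near vb s2) (uoo_invS s2)) => i /= [vi is2].
rewrite avgB mulrC ler_pdivlMr //.
have /ltW : dl * (K i)%:R < \sum_(j < K i)
    walk E a j (fun y => (hits (v i) (invS R i) y)%:R) (x i).
  by rewrite ltNge; apply/negP => le; apply: nex; exists i.
move=> /le_trans; apply; apply: ler_sum => j _.
apply: walk_le; [exact: bnd_bool|exact: count_bnd|] => y.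
case: (boolP (hits _ _ _)) => [/asboolP[z hz]|_] /=; last first.
  rewrite /count ler0z subr_ge0 le_ceil // lerD2r; lra.
move: vi hz; rewrite ltr_norml ler_norml => vi hz.
have c1 : Num.ceil (v' - s - y) <= z by rewrite ceil_le_int /v'; lra.
have c2 : z < Num.ceil (v' + s - y) by rewrite ceil_gt_int /v'; lra.
by rewrite /count ler1z -gtz0_ge1 subr_gt0 (le_lt_trans c1).
Qed.

End Limit.

Lemma hits_perz (v eta x : R) (z : int) : hits (v + z%:~R) eta x = hits v eta x.
Proof.
apply/asboolP/asboolP => -[z' h].
  by exists (z' - z); rewrite intrD mulrNz; move: h; congr (`|_| <= _); ring.
by exists (z' + z); rewrite intrD; move: h; congr (`|_| <= _); ring.
Qed.

(** Counterexamples at all scales would produce a limit law with an atom of mass at least [dl];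
    being stationary for [b], it has none. *)
Lemma cesaro_hits (dl : R) : 0 < dl -> exists (eta : R) K0, 0 < eta /\
  forall K x v, (K0 < K)%N ->
  \sum_(j < K) walk E a j (fun y => (hits v eta y)%:R) x <= dl * K%:R.
Proof.
move=> dl0; apply: contrapT => nex.
have ex i : exists Kxv : nat * R * R, [/\ (i < Kxv.1.1)%N, 0 <= Kxv.2 <= 1 &
    dl * (Kxv.1.1)%:R <
    \sum_(j < Kxv.1.1) walk E a j (fun y => (hits Kxv.2 (invS R i) y)%:R) Kxv.1.2].
  apply: contrapT => nx; apply: nex; exists (invS R i), i; split.
    exact: invS_gt0.
  move=> K x v iK; rewrite leNgt; apply/negP => lt; apply: nx.
  have [z vz] := frac_part v; exists (K, x, v + z%:~R); split => //=; first lra.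
  by under eq_bigr do under eq_fun do rewrite hits_perz.
have [u uP] := choice ex.
pose K i := (u i).1.1; pose x i := (u i).1.2; pose v i := (u i).2.
have Ki i : (i < K i)%N by have [] := uP i.
have vb : bnd v by apply: (@bnd_itv _ _ 0 1) => i; have [] := uP i.
have nob F : ~ finite_invariant p b F.
  by move=> Fb; apply: (noF (F := F)); exact: (@finite_invariantC _ _ _ _ S F).
have [s s0 hs] := stationary_cont p_ge0 p_sum (line_systemC S) nob
  (limit_law_degree_one x Ki) (limit_law_stationary x Ki) (ulim v) dl0.
have [i] := limit_law_hits Ki vb dl0 hs s0.
by have [_ _] := uP i; rewrite -/(K i) -/(x i) -/(v i) => lt /(lt_le_trans lt); rewrite ltxx.
Qed.

End Equidistribution.

(** * Uniform non-concentration of the law at a fixed time *)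

Section NonConcentration.
Variables (R : realType) (p : nat -> R) (a b : nat -> R -> R).
Hypothesis p_ge0 : forall k, 0 <= p k.
Hypothesis p_sum : series p @ \oo --> (1 : R).
Hypothesis S : line_system p a b.
Hypothesis noF : forall F, ~ finite_invariant p a F.
Hypothesis leb : stationary p a id.
Variable c : R.
Hypothesis c01 : 0 < c <= 1.
Hypothesis gapc : forall th s : R, 0 < th <= c ->
  exists2 w, posword p w & run a (s + th) w <> run a s w + th.

Let E := dmean p_ge0 p_sum.
Let W := walk E a.

Let ib (P : R -> bool) : bnd (fun y => (P y)%:R : R).
Proof. exact: bnd_bool. Qed.

Lemma walk_hits_perz n (v eta x : R) (z : int) :
  W n (fun y => (hits v eta y)%:R) (x + z%:~R) = W n (fun y => (hits v eta y)%:R) x.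
Proof.
rewrite /W -(@walk_map _ _ _ _ E a a (fun y => y + z%:~R)
  (fun y => (hits v eta y)%:R) n x); last first.
  by move=> k y; rewrite (degree_oneDz (ls_a S k)).
congr (walk E a n _ x); apply/funext => y; congr (nat_of_bool _)%:R.
apply/asboolP/asboolP => -[z' h].
  by exists (z + z'); rewrite intrD addrA.
by exists (z' - z); rewrite intrD mulrNz; move: h; congr (`|_| <= _); ring.
Qed.

(** Density of orbits gives a word leading from [x] close to [y]; compactness makes its length and
    probability uniform. *)
Lemma recurrence (rho : R) : 0 < rho -> exists m (beta : R), 0 < beta /\
  forall x y, beta <= \sum_(j < m) W j (fun y' => (hits y rho y')%:R) x.
Proof.
move=> rho0; apply: contrapT => nex.
have ex i : exists u : R * R, [/\ 0 <= u.1 <= 1, 0 <= u.2 <= 1 &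
    \sum_(j < i) W j (fun y' => (hits u.2 rho y')%:R) u.1 < invS R i].
  apply: contrapT => nx; apply: nex; exists i, (invS R i); split.
    exact: invS_gt0.
  move=> x y; rewrite leNgt; apply/negP => lt; apply: nx.
  have [z xz] := frac_part x; have [z' yz] := frac_part y.
  exists (x + z%:~R, y + z'%:~R); split => /=; [lra|lra|].
  under eq_bigr do under eq_fun do rewrite hits_perz.
  by under eq_bigr do rewrite walk_hits_perz.
have [u uP] := choice ex.
pose x i := (u i).1; pose y i := (u i).2.
have xb : bnd x by apply: (@bnd_itv _ _ 0 1) => i; have [] := uP i.
have yb : bnd y by apply: (@bnd_itv _ _ 0 1) => i; have [] := uP i.
have r3 : 0 < rho / 3 by lra.
have [w [z [pw wz]]] := orbit_dense p_ge0 p_sum S noF leb (ulim x) (ulim y) r3.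
have q0 := posword_gt0 pw.
have [r r0 cw] := run_cont S w (ulim x) r3.
have [i [[[/= xi yi] iq] iw]] := uoo_ex (filterI (filterI (filterI
  (ulim_near xb r0) (ulim_near yb r3)) (uoo_invS q0)) (uoo_ge (size w).+1)).
have [_ _ /lt_trans/(_ iq)] := uP i; apply/negP; rewrite -leNgt -/(x i) -/(y i).
have hw : hits (y i) rho (run a (x i) w).
  apply/asboolP; exists z; have := cw (x i); rewrite distrC => /(_ xi).
  by move: wz yi; rewrite !ltr_norml ler_norml; lra.
have := @walk_ge_word _ _ p_ge0 p_sum _ a w (fun y' => (hits (y i) rho y')%:R) (x i)
  (ib _) (fun y' => ltac:(exact: ler0n)).
rewrite hw mulr1 => /le_trans; apply.
rewrite (bigD1 (Ordinal iw)) //= lerDl; apply: sumr_ge0 => j _.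
by have /andP[] := walk_itv E a j (x i) (fun y' => ind_itv R (hits (y i) rho y')).
Qed.

Let W_hits_ge0 n (v eta x : R) : 0 <= W n (fun y => (hits v eta y)%:R) x.
Proof. by have /andP[] := walk_itv E a n x (fun y => ind_itv R (hits v eta y)). Qed.

Lemma recurrence_blocks (rho beta : R) m L x y :
  (forall x y, beta <= \sum_(j < m) W j (fun y' => (hits y rho y')%:R) x) ->
  beta * L%:R <= \sum_(j < m * L) W j (fun y' => (hits y rho y')%:R) x.
Proof.
move=> rec; elim: L => [|L IH]; first by rewrite muln0 mulr0 big_ord0.
rewrite mulnS addnC big_split_ord /= -natr1 mulrDr mulr1 lerD //.
have -> : \sum_(i < m) W (m * L + i) (fun y' => (hits y rho y')%:R) x =
    W (m * L) (fun x' => \sum_(i < m) W i (fun y' => (hits y rho y')%:R) x') x.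
  rewrite /W (@walk_sum _ _ _ E a (m * L) m
    (fun i => walk E a i (fun y' => (hits y rho y')%:R))); last first.
    by move=> j; exact: walk_bnd.
  by apply: eq_bigr => i _; rewrite walk_add.
rewrite -[leLHS](walk_cst E a (m * L) beta x); apply: walk_le.
- exact: bnd_cst.
- apply: (@bnd_sum _ _ m (fun i => walk E a i (fun y' => (hits y rho y')%:R))) => j.
  exact: walk_bnd.
- by move=> x'; exact: rec.
Qed.

(* four points: x, y and the endpoints l <= x, y + z <= r of a contracted arc *)
Let act4 k (u : (R * R) * (R * R)) := ((a k u.1.1, a k u.1.2), act2 a k u.2).

(** Both points stay in the image of one arc: unless it is still at least [eta] long, when one is
    near [v] so is the other, within twice the distance. *)
Lemma walk_hits_compare n (v eta x y rho : R) :
  rho * 2 <= 1 -> hits x rho y ->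
  W n (fun u => (hits v eta u)%:R) x <= W n (fun u => (hits v (2 * eta) u)%:R) y
    + walk E (act2 a) n (fun u => (eta <= gap u)%R%:R) (x - rho, x + rho).
Proof.
move=> rho1 /asboolP[z yz].
pose u0 := ((x, y), (x - rho, x + rho)).
rewrite -[W n _ x]/(walk E a n (fun u => (hits v eta u)%:R) (u0.1.1)).
rewrite -(@walk_map _ _ _ _ E act4 a (fun u => u.1.1)) //.
rewrite -[W n _ y]/(walk E a n (fun u => (hits v (2 * eta) u)%:R) (u0.1.2)).
rewrite -(@walk_map _ _ _ _ E act4 a (fun u => u.1.2)) //.
rewrite -[(x - rho, x + rho)]/(u0.2).
rewrite -(@walk_map _ _ _ _ E act4 (act2 a) (fun u => u.2)) //.
rewrite -walkD; [|exact: bnd_bool..].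
pose D : set ((R * R) * (R * R)) := [set u | [/\ u.2.1 <= u.1.1 <= u.2.2,
  u.2.1 <= u.1.2 + z%:~R <= u.2.2 & short u.2]].
apply: (@walk_le_on _ _ _ E act4 D).
- move=> k [[x1 y1] [l1 r1]] [/= /andP[A1 A2] /andP[B1 B2] sh]; split => /=.
  + by rewrite !(degree_one_le (ls_a S k)).
  + by rewrite -(degree_oneDz (ls_a S k)) !(degree_one_le (ls_a S k)).
  + exact: (short_act2 S k sh).
- exact: bnd_bool.
- by apply: bndD; exact: bnd_bool.
- move=> [[x1 y1] [l1 r1]] [/= A B sh].
  case: (leP eta (gap (l1, r1))) => /= g.
    by apply: (@le_trans _ _ 1); [have /andP[] := ind_itv R (hits v eta x1)|rewrite lerDr].
  rewrite addr0; case: (boolP (hits v eta x1)) => //= /asboolP[z' h].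
  rewrite (_ : hits _ _ _ = true) //; apply/asboolP; exists (z + z').
  move: g h; rewrite gap_short //= intrD !ler_norml; lra.
- move: yz; rewrite ler_norml => yz; split => /=; [lra|lra|].
  by rewrite /short /=; lra.
Qed.

(** If the law from [x] charged a small interval by more than [dl], then, up to contraction, so
    would the law from every point near [x]. The walk returns there with positive frequency, against
    the Cesaro bound. *)
Lemma walk_not_concentrated (dl : R) : 0 < dl -> exists (eta : R) n, 0 < eta /\
  forall x v, W n (fun y => (hits v eta y)%:R) x <= dl.
Proof.
move=> dl0; have d40 : 0 < dl / 4 by lra.
have [rho [rho0 rho1 ctr]] := contraction p_ge0 p_sum S leb c01 gapc d40.
have [m [beta [beta0 rec]]] := recurrence rho0.
have m0 : (0 < m)%N.
  rewrite lt0n; apply/eqP => m0; have := rec 0 0; rewrite m0 big_ord0; lra.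
have m0' : 0 < m%:R :> R by rewrite ltr0n.
(* [dl / 4] is the excess left after the contraction error [3 * (dl / 4)], and [beta / m] is the
   frequency of returns near [x]. *)
pose d' := dl / 4 * beta / m%:R.
have d'0 : 0 < d' by rewrite !mulr_gt0 ?invr_gt0 //; lra.
have [eta0 [K0 [eta00 ces]]] := cesaro_hits p_ge0 p_sum S noF d'0.
pose eta := eta0 / 2; have etap : 0 < eta by rewrite /eta; lra.
have [n nP] := ctr eta etap.
exists eta, n; split => // x v.
set q := W n _ x; have := nP n x (leqnn n); set g := walk _ _ n _ _ => gle.
rewrite leNgt; apply/negP => qdl.
have q3 : 0 <= q - g by lra.
pose L := K0.+1; pose K := (m * L)%N.
have K0K : (K0 < K)%N by rewrite /K /L leq_pmull.
have low j : (q - g) * W j (fun y => (hits x rho y)%:R) x <=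
    W (j + n)%N (fun y => (hits v eta0 y)%:R) x.
  rewrite /W -walkZ // walk_add; apply: walk_le.
  - exact: bndZ.
  - exact: walk_bnd.
  move=> y; case: (boolP (hits x rho y)) => /= h; last first.
    by rewrite mulr0; exact: W_hits_ge0.
  rewrite mulr1 lerBlDr; have := walk_hits_compare n v eta rho1 h.
  by rewrite -/q -/g (_ : 2 * eta = eta0) // /eta; lra.
have up : \sum_(j < K) W (j + n)%N (fun y => (hits v eta0 y)%:R) x <= d' * K%:R.
  have -> : \sum_(j < K) W (j + n)%N (fun y => (hits v eta0 y)%:R) x =
      W n (fun x' => \sum_(j < K) W j (fun y => (hits v eta0 y)%:R) x') x.
    rewrite /W (@walk_sum _ _ _ E a n K
      (fun j => walk E a j (fun y => (hits v eta0 y)%:R))); last first.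
      by move=> j; exact: walk_bnd.
    by apply: eq_bigr => j _; rewrite addnC walk_add.
  rewrite -[leRHS](walk_cst E a n _ x); apply: walk_le.
  - apply: (@bnd_sum _ _ K (fun j => walk E a j (fun y => (hits v eta0 y)%:R))) => j.
    exact: walk_bnd.
  - exact: bnd_cst.
  - by move=> x'; exact: ces.
have sum_low : (q - g) * (beta * L%:R) <= d' * K%:R.
  apply: le_trans up; apply: le_trans (ler_wpM2l q3 (recurrence_blocks L x x rec)) _.
  by rewrite mulr_sumr; apply: ler_sum => j _; exact: low.
move: sum_low; rewrite /d' /K natrM.
have -> : dl / 4 * beta / m%:R * (m%:R * L%:R) = dl / 4 * (beta * L%:R).
  by field; rewrite gt_eqF.
have L0 : 0 < beta * L%:R by rewrite mulr_gt0 // ltr0n.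
rewrite ler_pM2r //; lra.
Qed.

End NonConcentration.

(** * The circle and its lifts *)

Section CircleParam.
Variable R : realType.
Local Notation pi := (@pi R).

Let pipos : 0 < pi := pi_gt0 R.

Lemma cis_proof (t : R) : (cos (pi *+ 2 * t), sin (pi *+ 2 * t)) \in @circle_set R.
Proof. by rewrite inE /circle_set /= cos2Dsin2. Qed.

Definition cis (t : R) : S1 R := exist _ (cos (pi *+ 2 * t), sin (pi *+ 2 * t)) (cis_proof t).

Lemma cptE t : cpt (cis t) = (cos (pi *+ 2 * t), sin (pi *+ 2 * t)).
Proof. by []. Qed.

Lemma cpt_inj : injective (@cpt R).
Proof. exact: val_inj. Qed.

Lemma cisD1 t : cis (t + 1) = cis t.
Proof.
by apply: cpt_inj; rewrite !cptE mulrDr mulr1 cosD2pi sinD2pi.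
Qed.

Lemma cisDz t (z : int) : cis (t + z%:~R) = cis t.
Proof.
have n (m : nat) s : cis (s + m%:R) = cis s.
  by elim: m => [|m IH]; rewrite ?addr0 // -natr1 addrA cisD1.
case: z => m; first exact: n.
by rewrite NegzE mulrNz -(n m.+1) subrK.
Qed.

Lemma cis_surj (x : S1 R) : exists t, cis t = x.
Proof.
have : circle_set (cpt x) by exact: set_valP.
case e : (cpt x) => [u v]; rewrite /circle_set /= => uv.
have u1 : -1 <= u <= 1 by rewrite -ler_norml -ler_sqr ?nnegrE // real_normK ?num_real // expr1n; nra.
have ca : cos (acos u) = u by rewrite acosK // in_itv.
have sa : sin (acos u) = `|v|.
  by rewrite sin_acos // -sqrtr_sqr; congr Num.sqrt; lra.
have p2 : pi *+ 2 != 0 by rewrite mulrn_eq0 /= gt_eqF.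
have [v0|v0] := leP 0 v.
  exists (acos u / (pi *+ 2)); apply: cpt_inj; rewrite cptE e mulrC divfK //.
  by rewrite ca sa ger0_norm.
exists (- acos u / (pi *+ 2)); apply: cpt_inj; rewrite cptE e mulrC divfK //.
by rewrite cosN sinN ca sa ltr0_norm // opprK.
Qed.

(** Up to a positive factor, the oriented area of a triangle inscribed in the circle is a product of
    sines of half the angles between its vertices. *)
Lemma ccw_cis (a b c : R) : ccw (cis a) (cis b) (cis c) <->
  0 < sin (pi * (b - a)) * sin (pi * (c - b)) * sin (pi * (c - a)).
Proof.
rewrite /ccw !cptE /=; pose x := pi * (b - a); pose y := pi * (c - b).
have dbl (t : R) : pi *+ 2 * t = (pi * t) *+ 2 by rewrite mulrnAl.
have eb : pi *+ 2 * b = pi *+ 2 * a + x *+ 2 by rewrite !dbl /x -mulrnDl; congr (_ *+ 2); ring.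
have ec : pi *+ 2 * c = pi *+ 2 * b + y *+ 2 by rewrite !dbl /y -mulrnDl; congr (_ *+ 2); ring.
have -> : pi * (c - a) = x + y by rewrite /x /y; ring.
rewrite -/x -/y; move: ec eb.
move: (pi *+ 2 * a) (pi *+ 2 * b) (pi *+ 2 * c) => A B C ec eb.
have -> : (cos B - cos A) * (sin C - sin A) - (sin B - sin A) * (cos C - cos A) =
    sin (C - B) + sin (B - A) - sin (C - A) by rewrite !sinB; ring.
have -> : C - A = x *+ 2 + y *+ 2 by rewrite ec eb; ring.
have -> : C - B = y *+ 2 by rewrite ec; ring.
have -> : B - A = x *+ 2 by rewrite eb; ring.
rewrite [sin (x *+ 2 + y *+ 2)]sinD [sin (x + y)]sinD !sin_mulr2n !cos_mulr2n !cos2sin2.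
set l := (X in (0 < X) <-> _).
have -> : l = 4 * (sin x * sin y * (sin x * cos y + cos x * sin y)) by rewrite /l; ring.
by rewrite pmulr_rgt0.
Qed.

Lemma ccw_lt (a b c : R) : a < b -> b < c -> c < a + 1 ->
  ccw (cis a) (cis b) (cis c).
Proof.
move=> ab bc ca; rewrite ccw_cis.
by rewrite !mulr_gt0 //; apply: sin_gt0_pi; rewrite pmulr_rgt0 ?gtr_pMr //; lra.
Qed.

Lemma ccw_swap (x y z : S1 R) : ccw x y z -> ~ ccw x z y.
Proof. by rewrite /ccw => h1 h2; lra. Qed.

Lemma cis_inj (s t : R) : cis s = cis t -> exists z : int, s = t + z%:~R.
Proof.
move=> st; have [z zP] := frac_part (s - t).
exists (- z); rewrite mulrNz; pose s' := s + z%:~R.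
have s't : cis s' = cis t by rewrite cisDz.
suff : s' = t by rewrite /s'; lra.
have [ts|] := ltP t s'; last by rewrite /s'; lra.
pose m := (t + s') / 2.
have := ccw_lt (a := t) (b := m) (c := s'); rewrite s't.
have -> : ccw (cis t) (cis m) (cis t) = False.
  rewrite /ccw propeqE; split=> //; set u := cpt _; set v := cpt _.
  by rewrite !subrr !mulr0 subrr ltxx.
by move=> h; exfalso; apply: h; move: ts; rewrite /m /s'; lra.
Qed.

Lemma ccw_cis_lt (a b c : R) : a < b < a + 1 -> a < c < a + 1 ->
  ccw (cis a) (cis b) (cis c) -> b < c.
Proof.
move=> /andP[ab b1] /andP[ac c1] abc; rewrite ltNge le_eqVlt; apply/negP => /orP[/eqP cb|cb].
  by move: abc; rewrite cb /ccw; set u := cpt _; set v := cpt _ => h; lra.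
by apply: (ccw_swap abc); exact: ccw_lt.
Qed.

(** The lift is chosen in the unit interval that starts at [t0] plus the integer part of [t]. It is
    monotone there because the cyclic order, based at the image of [cis 0], becomes the order of the
    line. *)
Lemma exists_lift (g : CircMap R) : homeo_plus g ->
  exists2 A : R -> R, degree_one A & forall t, cis (A t) = g (cis t).
Proof.
move=> [[_ [gi [_ gK _]]] gp].
have g_inj : injective g := can_inj gK.
have [t0 t0P] := cis_surj (g (cis 0)).
have ex t : exists s, cis s = g (cis t) /\
    t0 + (Num.floor t)%:~R <= s < t0 + (Num.floor t)%:~R + 1.
  have [s sP] := cis_surj (g (cis t)).
  have [z zP] := frac_part (s - (t0 + (Num.floor t)%:~R)).
  by exists (s + z%:~R); rewrite cisDz; split => //; lra.
have uniq x s s' : x <= s < x + 1 -> x <= s' < x + 1 -> cis s = cis s' -> s = s'.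
  move=> xs xs' /cis_inj[z e].
  suff -> : s = s' + 0 by rewrite addr0.
  rewrite e; congr (_ + _); case: (ltgtP z 0) => [z0|z0|-> //].
  - have : z%:~R <= (-1)%:~R :> R by rewrite ler_int; move: z0; rewrite -ltzD1 addNr.
    by rewrite mulrNz; lra.
  - have : 1%:~R <= z%:~R :> R by rewrite ler_int -gtz0_ge1.
    by lra.
have [A AP] := choice ex.
exists A; last by move=> t; have [] := AP t.
split=> [s t st|t]; last first.
  have [e1 i1] := AP t; have [e2 i2] := AP (t + 1).
  apply: (uniq (t0 + (Num.floor t)%:~R + 1)).
  - by move: i2; rewrite floorDrz ?num1 ?rpred1 // floor1 intrD addrA.
  - by lra.
  - by rewrite e2 !cisD1.
have [e1 i1] := AP s; have [e2 i2] := AP t.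
have := le_floor st; rewrite le_eqVlt => /orP[/eqP fst|fst]; last first.
  have : (Num.floor s + 1)%:~R <= (Num.floor t)%:~R :> R by rewrite ler_int lezD1.
  by rewrite intrD; lra.
move: i1; rewrite fst; set n := Num.floor t in i2 * => i1.
have tn := floor_itv t; have sn := floor_itv s.
move: tn sn; rewrite fst -/n intrD => /andP[n1 n2] /andP[n3 n4].
have ct0 : cis (t0 + n%:~R) = g (cis n%:~R).
  by rewrite cisDz t0P -[n%:~R]add0r cisDz.
have [sn|sn] := ltP n%:~R s; last first.
  have sE : s = n%:~R by lra.
  have -> : A s = t0 + n%:~R by apply: (uniq (t0 + n%:~R)) => //; [lra|rewrite e1 sE ct0].
  by lra.
have [stl|] := ltP s t; last by move=> ts; have -> : s = t by lra.
(* Injectivity keeps interior points off the base point: [ccw_cis_lt] wants strict inequalities. *)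
have An x : n%:~R < x < n%:~R + 1 -> cis (A x) = g (cis x) ->
    t0 + n%:~R <= A x -> t0 + n%:~R < A x.
  move=> xn ex0; rewrite le_eqVlt => /orP[/eqP e|//]; exfalso.
  move: ex0; rewrite -e ct0 => /g_inj e'.
  have : n%:~R = x by apply: (uniq n%:~R) => //; lra.
  lra.
apply/ltW; apply: (@ccw_cis_lt (t0 + n%:~R)).
- by have := An s ltac:(lra) e1 ltac:(lra); lra.
- by have := An t ltac:(lra) e2 ltac:(lra); lra.
rewrite ct0 e1 e2; apply: gp; apply: ccw_lt; lra.
Qed.

(** The displacement is an integer, and monotonicity lets it vary by less than 1 over a period. *)
Lemma lift_id (A : R -> R) : degree_one A -> (forall t, cis (A t) = cis t) ->
  exists z : int, forall t, A t = t + z%:~R.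
Proof.
move=> A1 Aid; have [zf zP] := choice (fun t => cis_inj (Aid t)).
have loc s t : s <= t < s + 1 -> zf t = zf s.
  move=> st; have := degree_one_diff A1 (s := s) (t := t) (n := 1).
  rewrite !zP => /(_ ltac:(lra) ltac:(lra)) h.
  have h1 : (-1)%:~R < (zf t - zf s)%:~R :> R by rewrite intrD !mulrNz; lra.
  have h2 : (zf t - zf s)%:~R < 1%:~R :> R.
    rewrite intrD !mulrNz; have [->|] := eqVneq s t; first by rewrite subrr ltr01.
    by move=> /eqP ne; have [|] := ltP s t; lra.
  move: h1 h2; rewrite !ltr_int => h1 h2.
  apply/eqP; rewrite -subr_eq0 eq_le; apply/andP; split.
    by rewrite -ltzD1 add0r.
  by rewrite -ltzD1 -ltrBlDr sub0r.
exists (zf 0) => t; rewrite zP; congr (_ + _%:~R).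
have [z tz] := frac_part t.
have <- : zf (t + z%:~R) = zf 0 by apply: loc; lra.
have := zP (t + z%:~R); rewrite (degree_oneDz A1) zP => h.
have {}h : (zf t)%:~R = (zf (t + z%:~R))%:~R :> R by lra.
by apply/eqP; rewrite -(eqr_int R); apply/eqP.
Qed.

End CircleParam.

Section CircleTopology.
Variable R : realType.

Lemma cpt_continuous : continuous (@cpt R).
Proof. exact: initial_continuous. Qed.

Lemma cis_continuous : continuous (@cis R).
Proof.
apply: (@continuous_comp_initial _ _ _ (set_val : S1 R -> R * R) (@cis R)).
move=> t; apply: (@cvg_pair _ _ _ _ (nbhs (cos (pi *+ 2 * t))) (nbhs (sin (pi *+ 2 * t)))).
  apply: (@continuous_comp _ _ _ (fun x => pi *+ 2 * x) (@cos R)).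
    by apply: cvgM; [exact: cvg_cst|exact: cvg_id].
  exact: continuous_cos.
apply: (@continuous_comp _ _ _ (fun x => pi *+ 2 * x) (@sin R)).
  by apply: cvgM; [exact: cvg_cst|exact: cvg_id].
exact: continuous_sin.
Qed.

Lemma open_ccw (x y : S1 R) : open [set u | ccw x u y].
Proof.
pose f (u : S1 R) : R := ((cpt u).1 - (cpt x).1) * ((cpt y).2 - (cpt x).2)
      - ((cpt u).2 - (cpt x).2) * ((cpt y).1 - (cpt x).1).
have -> : [set u | ccw x u y] = f @^-1` [set r | 0 < r] by [].
apply: open_comp; last exact: open_gt.
move=> u _; have c1 : (fun v : S1 R => (cpt v).1) @ u --> (cpt u).1.
  by apply: (continuous_comp (@cpt_continuous u)); exact: cvg_fst.
have c2 : (fun v : S1 R => (cpt v).2) @ u --> (cpt u).2.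
  by apply: (continuous_comp (@cpt_continuous u)); exact: cvg_snd.
exact: (cvgB (cvgM (cvgB c1 (cvg_cst _)) (cvg_cst _)) (cvgM (cvgB c2 (cvg_cst _)) (cvg_cst _))).
Qed.

(** The chord of its ends cuts the arc out of the circle. *)
Lemma open_arc (s t : R) : s < t -> t < s + 1 -> open [set cis u | u in `]s, t[].
Proof.
move=> st ts.
suff -> : [set cis u | u in `]s, t[] = [set u | ccw (cis s) u (cis t)].
  exact: open_ccw.
apply/seteqP; split=> [x [u /= u_st <-]|x /= ccwx].
  by move: u_st; rewrite in_itv /= => /andP[su ut]; exact: ccw_lt.
have [u ux] := cis_surj x; have [z uz] := frac_part (u - s).
pose v := u + z%:~R; have vx : cis v = x by rewrite cisDz.
exists v => //=; rewrite in_itv /=; move: ccwx; rewrite -vx => ccwx.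
have sv : s < v.
  have : s <= v by rewrite /v; lra.
  rewrite le_eqVlt => /orP[/eqP sv|//]; move: ccwx; rewrite sv /ccw.
  by set a := cpt _; set b := cpt _ => h; lra.
rewrite sv /=; apply: (@ccw_cis_lt _ s) => //; [rewrite sv /v; lra|lra].
Qed.

Lemma circle_continuous_measurable (g : CircMap R) : continuous g ->
  measurable_fun [set: S1B R] (g : S1B R -> S1B R).
Proof.
move=> cg; apply: (@measurability _ _ (S1B R) (S1B R) setT g (@open (S1 R))) => //.
move=> _ [B oB <-]; rewrite setTI; apply: sub_sigma_algebra.
by apply: open_comp oB => // x _; exact: cg.
Qed.

Lemma cis_measurable : measurable_fun [set: measurableTypeR R] (@cis R : _ -> S1B R).
Proof.
apply: (@measurability _ _ (measurableTypeR R) (S1B R) setT (@cis R) (@open (S1 R))) => //.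
move=> _ [B oB <-]; rewrite setTI; apply: open_measurable.
by apply: open_comp oB => // x _; exact: cis_continuous.
Qed.

End CircleTopology.

(** * Invariant probabilities on the circle *)

Lemma lebesgue_shift (R : realType) (c : R) (A : set (measurableTypeR R)) :
  measurable A ->
  lebesgue_measure ((fun x => x + c) @^-1` A) = lebesgue_measure A.
Proof.
move=> mA; have mshift : measurable_fun (setT : set (measurableTypeR R))
    (fun x : R => x + c : measurableTypeR R) by exact: measurable_funD.
apply/esym; apply: (@lebesgue_measure_unique R
  (measure_function_pushforward__canonical__measure_function_Measure
    lebesgue_measure mshift)) => //= _ [[a b]] _ <-.
rewrite /pushforward.
have -> : (fun x => x + c) @^-1` `]a, b] = `]a - c, b - c]%classic.
  by apply/seteqP; split=> x /=; rewrite !in_itv /= => ?; lra.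
rewrite !lebesgue_measure_itv /= !lte_fin ltrD2r; case: ifPn => // _.
by rewrite -!EFinB; congr (_%:E); ring.
Qed.

Section PeriodicSet.
Variables (R : realType) (B : set (measurableTypeR R)).
Hypothesis mB : measurable B.
Hypothesis perB : forall x, B (x + 1) <-> B x.
Local Notation leb := (@lebesgue_measure R).

Let perBz x (z : int) : B (x + z%:~R) <-> B x.
Proof.
have n (m : nat) y : B (y + m%:R) <-> B y.
  by elim: m => [|m IH]; rewrite ?addr0 // -natr1 addrA perB.
by case: z => m; [exact: n|rewrite NegzE mulrNz -(n m.+1) subrK].
Qed.

(** The shifted period is cut at 1, and the overhanging part is moved back by one period. *)
Lemma lebesgue_periodic_shift c :
  leb ([set x | B (x + c)] `&` `[0, 1[) = leb (B `&` `[0, 1[).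
Proof.
have [z zc] := frac_part c; pose e := c + z%:~R.
have -> : [set x | B (x + c)] = [set x | B (x + e)].
  by apply/seteqP; split=> x /=; rewrite /e addrA perBz.
have -> : [set x | B (x + e)] `&` `[0, 1[ =
    (fun x => x + e) @^-1` (B `&` `[e, e + 1[).
  by apply/seteqP; split=> x /= [Bx]; rewrite !in_itv /= => ?; split => //; lra.
rewrite lebesgue_shift; last exact: measurableI.
have e01 : 0 <= e < 1 by rewrite /e; lra.
have cut (u v w : R) : u <= v <= w -> leb (B `&` `[u, w[) =
    (leb (B `&` `[u, v[) + leb (B `&` `[v, w[))%E.
  move=> uvw; rewrite -measureU; [|exact: measurableI..|].
    congr (leb _); rewrite -setIUr; congr (_ `&` _).
    apply/seteqP; split=> x /=; rewrite !in_itv /=.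
      by move=> xuw; have [xv|xv] := ltP x v; [left|right]; lra.
    by move=> [] ?; lra.
  apply/seteqP; split=> // x /= [[_ +] [_]]; rewrite /= !in_itv /= => ? ?; lra.
rewrite (cut e 1 (e + 1)); last lra.
rewrite (cut 0 e 1); last lra.
rewrite addeC; congr (_ + _)%E.
rewrite -(@lebesgue_shift _ 1) /=; last exact: measurableI.
congr (leb _); apply/seteqP; split=> x /= [Bx]; rewrite !in_itv /= => ?.
  by split; [exact/perB|lra].
by split; [exact/perB|lra].
Qed.

End PeriodicSet.

Section InvariantProbability.
Variables (R : realType) (mu : CircMap R -> R) (G : set (CircMap R)).
Hypothesis Gsub : homeo_plus_subgroup G.
Hypothesis Ggen : nondegenerate_on G mu.
Local Open Scope ereal_scope.

(** Invariance under the support passes to the semigroup that it generates, which is [G]. *)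
Lemma invariant_probability_of_measure (m : {measure set (S1B R) -> \bar R}) :
  m [set: S1B R] != 0 -> m [set: S1B R] < +oo ->
  (forall g, (0 < mu g)%R -> forall A : set (S1B R), measurable A ->
    m (g @^-1` A) = m A) ->
  has_invariant_probability G.
Proof.
move=> m0 moo minv; exists (mnormalize m (dirac (cis 0%R : S1B R))).
have Gc g : G g -> continuous g by case: Gsub => h _ _ _ /h [[]].
have all g : G g -> forall A : set (S1B R), measurable A -> m (g @^-1` A) = m A.
  rewrite -{1}Ggen; elim=> {}g; first exact: minv.
  move=> h Gg IHg Gh IHh A mA; rewrite comp_preimage IHh ?IHg //.
  rewrite -[X in measurable X]setTI; apply: circle_continuous_measurable => //.
  by apply: Gc; rewrite -Ggen.
move=> g Gg A mA /=; rewrite /mnormalize.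
by rewrite (negbTE m0) /= lt_eqF // all.
Qed.

Lemma invariant_probability_of_finite (L : seq (S1 R)) :
  uniq L -> L != [::] ->
  (forall g, (0 < mu g)%R -> forall x, x \in L -> g x \in L) ->
  has_invariant_probability G.
Proof.
move=> uL L0 Linv.
have [x0 x0L] : exists x0, x0 \in L by case: (L) L0 => // x l _; exists x; rewrite mem_head.
pose m : {measure set (S1B R) -> \bar R} :=
  msum (fun k => dirac (nth x0 L k : S1B R)) (size L).
have mE (A : set (S1B R)) : m A = \sum_(x <- L) (\d_(x : S1B R) A : \bar R).
  by rewrite /m /msum (big_nth x0) big_mkord.
apply: (@invariant_probability_of_measure m).
- rewrite mE; under eq_bigr do rewrite diracT.
  rewrite sumEFin eqe (big_nth x0) big_mkord sumr_const card_ord.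
  by rewrite pnatr_eq0 size_eq0.
- rewrite mE; under eq_bigr do rewrite diracT.
  by rewrite sumEFin ltry.
- move=> g g0 A mA; rewrite !mE.
  have ginj : injective g.
    have : G g by rewrite -Ggen; exact: gs_base.
    by case: Gsub => h _ _ _ /h[[_ [gi [_ /can_inj]]]].
  (* An injection of a finite set into itself permutes it. *)
  have pm : perm_eq (map g L) L.
    have umL : uniq (map g L) by rewrite map_inj_uniq.
    apply: uniq_perm => //; have sub : {subset map g L <= L}.
      by move=> _ /mapP[x xL ->]; exact: Linv.
    by have [] := uniq_min_size umL sub; rewrite ?size_map.
  by rewrite -[RHS](perm_big _ pm) /= big_map.
Qed.

(** Lebesgue measure on a period, pushed to the circle along [Q]; a translation of the parameter
    preserves it. It serves to exclude that all quotient steps are translations. *)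
Lemma invariant_probability_of_translations (Q : R -> R) :
  degree_one Q ->
  (forall g, (0 < mu g)%R -> exists c, forall u, g (cis (Q u)) = cis (Q (u + c)%R)) ->
  has_invariant_probability G.
Proof.
move=> Q1 Qc.
pose X (u : measurableTypeR R) : S1B R := cis (Q u).
have mX : measurable_fun setT X.
  apply: (@measurableT_comp _ _ _ _ _ _ (@cis R : measurableTypeR R -> S1B R)).
    exact: cis_measurable.
  by apply: nondecreasing_measurable => // s t; exact: degree_one_le.
have m01 : measurable (`[0%R, 1%R[%classic : set (measurableTypeR R)) by [].
have mXA (A : set (S1B R)) : measurable A -> measurable (X @^-1` A).
  by move=> mA; rewrite -[X in measurable X]setTI; exact: mX.
pose m := measure_function_pushforward__canonical__measure_function_Measure
  (mrestr lebesgue_measure m01) mX.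
have mE A : m A = lebesgue_measure (X @^-1` A `&` `[0%R, 1%R[) by [].
have mT : m setT = 1.
  rewrite mE preimage_setT setTI lebesgue_measure_itv /= lte_fin ltr01.
  by rewrite -EFinB subr0.
apply: (@invariant_probability_of_measure m).
- by rewrite mT oner_neq0.
- by rewrite mT ltry.
- move=> g g0 A mA; have [c gc] := Qc g g0; rewrite !mE.
  rewrite -(@lebesgue_periodic_shift _ (X @^-1` A) (mXA A mA) _ c).
    congr (lebesgue_measure (_ `&` _)); apply/seteqP.
    by split=> u /=; rewrite /X gc.
  by move=> x /=; rewrite /X (proj2 Q1) cisD1.
Qed.

End InvariantProbability.

(* The random walk of step law mu, lifted to R: steps of positive mass are
   numbered by cw_code, cw_a are the lifted steps, and cw_h is the distribution
   function of a measure that is stationary for the inverse walk. *)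
Record circle_walk (R : realType) (mu : CircMap R -> R) := CircleWalk {
  cw_code : CircMap R -> nat ;
  cw_p : nat -> R ;
  cw_p_ge0 : forall k, 0 <= cw_p k ;
  cw_p_sum : series cw_p @ \oo --> (1 : R) ;
  cw_a : nat -> R -> R ;
  cw_h : R -> R ;
  cw_c : R ;
  cw_E := dmean cw_p_ge0 cw_p_sum ;
  cw_step : forall g, 0 < mu g -> cw_p (cw_code g) = mu g /\
    forall t, cis (cw_a (cw_code g) t) = g (cis t) ;
  cw_code_inj : forall g h, 0 < mu g -> 0 < mu h -> cw_code g = cw_code h -> g = h ;
  cw_code_onto : forall k, 0 < cw_p k -> exists2 g, 0 < mu g & cw_code g = k ;
  cw_a1 : forall k, degree_one (cw_a k) ;
  cw_h1 : degree_one cw_h ;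
  cw_h_unif : forall e, 0 < e ->
    exists2 r, 0 < r & forall t, cw_h (t + r) - cw_h (t - r) < e ;
  cw_gap := fun x : R * R => gap (cw_h x.1, cw_h x.2) ;
  cw_c01 : 0 < cw_c <= 1 ;
  cw_visits : forall eta, 0 < eta -> exists B, forall x N, short x ->
    \sum_(n < N) walk cw_E (act2 cw_a) n (fun y => (eta <= cw_gap y <= cw_c)%R%:R) x <= B ;
  cw_jumps : forall d x N, 0 < d -> short x ->
    \sum_(n < N) walk cw_E (act2 cw_a) n (fun y =>
      cw_E (fun k => (d <= `|cw_gap (act2 cw_a k y) - cw_gap y|)%R%:R)) x <= d ^- 2 ;
  cw_markov : forall n d x, short x -> 0 < d ->
    walk cw_E (act2 cw_a) n (fun y => (d <= cw_gap y)%R%:R) x <= cw_gap x / d ;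
  cw_spread : forall dl, 0 < dl -> exists (eta : R) n, 0 < eta /\
    forall x v, walk cw_E cw_a n (fun y => (hits v eta (cw_h y))%:R) x <= dl }.

Arguments cw_E : simpl never.
Arguments cw_gap : simpl never.

(** * The lifted walk of a nondegenerate measure *)

Section GroupWalk.
Variables (R : realType) (G : set (CircMap R)) (mu : CircMap R -> R).
Hypothesis Gcount : countable G.
Hypothesis Gsub : homeo_plus_subgroup G.
Hypothesis Gnoinv : ~ has_invariant_probability G.
Hypothesis Gprob : prob_on G mu.
Hypothesis Ggen : nondegenerate_on G mu.

Let code := projT1 (cid (elimT (countable_injP G) Gcount)).

Let supp_G g : 0 < mu g -> G g.
Proof. by move=> g0; rewrite -Ggen; exact: gs_base. Qed.

Let code_inj g h : 0 < mu g -> 0 < mu h -> code g = code h -> g = h.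
Proof.
rewrite /code; case: cid => f /= finj g0 h0; apply: finj; rewrite inE; exact: supp_G.
Qed.

Let fiber k : set (CircMap R) := [set g | 0 < mu g /\ code g = k].
Let dec k : CircMap R := xget (id : CircMap R) (fiber k).
(** Codes that number no step get mass 0 and, in [lifts_ex], the identity as lift. *)
Let p k := if `[< fiber k !=set0 >] then mu (dec k) else 0.

Let decP k : fiber k !=set0 -> fiber k (dec k).
Proof. by move=> [g gk]; rewrite /dec; case: xgetP => [? ->//|/(_ g)]. Qed.

Let p_code g : 0 < mu g -> p (code g) = mu g /\ dec (code g) = g.
Proof.
move=> g0; have ne : fiber (code g) !=set0 by exists g.
have [d0 dc] := decP ne; have dg := code_inj d0 g0 dc.
by rewrite /p dg; case: asboolP.
Qed.

Let p_ge0 k : 0 <= p k.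
Proof. by case: Gprob => m0 _ _; rewrite /p; case: ifP. Qed.

Let p_gt0 k : 0 < p k -> fiber k !=set0.
Proof. by rewrite /p; case: asboolP => //; rewrite ltxx. Qed.

Let p_sum : series p @ \oo --> (1 : R).
Proof.
case: Gprob => m0 mG m1.
pose S : set (CircMap R) := [set g | 0 < mu g].
have SG : (\esum_(g in S) (mu g)%:E = 1)%E.
  rewrite -m1 esum_mkcond [RHS]esum_mkcond; apply: eq_esum => g _.
  have := m0 g; rewrite le_eqVlt => /orP[/eqP e|g0]; last first.
    by rewrite !mem_set //; exact: supp_G.
  by rewrite -e; do 2! case: ifP.
have nat1 : (\sum_(k <oo) (p k)%:E = 1)%E.
  rewrite nneseries_esumT; last by move=> n; rewrite lee_fin.
  rewrite -[RHS]SG.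
  have -> : (\esum_(g in S) (mu g)%:E = \esum_(g in S) (p (code g))%:E)%E.
    by apply: eq_esum => g g0; have [->] := p_code g0.
  rewrite -(@esum_image _ _ _ S code (fun k => (p k)%:E)); last first.
    by move=> g h; rewrite !inE => g0 h0; exact: code_inj.
  rewrite [RHS]esum_mkcond; apply: eq_esum => k _.
  case: ifPn => // /negP kS.
  rewrite (_ : p k = 0) // /p; case: asboolP => // /decP[d0 dk]; exfalso.
  by apply: kS; rewrite inE; exists (dec k).
have cv : cvgn (series p).
  by apply: nnseries_is_cvg => //; rewrite nat1 ltry.
suff <- : limn (series p) = 1 by [].
have : (limn (EFin \o series p) = 1)%E.
  rewrite -nat1; congr (limn _); apply/funext => n /=.
  by rewrite /series /= -sumEFin.
by rewrite EFin_lim // => -[].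
Qed.

Let Ghomeo g : G g -> homeo_plus g.
Proof. by case: Gsub => h _ _ _ /h. Qed.

(** Lifts of a map and of its inverse compose to an integer translation; subtracting it from the
    second makes them inverse to each other. *)
Let lifts_ex k : exists ab : (R -> R) * (R -> R),
  [/\ degree_one ab.1, degree_one ab.2, (forall t, ab.1 (ab.2 t) = t),
      (forall t, ab.2 (ab.1 t) = t) &
      if `[< 0 < p k >] then forall t, cis (ab.1 t) = dec k (cis t)
      else forall t, ab.1 t = t].
Proof.
case: asboolP => [pk|_]; last by exists (id, id); split => //; exact: degree_one_id.
have [d0 _] := decP (p_gt0 pk); have Gd := supp_G d0.
have [h [Gh hd dh]] : exists h, [/\ G h, cancel (dec k) h & cancel h (dec k)].
  by case: Gsub => _ _ _ /(_ _ Gd).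
have [A A1 Ad] := exists_lift (Ghomeo Gd); have [B B1 Bh] := exists_lift (Ghomeo Gh).
have [z zP] : exists z : int, forall t, A (B t) = t + z%:~R.
  apply: (lift_id (degree_one_comp A1 B1)) => t /=.
  by rewrite Ad Bh dh.
have [z' zP'] : exists z : int, forall t, B (A t) = t + z%:~R.
  apply: (lift_id (degree_one_comp B1 A1)) => t /=.
  by rewrite Bh Ad hd.
have zz : z%:~R = z'%:~R :> R.
  have := zP (A 0); rewrite zP' (degree_oneDz A1); lra.
exists (A, fun t => B t - z%:~R); split=> //=.
- split=> [s t st|t]; first by rewrite lerD2r degree_one_le.
  by rewrite (proj2 B1); lra.
- by move=> t; have := degree_oneDz A1 (B t) (- z); rewrite mulrNz => ->; rewrite zP; lra.
- by move=> t; rewrite zP' -zz; lra.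
Qed.

Let ab := projT1 (choice lifts_ex).
Let a k := (ab k).1.
Let b k := (ab k).2.

Let abP k : [/\ degree_one (a k), degree_one (b k), (forall t, a k (b k t) = t),
      (forall t, b k (a k t) = t) &
      if `[< 0 < p k >] then forall t, cis (a k t) = dec k (cis t)
      else forall t, a k t = t].
Proof. exact: (projT2 (choice lifts_ex) k). Qed.

Let a_code g t : 0 < mu g -> cis (a (code g) t) = g (cis t).
Proof.
move=> g0; have [_ _ _ _] := abP (code g); have [-> ->] := p_code g0.
by case: asboolP.
Qed.

Let word_of g : G g -> exists2 w, posword p w & forall t, cis (run a t w) = g (cis t).
Proof.
rewrite -{1}Ggen; elim=> {}g => [g0|h _ [w pw wg] _ [v pv vh]].
  exists [:: code g] => [|t] /=; last exact: a_code.
  by have [-> _] := p_code g0; rewrite andbT.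
(* In [g \o h] the map [h] acts first, so its word comes first. *)
exists (v ++ w) => [|t]; first by rewrite /posword all_cat; apply/andP.
by rewrite run_cat wg vh.
Qed.

Let sys : line_system p a b.
Proof.
split; try by move=> k; have [] := abP k.
move=> k pk; have [d0 _] := decP (p_gt0 pk); have Gd := supp_G d0.
have [a1 b1 abk bak] := abP k; case: asboolP => // _ ad.
have [h [Gh hd dh]] : exists h, [/\ G h, cancel (dec k) h & cancel h (dec k)].
  by case: Gsub => _ _ _ /(_ _ Gd).
have [w pw wh] := word_of Gh.
have r1 : degree_one (fun t => run a t w).
  elim: (w) => [|i v IH]; first exact: degree_one_id.
  have [ai _ _ _ _] := abP i; exact: (degree_one_comp IH ai).
have [z zP] : exists z : int, forall t, a k (run a t w) = t + z%:~R.
  apply: (lift_id (degree_one_comp a1 r1)) => t /=.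
  by rewrite ad wh dh.
exists w, (- z); split => // t.
by rewrite -(bak (run a t w)) zP (degree_oneDz b1) mulrNz addrK.
Qed.

Let a_null k t : ~ 0 < p k -> a k t = t.
Proof. by move=> pk; have [_ _ _ _] := abP k; case: asboolP. Qed.

Let no_finite F : ~ finite_invariant p a F.
Proof.
move=> [[t0 Ft0] Ff Fp Fa]; apply: Gnoinv.
have Fz t (z : int) : F (t + z%:~R) <-> F t.
  have Fn (n : nat) x : F (x + n%:R) <-> F x.
    by elim: n => [|n IH]; rewrite ?addr0 // -natr1 addrA Fp.
  by case: z => n; [exact: Fn|rewrite NegzE mulrNz -(Fn n.+1) subrK].
have Ff' : finite_set [set cis t | t in F `&` `[0, 1[] by exact: finite_image.
have /finite_seqP[L LE] := Ff'.
have inL x : x \in undup L <-> exists2 t, F t & cis t = x.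
  rewrite mem_undup; split=> [xL|[t Ft <-]].
    have : [set` L] x by [].
    by rewrite -LE => -[t [Ft _] <-]; exists t.
  have [z tz] := frac_part t; suff : [set` L] (cis t) by [].
  rewrite -LE; exists (t + z%:~R); last by rewrite cisDz.
  by split; [exact/Fz|rewrite /= in_itv].
apply: (@invariant_probability_of_finite _ mu G Gsub Ggen (undup L)).
- exact: undup_uniq.
- have : cis t0 \in undup L by apply/inL; exists t0.
  by case: (undup L).
- move=> g g0 x /inL[t Ft <-]; apply/inL; exists (a (code g) t); last exact: a_code.
  by apply/Fa => //; have [-> _] := p_code g0.
Qed.

Let h := shape p a.
Let h1 : degree_one h := shape_degree_one p_ge0 p_sum sys.
Let hst : stationary p a h := shape_stationary p_ge0 p_sum sys.
Let hc t e : 0 < e -> exists2 r, 0 < r & h (t + r) - h (t - r) < e :=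
  @stationary_cont _ _ _ _ p_ge0 p_sum sys no_finite h h1 hst t e.
Let hu e : 0 < e -> exists2 r, 0 < r & forall t, h (t + r) - h (t - r) < e :=
  @stationary_ucont _ _ _ _ p_ge0 p_sum sys no_finite h h1 hst e.

Let q := qa a h.
Let qsys : line_system p q (qb b h) := quotient_system p_ge0 p_sum sys a_null h1 hst hc.
Let qleb : stationary p q id := quotient_stationary h1 hst hc.
Let q_no_finite F : ~ finite_invariant p q F :=
  quotient_no_finite p_ge0 p_sum sys a_null h1 hst hc no_finite (F := F).

(** Otherwise Lebesgue measure on the quotient, carried to the left ends of the fibres, would be an
    invariant probability. *)
Let q_not_translations : ~ forall k, 0 < p k -> exists c, forall t, q k t = t + c.
Proof.
move=> tr; apply: Gnoinv.
apply: (@invariant_probability_of_translations _ mu G Gsub Ggen (leftmost h)).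
  split=> [s t st|t]; last by have := leftmostDz h1 hc t 1.
  rewrite leNgt; apply/negP => /(leftmost_lt h1 hc); rewrite (leftmostK h1 hc); lra.
move=> g g0; have [pg _] := p_code g0.
have [|c qc] := tr (code g); first by rewrite pg.
exists c => u; rewrite -a_code //; congr cis.
by rewrite (leftmost_qa p_ge0 p_sum sys a_null h1 hst hc) -qc.
Qed.

(** The estimates are proved in the quotient and pulled back: [h] sends the walk, on points and on
    pairs, to the quotient walk. *)
Lemma circle_walk_exists : exists _ : circle_walk mu, True.
Proof.
have [c c01 gapc] := rigid_gap p_ge0 p_sum qsys q_no_finite qleb q_not_translations.
pose E := dmean p_ge0 p_sum.
pose hh (x : R * R) := (h x.1, h x.2).
have hact k x : hh (act2 a k x) = act2 q k (hh x).
  by rewrite /hh /act2 /= /q !(qaE p_ge0 p_sum sys a_null h1 hst hc).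
have hshort x : short x -> short (hh x).
  by move=> /andP[x0 x1]; apply: (degree_one_diff h1 (n := 1)); lra.
unshelve eexists; last by [].
apply: (@CircleWalk R mu code p p_ge0 p_sum a h c) => //.
- by move=> g g0; have [-> _] := p_code g0; split=> // t; exact: a_code.
- by move=> k /p_gt0/decP[d0 dk]; exists (dec k).
- by move=> k; have [] := abP k.
- move=> eta eta0; have [B BP] := visits_bound p_ge0 p_sum qsys qleb c01 gapc eta0.
  exists B => x N sx; rewrite (le_trans _ (BP (hh x) N (hshort x sx))) //.
  apply: ler_sum => n _.
  by rewrite -(@walk_map _ _ _ _ _ (act2 a) (act2 q) hh _ n x hact).
- move=> d x N d0 sx.
  apply: le_trans (jumps_bound p_ge0 p_sum qsys qleb N d0 (hshort x sx)).
  apply: ler_sum => n _.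
  rewrite -(@walk_map _ _ _ _ _ (act2 a) (act2 q) hh _ n x hact).
  rewrite le_eqVlt; apply/orP; left; apply/eqP; congr (walk _ _ _ _ _).
  apply/funext => y; congr (dexp p _); apply/funext => k.
  by rewrite -hact.
- move=> n d x sx d0.
  apply: le_trans (walk_gap_markov p_ge0 p_sum qsys qleb n (hshort x sx) d0).
  by rewrite -(@walk_map _ _ _ _ _ (act2 a) (act2 q) hh _ n x hact).
- move=> dl dl0.
  have [eta [n [eta0 P]]] := walk_not_concentrated p_ge0 p_sum qsys q_no_finite qleb c01 gapc dl0.
  exists eta, n; split => // x v; apply: le_trans (P (h x) v).
  rewrite -(@walk_map _ _ _ _ _ a q h _ n x) // => k y.
  by rewrite /q (qaE p_ge0 p_sum sys a_null h1 hst hc).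
Qed.

End GroupWalk.

(** * Random products *)

Lemma nneseries_dexp (R : realType) (p : nat -> R) (f : nat -> R) :
  (forall k, 0 <= p k) -> series p @ \oo --> (1 : R) -> bnd f ->
  (\sum_(k <oo) (p k * f k)%:E = (dexp p f)%:E)%E.
Proof.
move=> p0 p1 fb; rewrite /dexp -EFin_lim; last exact: (dexp_is_cvg p0 p1 fb).
by congr (limn _); apply/funext => n /=; rewrite /series /= -sumEFin.
Qed.

Lemma measure_bigcup_nat d (R : realType) (T : measurableType d)
    (m : {measure set T -> \bar R}) (F : nat -> set T) :
  (forall i, measurable (F i)) -> trivIset setT F ->
  m (\bigcup_i F i) = (\sum_(i <oo) m (F i))%E.
Proof.
move=> mF tF; rewrite measure_bigcup //.
by apply: eq_eseriesl => i; rewrite in_setT.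
Qed.

Section ProductMean.
Variables (R : realType) (T1 T2 : Type) (E1 : mean R T1) (E2 : mean R T2).

Let pexp (f : T1 * T2 -> R) := E1 (fun i => E2 (fun j => f (i, j))).

Let inner_bnd (f : T1 * T2 -> R) : bnd f -> bnd (fun i => E2 (fun j => f (i, j))).
Proof. by move=> [B fB]; exists B => i; exact: expect_norm. Qed.

Let slice_bnd (f : T1 * T2 -> R) i : bnd f -> bnd (fun j => f (i, j)).
Proof. by move=> [B fB]; exists B. Qed.

Let pexpD f g : bnd f -> bnd g -> pexp (fun x => f x + g x) = pexp f + pexp g.
Proof.
move=> fb gb; rewrite /pexp -expectD; [|exact: inner_bnd..].
by congr (expect E1 _); apply/funext => i; rewrite expectD //; exact: slice_bnd.
Qed.

Let pexpZ c f : bnd f -> pexp (fun x => c * f x) = c * pexp f.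
Proof.
move=> fb; rewrite /pexp -expectZ; last exact: inner_bnd.
by congr (expect E1 _); apply/funext => i; rewrite expectZ //; exact: slice_bnd.
Qed.

Let pexp_le f g : bnd f -> bnd g -> (forall x, f x <= g x) -> pexp f <= pexp g.
Proof.
move=> fb gb fg; apply: expect_le; [exact: inner_bnd..|] => i.
by apply: expect_le => //; exact: slice_bnd.
Qed.

Let pexp_cst c : pexp (fun=> c) = c.
Proof.
rewrite /pexp -[RHS](@expect_cst _ _ E1); congr (expect E1 _).
by apply/funext => i; rewrite expect_cst.
Qed.

Definition pmean : mean R (T1 * T2) := Mean pexpD pexpZ pexp_le pexp_cst.

Lemma pmean_fst f : pmean (fun x => f x.1) = E1 f.
Proof.
rewrite -[LHS]/(E1 (fun i => E2 (fun=> f i))).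
by congr (expect E1 _); apply/funext => i; rewrite expect_cst.
Qed.

Lemma pmean_snd f : pmean (fun x => f x.2) = E2 f.
Proof. by rewrite -[RHS](@expect_cst _ _ E1). Qed.

Lemma pmeanM f g : bnd f -> bnd g -> pmean (fun x => f x.1 * g x.2) = E1 f * E2 g.
Proof.
move=> fb gb; rewrite -[LHS]/(E1 (fun i => E2 (fun j => f i * g j))) mulrC.
by rewrite -expectZ //; congr (expect E1 _); apply/funext => i; rewrite expectZ // mulrC.
Qed.

Section ProductWalk.
Variables (X1 X2 : Type) (act1 : T1 -> X1 -> X1) (act2 : T2 -> X2 -> X2).

Definition pact (k : T1 * T2) (x : X1 * X2) := (act1 k.1 x.1, act2 k.2 x.2).

Lemma walk_pact n f g x : bnd f -> bnd g ->
  walk pmean pact n (fun y => f y.1 * g y.2) x = walk E1 act1 n f x.1 * walk E2 act2 n g x.2.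
Proof.
move=> fb gb; elim: n x => [|n IH] x //=.
rewrite -pmeanM; [|exact: walk_bnd_act..].
by congr (expect pmean _); apply/funext => k; rewrite IH.
Qed.

End ProductWalk.
End ProductMean.

(** * Events of the sample space that depend on finite words *)

Section Sample.
Variables (R : realType) (mu1 mu2 : CircMap R -> R).
Variables (w1 : circle_walk mu1) (w2 : circle_walk mu2).
Variable P : probability (Omega R) R.
Hypothesis Piid : is_iid_product mu1 mu2 P.

Local Notation T := (nat * nat)%type.
Let p1 := cw_p w1.
Let p2 := cw_p w2.
Definition sample_mean := pmean (cw_E w1) (cw_E w2).

(** On these sequences the codes determine the steps. *)
Definition typical : set (Omega R) :=
  [set x | forall k, 0 < mu1 (x.1 k) /\ 0 < mu2 (x.2 k)].

Definition letter (x : Omega R) k : T := (cw_code w1 (x.1 k), cw_code w2 (x.2 k)).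

Definition prefix n x : seq T := mkseq (letter x) n.

Definition wcyl (w : seq T) : set (Omega R) :=
  [set x | (forall k, (k < size w)%N -> 0 < mu1 (x.1 k) /\ 0 < mu2 (x.2 k)) /\
    prefix (size w) x = w].

Definition weight (w : seq T) : R := \prod_(k <- w) (p1 k.1 * p2 k.2).

Lemma prefixS n x : prefix n.+1 x = rcons (prefix n x) (letter x n).
Proof. by rewrite /prefix mkseqS. Qed.

Lemma size_prefix n x : size (prefix n x) = n.
Proof. exact: size_mkseq. Qed.

Let weight_rcons w k : weight (rcons w k) = weight w * (p1 k.1 * p2 k.2).
Proof. by rewrite /weight -cats1 big_cat big_seq1. Qed.

Lemma wcyl_cyl w : all (fun k => (0 < p1 k.1) && (0 < p2 k.2)) w ->
  exists a b, wcyl w = cyl (size w) a b /\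
    \prod_(k < size w) (mu1 (a k) * mu2 (b k)) = weight w.
Proof.
move=> pw.
have ex k : exists g : CircMap R * CircMap R, (k < size w)%N ->
    [/\ 0 < mu1 g.1, 0 < mu2 g.2, cw_code w1 g.1 = (nth (0, 0)%N w k).1 &
        cw_code w2 g.2 = (nth (0, 0)%N w k).2].
  have [kw|kw] := ltnP k (size w); last by exists (id, id).
  have /andP[/cw_code_onto[g g0 gk] /cw_code_onto[h h0 hk]] :=
    allP pw _ (mem_nth (0, 0)%N kw).
  by exists (g, h).
have [g gP] := choice ex.
exists (fun k => (g k).1), (fun k => (g k).2); split.
  apply/seteqP; split=> x.
    move=> [xpos xw] k kw; have [g1 g2 c1 c2] := gP k kw; have [x1 x2] := xpos k kw.
    have := congr1 (fun v => nth (0, 0)%N v k) xw; rewrite /= nth_mkseq // => e.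
    split; [apply: (@cw_code_inj _ _ w1)|apply: (@cw_code_inj _ _ w2)] => //.
      by rewrite c1 -e.
    by rewrite c2 -e.
  move=> xc; split=> [k kw|].
    by have [-> ->] := xc k kw; have [] := gP k kw.
  apply: (@eq_from_nth _ (0, 0)%N); rewrite size_prefix // => k kw.
  rewrite nth_mkseq // /letter; have [-> ->] := xc k kw.
  by have [_ _ -> ->] := gP k kw; case: (nth _ _ _).
rewrite /weight (big_nth (0, 0)%N) big_mkord; apply: eq_bigr => k _.
have [g1 g2 <- <-] := gP k (ltn_ord k).
by rewrite /p1 /p2; have [-> _] := cw_step w1 g1; have [-> _] := cw_step w2 g2.
Qed.

Lemma wcyl_null w : ~~ all (fun k => (0 < p1 k.1) && (0 < p2 k.2)) w ->
  wcyl w = set0 /\ weight w = 0.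
Proof.
move=> /allPn[k kw]; rewrite negb_and => pk; split.
  apply/seteqP; split=> // x [xpos xw]; exfalso.
  move: kw; rewrite -xw => /mapP[i]; rewrite mem_iota /= add0n => iw ek.
  have [x1 x2] := xpos i iw; move: pk; rewrite ek /= /p1 /p2.
  by have [-> _] := cw_step w1 x1; have [-> _] := cw_step w2 x2; rewrite x1 x2.
rewrite /weight (big_rem k) //=; move: pk; rewrite -!leNgt => /orP[pk|pk].
  have -> : p1 k.1 = 0 by apply/eqP; rewrite eq_le pk cw_p_ge0.
  by rewrite !mul0r.
have -> : p2 k.2 = 0 by apply/eqP; rewrite eq_le pk cw_p_ge0.
by rewrite mulr0 mul0r.
Qed.

Lemma wcyl_measurable w : measurable (wcyl w).
Proof.
case: (boolP (all (fun k => (0 < p1 k.1) && (0 < p2 k.2)) w)) => [pw|/wcyl_null[-> _] //].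
have [a [b [-> _]]] := wcyl_cyl pw.
by apply: sub_sigma_algebra; exists (size w), a, b.
Qed.

Lemma wcyl_prob w : P (wcyl w) = (weight w)%:E.
Proof.
case: (boolP (all (fun k => (0 < p1 k.1) && (0 < p2 k.2)) w)) => [pw|].
  by have [a [b [-> <-]]] := wcyl_cyl pw; exact: Piid.
by move=> /wcyl_null[-> ->]; rewrite measure0.
Qed.

Lemma wcyl_rcons_sub w k : wcyl (rcons w k) `<=` wcyl w.
Proof.
move=> x []; rewrite size_rcons => xpos; rewrite prefixS => /rcons_inj[xw _].
by split=> // i iw; apply: xpos; rewrite ltnS ltnW.
Qed.

(** At its first bad index a sequence lies in the cylinder of its word so far, but in none of the
    one-letter extensions, which exhaust the weight of that word. There are countably many words. *)
Lemma typical_negligible : P.-negligible (~` typical).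
Proof.
pose ch w := \bigcup_i \bigcup_j wcyl (rcons w (i, j)).
have mch w : measurable (ch w).
  by do 2! apply: bigcup_measurable => ? _; exact: wcyl_measurable.
have Pch w : P (ch w) = (weight w)%:E.
  have triv2 i : trivIset setT (fun j => wcyl (rcons w (i, j))).
    apply/trivIsetP => j j' _ _ jj'; apply/seteqP; split=> // x [[_ +] [_]].
    rewrite !size_rcons !prefixS => /rcons_inj[_ _ e] /rcons_inj[_ _ e'].
    by move: jj'; rewrite -e -e' eqxx.
  have P2 i : P (\bigcup_j wcyl (rcons w (i, j))) = (weight w * p1 i)%:E.
    rewrite measure_bigcup_nat //; last by move=> j; exact: wcyl_measurable.
    transitivity (\sum_(j <oo) (p2 j * (weight w * p1 i))%:E)%E.
      apply: eq_eseriesr => j _; apply: (etrans (wcyl_prob _)).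
      by rewrite weight_rcons mulrA mulrC.
    rewrite nneseries_dexp; [|exact: cw_p_ge0|exact: cw_p_sum|exact: bnd_cst].
    by rewrite (dexp_cst (cw_p_sum w2)).
  rewrite /ch measure_bigcup_nat //.
  - transitivity (\sum_(i <oo) (p1 i * weight w)%:E)%E.
      by apply: eq_eseriesr => i _; apply: (etrans (P2 _)); rewrite mulrC.
    rewrite nneseries_dexp; [|exact: cw_p_ge0|exact: cw_p_sum|exact: bnd_cst].
    by rewrite (dexp_cst (cw_p_sum w1)).
  - by move=> i; apply: bigcup_measurable => j _; exact: wcyl_measurable.
  - apply/trivIsetP => i i' _ _ ii'; apply/seteqP; split=> // x [[j _ [_ +]] [j' _ [_]]].
    rewrite !size_rcons !prefixS => /rcons_inj[_ e _] /rcons_inj[_ e' _].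
    by move: ii'; rewrite -e -e' eqxx.
pose N n := if @unpickle (seq T) n is Some w then wcyl w `\` ch w else set0.
apply: (@negligibleS _ _ _ _ (\bigcup_n N n)); last first.
  apply: negligible_bigcup => n; rewrite /N; case: unpickle => [w|]; last exact: negligible_set0.
  apply/negligibleP; first exact: measurableD (wcyl_measurable w) (mch w).
  have chw : ch w `<=` wcyl w by move=> x [i _ [j _]]; exact: wcyl_rcons_sub.
  rewrite measureD //=; first by rewrite (setIidr chw) wcyl_prob Pch subee.
  - exact: wcyl_measurable.
  - by rewrite wcyl_prob ltry.
move=> x /= ntx.
have [k bad mink] : exists2 k, ~ (0 < mu1 (x.1 k) /\ 0 < mu2 (x.2 k)) &
    forall i, (i < k)%N -> 0 < mu1 (x.1 i) /\ 0 < mu2 (x.2 i).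
  have /asboolP ex : `[< exists k, ~~ `[< 0 < mu1 (x.1 k) /\ 0 < mu2 (x.2 k) >] >].
    apply/asboolP; apply: contrapT => nk; apply: ntx => k; apply: contrapT => nok.
    by apply: nk; exists k; apply/asboolP.
  have [k /asboolP bad mink] := ex_minnP ex; exists k => // i ik.
  apply: contrapT => nok; have := mink i; rewrite leqNgt ik => /(_ _).
  by move=> h; have : false by apply: h; apply/asboolP.
exists (pickle (prefix k x)) => //; rewrite /N pickleK; split.
  by split; rewrite size_prefix.
move=> [i _ [j _ [+ _]]]; rewrite size_rcons size_prefix => /(_ k (ltnSn k)).
exact: bad.
Qed.

Local Notation app := (fun (k : T) w => rcons w k).

(** The recursion matches that of [walk]: Boole's inequality, applied letter by letter, bounds the
    probability by the expectation. *)
Fixpoint cover m (D : seq T -> bool) w : set (Omega R) :=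
  if m is m'.+1 then \bigcup_i \bigcup_j cover m' D (rcons w (i, j))
  else if D w then wcyl w else set0.

Lemma cover_measurable m (D : seq T -> bool) w : measurable (cover m D w).
Proof.
elim: m w => [|m IH] w /=; first by case: ifP => // _; exact: wcyl_measurable.
by do 2! apply: bigcup_measurable => ? _.
Qed.

Lemma cover_prob m (D : seq T -> bool) w : (P (cover m D w) <=
  (weight w * walk sample_mean app m (fun v => (D v)%:R) w)%:E)%E.
Proof.
elim: m w => [|m IH] w /=.
  by case: (D w); rewrite /= ?measure0 ?mulr1 ?mulr0 ?wcyl_prob.
have Db : bnd (fun v => (D v)%:R : R) by exact: bnd_bool.
pose f i j := walk sample_mean app m (fun v => (D v)%:R) (rcons w (i, j)).
have fB i j : `|f i j| <= 1.
  by apply: walk_norm => v; case: (D v); rewrite /= ?normr1 ?normr0.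
have fb i : bnd (f i) by exists 1 => j.
have Eb : bnd (fun i => cw_E w2 (f i)) by exists 1 => i; exact: expect_norm.
have -> : (weight w * cw_E w1 (fun i => cw_E w2 (f i)))%:E =
    (\sum_(i <oo) (p1 i * (weight w * cw_E w2 (f i)))%:E)%E.
  rewrite nneseries_dexp; [|exact: cw_p_ge0|exact: cw_p_sum|exact: bndZ].
  by rewrite (dexp_Z (cw_p_ge0 w1) (cw_p_sum w1)).
apply: (@le_trans _ _ (\sum_(i <oo) P (\bigcup_j cover m D (rcons w (i, j))))%E).
  apply: generalized_Boole_inequality.
    by move=> i; apply: bigcup_measurable => j _; exact: cover_measurable.
  by do 2! apply: bigcup_measurable => ? _; exact: cover_measurable.
apply: lee_nneseries => [i _ _|i _]; first exact: measure_ge0.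
have -> : (p1 i * (weight w * cw_E w2 (f i)))%:E =
    (\sum_(j <oo) (p2 j * (p1 i * weight w * f i j))%:E)%E.
  rewrite nneseries_dexp; [|exact: cw_p_ge0|exact: cw_p_sum|exact: bndZ].
  by rewrite (dexp_Z (cw_p_ge0 w2) (cw_p_sum w2)) // mulrA.
apply: (@le_trans _ _ (\sum_(j <oo) P (cover m D (rcons w (i, j))))%E).
  apply: generalized_Boole_inequality; first by move=> j; exact: cover_measurable.
  by apply: bigcup_measurable => j _; exact: cover_measurable.
apply: lee_nneseries => [j _ _|j _]; first exact: measure_ge0.
apply: (le_trans (IH _)); rewrite lee_fin weight_rcons /= -/(f i j).
by rewrite le_eqVlt; apply/orP; left; apply/eqP; ring.
Qed.

Lemma typical_cover m (D : seq T -> bool) w x : typical x -> prefix (size w) x = w ->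
  D (prefix (size w + m) x) -> cover m D w x.
Proof.
elim: m w => [|m IH] w tx xw /=.
  by rewrite addn0 xw => ->; split.
move=> Dx; exists (letter x (size w)).1 => //; exists (letter x (size w)).2 => //.
apply: IH => //; first by rewrite size_rcons prefixS xw; case: (letter _ _).
by rewrite size_rcons addSnnS.
Qed.

(** A measurable superset is enough, since it serves only to bound probabilities and to find null
    sets. *)
Lemma prefix_event n (D : seq T -> bool) : exists A, [/\ measurable A,
  [set x | typical x /\ D (prefix n x)] `<=` A &
  (P A <= (walk sample_mean app n (fun v => (D v)%:R) [::])%:E)%E].
Proof.
exists (cover n D [::]); split; first exact: cover_measurable.
  by move=> x [tx Dx]; apply: typical_cover.
by have := cover_prob n D [::]; rewrite /weight big_nil mul1r.
Qed.

Lemma borel_cantelli_prefix (l : nat -> nat) (D : nat -> seq T -> bool) (B : R) :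
  (forall N, \sum_(i < N) walk sample_mean app (l i) (fun v => (D i v)%:R) [::] <= B) ->
  P.-negligible [set x | typical x /\
    forall i0, exists2 i, (i0 <= i)%N & D i (prefix (l i) x)].
Proof.
move=> sumB; have [A AP] := choice (fun i => prefix_event (l i) (D i)).
have mA i : measurable (A i) by have [] := AP i.
apply: (@negligibleS _ _ _ _ (lim_sup_set A)).
  move=> x [tx inf] n _; have [i ni Di] := inf n; exists i => //.
  by have [_ sub _] := AP i; apply: sub.
apply/negligibleP.
  by apply: bigcap_measurable => // n _; apply: bigcup_measurable.
apply: lim_sup_set_cvg0 => //.
apply: (@le_lt_trans _ _ (B%:E)); last exact: ltry.
apply: lime_le; first by apply: is_cvg_nneseries.
near=> N; rewrite big_mkord.
apply: (@le_trans _ _ (\sum_(i < N)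
    (walk sample_mean app (l i) (fun v => (D i v)%:R) [::])%:E)%E).
  by apply: lee_sum => i _; have [] := AP i.
by rewrite sumEFin lee_fin.
Unshelve. all: by end_near. Qed.

End Sample.

(** * Frequencies *)

Section Chernoff.
Variables (R : realType) (T X : Type) (E : mean R T) (act : T -> X -> X).
Variables (x0 : X) (C : X -> bool) (K q : nat).
Hypothesis q0 : (0 < q)%N.
Hypothesis CK : forall x, walk E act K (fun y => (C y)%:R) x <= q%:R^-1.

Local Notation app := (fun (k : T) w => rcons w k).

Lemma walk_app_le n (f g : seq T -> R) w : bnd f -> bnd g ->
  (forall u, size u = n -> f (w ++ u) <= g (w ++ u)) ->
  walk E app n f w <= walk E app n g w.
Proof.
move=> fb gb; elim: n w => [|n IH] w fg /=.
  by have := fg [::] erefl; rewrite cats0.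
apply: expect_le; [exact: walk_bnd_act..|] => k; apply: IH => u su.
by rewrite cat_rcons; apply: fg; rewrite /= su.
Qed.

(** Visits at the times [r + K], [r + 2 * K] and so on: successive times are [K] steps apart, so
    [CK] applies to each given the past. *)
Definition cnt r J w : nat :=
  \sum_(j < J) C (run act x0 (take (r + j.+1 * K) w)).

Lemma cnt_le r J w : (cnt r J w <= J)%N.
Proof.
rewrite -[leqRHS]card_ord -sum1_card; apply: leq_sum => j _.
by case: (C _).
Qed.

Lemma pow_cnt_bnd r J : bnd (fun w => 2 ^+ cnt r J w : R).
Proof.
apply: (@bnd_itv _ _ 0 (2 ^+ J)) => w; rewrite exprn_ge0 //=.
by apply: ler_weXn2l; rewrite ?ler1n // cnt_le.
Qed.

(** Exponential moment with base 2: a visit multiplies it by [2 ^ C = 1 + C], whose mean given the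
    past is at most [1 + 1 / q]. *)
Lemma chernoff_step r J : walk E app (r + J * K) (fun w => 2 ^+ cnt r J w) [::]
  <= (1 + q%:R^-1 : R) ^+ J.
Proof.
elim: J => [|J IH].
  rewrite expr0 mul0n addn0.
  have -> : (fun w => 2 ^+ cnt r 0 w : R) = fun=> 1.
    by apply/funext => w; rewrite /cnt big_ord0.
  by rewrite walk_cst.
rewrite mulSn [(K + _)%N]addnC addnA walk_add exprS.
apply: (@le_trans _ _ ((1 + q%:R^-1) * walk E app (r + J * K) (fun w => 2 ^+ cnt r J w) [::]));
  last by rewrite ler_wpM2l // addr_ge0 // invr_ge0.
have fb : bnd (walk E app K (fun w => 2 ^+ cnt r J.+1 w)) := walk_bnd _ _ _ (pow_cnt_bnd _ _).
rewrite -walkZ; last exact: pow_cnt_bnd.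
apply: walk_app_le => //; first exact: bndZ (pow_cnt_bnd _ _).
move=> w; rewrite cat0s => sw.
pose g v : R := 1 + (C (run act x0 v))%:R.
have Cb : bnd (fun v => (C (run act x0 v))%:R : R) by exact: bnd_bool.
have gb : bnd g by apply: bndD => //; exact: bnd_cst.
apply: (@le_trans _ _ (walk E app K (fun v => 2 ^+ cnt r J w * g v) w)).
  apply: walk_app_le; [exact: pow_cnt_bnd|exact: bndZ|] => u su.
  have -> : cnt r J.+1 (w ++ u) = (cnt r J w + C (run act x0 (w ++ u)))%N.
    rewrite /cnt big_ord_recr /=; congr (_ + _)%N; last first.
      by rewrite take_oversize // size_cat sw su mulSn addnCA addnC.
    apply: eq_bigr => j _; rewrite take_cat sw ltn_add2l.
    case: ltnP => // jJ; have e : (j.+1 * K = J * K)%N.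
      by apply/eqP; rewrite eqn_leq jJ leq_mul2r ltn_ord orbT.
    by rewrite e subnn take0 cats0 take_oversize // sw.
  by rewrite exprD /g; case: (C _); rewrite ?expr1 ?expr0 // addr0.
rewrite walkZ // mulrC ler_wpM2r ?exprn_ge0 //.
rewrite /g walkD //; last exact: bnd_cst.
rewrite walk_cst lerD2l.
rewrite (@walk_map _ _ _ _ E app act (run act x0) (fun y => (C y)%:R)) //.
by move=> k v; rewrite run_rcons.
Qed.

Lemma one_plus_inv_pow : (1 + q%:R^-1 : R) ^+ q <= 4.
Proof.
(* From [1 - 1/2 <= expR (- 1/2)]. *)
have e2 : expR (2^-1) <= 2 :> R.
  have := expR_ge1Dx (- 2^-1 : R); rewrite expRN => h.
  have h2 : 2^-1 <= (expR (2^-1))^-1 :> R by apply: le_trans h; lra.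
  by move: h2; rewrite lef_pV2 ?posrE ?expR_gt0.
apply: (@le_trans _ _ (expR (q%:R^-1) ^+ q)).
  by apply: lerXn2r; rewrite ?nnegrE ?addr_ge0 ?expR_ge0 ?expR_ge1Dx.
rewrite -expRM_natl mulfV ?pnatr_eq0 -?lt0n //.
have -> : 1 = 2^-1 + 2^-1 :> R by lra.
rewrite expRD; have := expR_ge0 (2^-1 : R); nra.
Qed.

(** Markov for [2 ^ cnt] at the level [2 ^ (4 * i) = 16 ^ i], against a mean of at most [4 ^ i]. *)
Lemma chernoff r i : walk E app (r + q * i * K)
  (fun w => (4 * i <= cnt r (q * i) w)%N%:R) [::] <= (4^-1 : R) ^+ i.
Proof.
apply: (@le_trans _ _ (16 ^- i * (1 + q%:R^-1) ^+ (q * i))); last first.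
  rewrite mulrC ler_pdivrMr ?exprn_gt0 // -exprMn exprM.
  have -> : 4^-1 * 16 = 4 :> R by lra.
  by apply: lerXn2r;
    rewrite ?nnegrE ?one_plus_inv_pow ?exprn_ge0 ?addr_ge0 ?invr_ge0.
apply: le_trans (ler_wpM2l _ (chernoff_step r (q * i))); last first.
  by rewrite invr_ge0 exprn_ge0.
rewrite -walkZ; last exact: pow_cnt_bnd.
apply: walk_le; [exact: bnd_bool|exact: bndZ (pow_cnt_bnd _ _)|] => w.
case: leqP => /= ci; last by rewrite mulr_ge0 ?invr_ge0 ?exprn_ge0.
rewrite mulrC ler_pdivlMr ?exprn_gt0 // mul1r.
have -> : 16 = 2 ^+ 4 :> R by lra.
by rewrite -exprM ler_weXn2l // ler1n.
Qed.

Lemma chernoff_sum r N : \sum_(i < N) walk E app (r + q * i * K)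
  (fun w => (4 * i <= cnt r (q * i) w)%N%:R) [::] <= 2.
Proof.
apply: (@le_trans _ _ (\sum_(i < N) (4^-1 : R) ^+ i)).
  by apply: ler_sum => i _; exact: chernoff.
suff -> : \sum_(i < N) (4^-1 : R) ^+ i = 4 / 3 * (1 - 4^-1 ^+ N).
  by have := exprn_ge0 N (_ : 0 <= 4^-1 :> R) => /(_ ltac:(lra)); lra.
elim: N => [|N IH]; first by rewrite big_ord0 expr0 subrr mulr0.
by rewrite big_ord_recr /= IH exprS; lra.
Qed.

End Chernoff.

Lemma sum_residues (c : nat -> nat) K J :
  (\sum_(t < K + J * K) c t =
   \sum_(t < K) c t + \sum_(r < K) \sum_(j < J) c (r + j.+1 * K))%N.
Proof.
elim: J => [|J IH].
  by rewrite mul0n addn0 [X in (_ + X)%N]big1 ?addn0 // => r _; rewrite big_ord0.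
rewrite mulSn [(K + (K + J * K))%N]addnC big_split_ord /= IH -addnA; congr (_ + _)%N.
rewrite -big_split /=; apply: eq_bigr => r _; rewrite big_ord_recr /=.
by congr (_ + c _)%N; rewrite mulSn [RHS]addnC.
Qed.

Section Frequency.
Variables (R : realType) (mu1 mu2 : CircMap R -> R).
Variables (w1 : circle_walk mu1) (w2 : circle_walk mu2).
Variable P : probability (Omega R) R.
Hypothesis Piid : is_iid_product mu1 mu2 P.
Variables (X : Type) (act : nat * nat -> X -> X) (x0 : X) (C : X -> bool) (K q : nat).
Hypothesis q0 : (0 < q)%N.
Hypothesis K0 : (0 < K)%N.
Hypothesis CK : forall x,
  walk (sample_mean w1 w2) act K (fun y => (C y)%:R) x <= q%:R^-1.

(** By Borel-Cantelli each residue class has fewer than [4 * i] visits among [q * i] times. The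
    fifth unit absorbs the first block and the rounding of [n] to a multiple of [q * K]. *)
Lemma frequency_le : P.-negligible [set x | typical mu1 mu2 x /\
  forall n0, exists2 n, (n0 <= n)%N &
    (5 * n < q * \sum_(t < n) C (run act x0 (prefix w1 w2 t x)))%N].
Proof.
pose bad r := [set x | typical mu1 mu2 x /\ forall i0, exists2 i, (i0 <= i)%N &
  (4 * i <= cnt act x0 C K r (q * i) (prefix w1 w2 (r + q * i * K) x))%N].
apply: (@negligibleS _ _ _ _ (\bigcup_r bad r)); last first.
  apply: negligible_bigcup => r.
  apply: (@borel_cantelli_prefix _ _ _ w1 w2 P Piid (fun i => r + q * i * K)%N
    (fun i w => 4 * i <= cnt act x0 C K r (q * i) w)%N 2).
  by move=> N; exact: (chernoff_sum x0 q0 CK).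
move=> x [tx inf]; apply: contrapT => nb.
have ok r : exists i0, forall i, (i0 <= i)%N ->
    (cnt act x0 C K r (q * i) (prefix w1 w2 (r + q * i * K) x) < 4 * i)%N.
  apply: contrapT => ni; apply: nb; exists r => //; split=> // i0.
  apply: contrapT => ne; apply: ni; exists i0 => i ii0; rewrite ltnNge; apply/negP => h.
  by apply: ne; exists i.
have [i0 i0P] := choice ok.
pose I := \max_(r < K) i0 r.
(* [5 * q * K <= n] pays for the first block and the rounding; the summand [I] puts [i] beyond the
   thresholds of all classes. *)
have [n nn] := inf (q * K * (I + 5))%N; apply/negP; rewrite -leqNgt.
pose c t : nat := C (run act x0 (prefix w1 w2 t x)).
pose i := (n %/ (q * K)).+1.
have qK : (0 < q * K)%N by rewrite muln_gt0 q0.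
have ni : (n <= q * i * K)%N.
  by rewrite mulnAC mulnC ltnW // ltn_ceil.
have ni2 : (q * i * K <= n + q * K)%N.
  by rewrite mulnAC /i mulnS addnC leq_add2r mulnC leq_trunc_div.
have Ii : (I <= i)%N.
  rewrite /i ltnW // ltnS leq_divRL //.
  by rewrite mulnC (leq_trans _ nn) // leq_mul2l leq_addr orbT.
have sumc : (\sum_(t < n) c t <= K + K * (4 * i))%N.
  apply: (@leq_trans (\sum_(t < K + q * i * K) c t)).
    have /subnKC <- : (n <= K + q * i * K)%N by rewrite (leq_trans ni) // leq_addl.
    by rewrite big_split_ord /= leq_addr.
  rewrite sum_residues leq_add //.
    rewrite -[leqRHS]card_ord -sum1_card; apply: leq_sum => t _; rewrite /c.
    by case: (C _).
  rewrite -[X in (_ <= X * _)%N]card_ord -sum_nat_const; apply: leq_sum => r _.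
  have /ltnW := i0P r i (leq_trans (leq_bigmax r) Ii); apply: leq_trans.
  rewrite /cnt; apply: leq_sum => j _; rewrite /c /prefix.
  rewrite -map_take take_iota (minn_idPl _) //.
  by rewrite leq_add2l leq_mul2r ltn_ord orbT.
rewrite -/(c _); apply: (@leq_trans (q * (K + K * (4 * i)))).
  by rewrite leq_mul2l sumc orbT.
have -> : (q * (K + K * (4 * i)) = q * K + 4 * (q * i * K))%N.
  by rewrite mulnDr; congr (_ + _)%N; rewrite !mulnA [(q * K)%N]mulnC; ring.
apply: (@leq_trans (q * K + 4 * (n + q * K))); first by rewrite leq_add2l leq_mul2l ni2 orbT.
have : (q * K * 5 <= n)%N by rewrite (leq_trans _ nn) // leq_mul2l leq_addl orbT.
rewrite mulnDr => h.
have -> : (q * K + (4 * n + 4 * (q * K)) = 4 * n + q * K * 5)%N by ring.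
by rewrite [(5 * n)%N]mulSn addnC leq_add2r.
Qed.

End Frequency.

(** Fubini: with the second walk frozen at its final position, the bound for the first is uniform
    and survives averaging. *)
Lemma walk_pact_slice (R : realType) (p r : nat -> R)
  (p0 : forall k, 0 <= p k) (p1 : series p @ \oo --> (1 : R))
  (r0 : forall k, 0 <= r k) (r1 : series r @ \oo --> (1 : R))
  (X Y : Type) (actX : nat -> X -> X) (actY : nat -> Y -> Y) n (f : X * Y -> R) d x :
  bnd f ->
  (forall u v, walk (dmean p0 p1) actX n (fun u' => f (u', v)) u <= d) ->
  walk (pmean (dmean p0 p1) (dmean r0 r1)) (pact actX actY) n f x <= d.
Proof.
move=> fb fd; set E1 := dmean p0 p1 in fd *; set E2 := dmean r0 r1.
have fb1 v : bnd (fun u => f (u, v)) by exact: (bnd_comp (fun u => (u, v)) fb).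
suff -> : walk (pmean E1 E2) (pact actX actY) n f x =
    walk E2 actY n (fun v => walk E1 actX n (fun u => f (u, v)) x.1) x.2.
  rewrite -[leRHS](walk_cst E2 actY n d x.2); apply: walk_le => //.
    by case: fb => B fB; exists B => v; exact: walk_norm.
  exact: bnd_cst.
have [B fB] := fb.
elim: n x {fd} => [|n IH] [u v] //=.
rewrite -[LHS]/(E1 (fun i => E2 (fun j =>
  walk (pmean E1 E2) (pact actX actY) n f (actX i u, actY j v)))).
have -> : (fun i => E2 (fun j => walk (pmean E1 E2) (pact actX actY) n f (actX i u, actY j v))) =
  (fun i => E2 (fun j => walk E2 actY n
     (fun v' => walk E1 actX n (fun u' => f (u', v')) (actX i u)) (actY j v))).
  by apply/funext => i; congr (expect E2 _); apply/funext => j; rewrite IH.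
have wB i v' : `|walk E1 actX n (fun u' => f (u', v')) (actX i u)| <= B by exact: walk_norm.
rewrite [LHS](dexp_exchange (B := B)) //; last by move=> i j; exact: walk_norm.
congr (dexp r _); apply/funext => j.
exact: (@walk_exchange _ _ _ p0 p1 r0 r1 _ actY n (actY j v)
  (fun i v' => walk E1 actX n (fun u' => f (u', v')) (actX i u)) B).
Qed.

Lemma hits_image (R : realType) (h : R -> R) (r eta v y : R) : degree_one h ->
  (forall t, h (t + r) - h (t - r) < eta) -> hits v r y -> hits (h v) eta (h y).
Proof.
move=> h1 hr /asboolP[z hz]; apply/asboolP; exists z; rewrite -(degree_oneDz h1).
move: hz; rewrite ler_norml => hz.
have l1 : h (v - r) <= h (y + z%:~R) by apply: degree_one_le => //; lra.
have l2 : h (y + z%:~R) <= h (v + r) by apply: degree_one_le => //; lra.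
have l3 : h (v - r) <= h v by apply: degree_one_le => //; lra.
have l4 : h v <= h (v + r) by apply: degree_one_le => //; lra.
by have := hr v; rewrite ler_norml; lra.
Qed.

(** * Upper frequencies of sets of times *)

Section UpperFrequency.
Local Open Scope nat_scope.
Implicit Types Q : nat -> bool.

(** Upper density at most [a / q], kept in natural numbers: [a] grows with the number of events,
    while [q] will tend to infinity. *)
Definition freq_le (a q : nat) Q :=
  exists n0, forall n, n0 <= n -> q * \sum_(t < n) Q t <= a * n.

Lemma freq_or a a' q Q Q' : freq_le a q Q -> freq_le a' q Q' ->
  freq_le (a + a') q (fun t => Q t || Q' t).
Proof.
move=> [n0 h] [n1 h']; exists (maxn n0 n1) => n; rewrite geq_max => /andP[/h A /h' B].
rewrite mulnDl; apply: leq_trans (leq_add A B); rewrite -mulnDr leq_mul2l; apply/orP; right.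
rewrite -big_split /=; apply: leq_sum => t _; by case: (Q t); case: (Q' t).
Qed.

Lemma freq_weaken a a' q Q : a <= a' -> freq_le a q Q -> freq_le a' q Q.
Proof.
move=> aa' [n0 h]; exists n0 => n /h; move/leq_trans; apply.
by rewrite leq_mul2r aa' orbT.
Qed.

(** The extra unit pays for the first [m] times once [n] exceeds [q * m]. *)
Lemma freq_sub a q Q Q' : (exists m, forall t, m <= t -> Q t -> Q' t) ->
  freq_le a q Q' -> freq_le a.+1 q Q.
Proof.
move=> [m sub] [n0 h]; exists (maxn n0 (q * m)) => n; rewrite geq_max => /andP[/h A B].
rewrite mulSn; apply: leq_trans (leq_add B A); rewrite -mulnDr leq_mul2l; apply/orP; right.
have -> : m + \sum_(t < n) Q' t = m + \sum_(0 <= t < n) Q' t by rewrite big_mkord.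
rewrite -(big_mkord xpredT (fun t => nat_of_bool (Q t))).
have [mn|/ltnW nm] := leqP m n; last first.
  apply: leq_trans (leq_addr _ _); apply: (@leq_trans n) => //.
  rewrite -[leqRHS](subn0 n) -[leqRHS]muln1 -sum_nat_const_nat; apply: leq_sum => t _.
  by case: (Q t).
rewrite (big_cat_nat (leq0n m) mn) /= leq_add //.
  rewrite -[leqRHS](subn0 m) -[leqRHS]muln1 -sum_nat_const_nat; apply: leq_sum => t _.
  by case: (Q t).
rewrite (big_cat_nat (leq0n m) mn (P := xpredT) (F := fun t => nat_of_bool (Q' t))) /=.
apply: leq_trans (leq_addl _ _); rewrite big_nat_cond [leqRHS]big_nat_cond.
apply: leq_sum => t /andP[/andP[mt _] _]; have := sub t mt.
by case: (Q t) => // /(_ isT) ->.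
Qed.

Lemma freq_has (I : eqType) (L : seq I) a q (Q : I -> nat -> bool) :
  (forall i, i \in L -> freq_le a q (Q i)) ->
  freq_le (size L * a) q (fun t => has (Q ^~ t) L).
Proof.
elim: L => [|i L IH] QL /=.
  by exists 0 => n _; rewrite big1 ?muln0.
rewrite mulSn; apply: freq_or; first by apply: QL; rewrite mem_head.
by apply: IH => j jL; apply: QL; rewrite inE jL orbT.
Qed.

Lemma freq_cancel a q m Q : 0 < m -> freq_le (m * a) (m * q) Q -> freq_le a q Q.
Proof.
move=> m0 [n0 h]; exists n0 => n /h; by rewrite -!mulnA leq_pmul2l.
Qed.

(** Doubling comes from [n.+1 <= 2 * n]. *)
Lemma freq_shift a q Q : freq_le a q Q -> freq_le a.*2 q (fun t => Q t.+1).
Proof.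
move=> [n0 h]; exists (maxn n0 1) => n; rewrite geq_max => /andP[nn n1].
apply: (@leq_trans (q * \sum_(t < n.+1) Q t)).
  by rewrite leq_mul2l; apply/orP; right; rewrite big_ord_recl leq_addl.
apply: (leq_trans (h _ (leqW nn))); rewrite -muln2 -mulnA leq_mul2l mul2n -addnn.
by rewrite -addn1 leq_add2l n1 orbT.
Qed.

End UpperFrequency.

Lemma density_one_of_freq (R : realType) (Q : nat -> Prop) (a : nat) :
  (forall q0, exists2 q, (q0 < q)%N & freq_le a q (fun t => ~~ `[< Q t >])) ->
  density_one R Q.
Proof.
move=> fr; apply/cvgrPdist_le => e e0.
(* [a * N.+1 <= (2 * a + 1) * N]; the last factor 2 leaves half of [e] for the extra term of the
   sum. *)
have [q qa [n0 h]] := fr (Num.truncn ((2 * a%:R + 1) / e * 2)).+1.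
have qe : (2 * a%:R + 1) / e * 2 < q%:R.
  apply: (lt_trans (truncnS_gt _)); rewrite ltr_nat; exact: qa.
have q0 : 0 < q%:R :> R by rewrite ltr0n (leq_trans _ qa).
near=> N.
have N0 : (0 < N)%N by near: N; exists 1%N.
have Nn : (n0 <= N.+1)%N by near: N; exists n0 => // m /= /leqW.
have Ne : 2 / e < N%:R.
  near: N; exists (Num.truncn (2 / e)).+1 => // m /= hm.
  by apply: (lt_le_trans (truncnS_gt _)); rewrite ler_nat.
have N0' : 0 < N%:R :> R by rewrite ltr0n.
pose B := \sum_(t < N.+1) (~~ `[< Q t >] : nat).
have qB : q%:R * B%:R <= a%:R * N.+1%:R :> R by rewrite -!natrM ler_nat; exact: h.
have sumE : \sum_(n < N.+1) (if `[< Q n >] then 1 else 0) = N.+1%:R - B%:R :> R.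
  rewrite /B natr_sum.
  have -> : N.+1%:R = \sum_(n < N.+1) 1 :> R by rewrite sumr_const card_ord.
  rewrite -sumrB; apply: eq_bigr => n _.
  by case: asboolP; rewrite /= ?subr0 ?subrr.
rewrite sumE -[X in X - _](@divff _ (N%:R : R)) ?gt_eqF // -mulrBl normrM.
rewrite [`|N%:R^-1|]gtr0_norm ?invr_gt0 // ler_pdivrMr //.
(* The sum has [N.+1] terms but is divided by [N], whence the [- 1]. *)
have -> : N%:R - (N.+1%:R - B%:R) = B%:R - 1 :> R by rewrite -natr1; ring.
have B0 : 0 <= B%:R :> R by [].
have Ble : B%:R <= e / 2 * N%:R.
  have : B%:R <= a%:R * N.+1%:R / q%:R :> R by rewrite ler_pdivlMr // mulrC.
  move=> /le_trans; apply; rewrite ler_pdivrMr //.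
  move: qe; rewrite -ltr_pdivlMr // ltr_pdivrMr // => qe.
  have a0 : 0 <= a%:R :> R by [].
  have N1 : 1 <= N%:R :> R by rewrite ler1n.
  rewrite -natr1.
  have aN : a%:R <= a%:R * N%:R :> R by rewrite ler_peMr.
  have : a%:R * (N%:R + 1) <= (2 * a%:R + 1) * N%:R :> R.
    by rewrite mulrDr mulrDl mulr1 mul1r -mulrA; lra.
  move=> /le_trans; apply.
  have -> : e / 2 * N%:R * q%:R = (q%:R / 2 * e) * N%:R by ring.
  by rewrite ler_pM2r // ltW.
have Ne' : 1 <= e / 2 * N%:R.
  move: Ne; rewrite ltr_pdivrMr // => Ne; lra.
by rewrite ler_norml; lra.
Unshelve. all: by end_near. Qed.

Lemma prob_liminf_le d (T : measurableType d) (R : realType) (P : probability T R)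
    (A : nat -> set T) (beta : \bar R) :
  (forall n, measurable (A n)) -> (forall n, P (A n) <= beta)%E ->
  (P (\bigcup_m \bigcap_(n in [set n | (m <= n)%N]) A n) <= beta)%E.
Proof.
move=> mA Ab; pose F m := \bigcap_(n in [set n | (m <= n)%N]) A n.
have mF m : measurable (F m) by apply: bigcap_measurable => //; exists m => /=.
have cv : P \o F @ \oo --> P (\bigcup_m F m).
  apply: nondecreasing_cvg_mu => //; first exact: bigcup_measurable.
  move=> m m' mm'; apply/subsetPset => x Fx n /= nm; apply: Fx => /=.
  exact: leq_trans nm.
rewrite -(cvg_lim _ cv) //; apply: lime_le; first by apply/cvg_ex; exists (P (\bigcup_m F m)).
apply: nearW => m /=; apply: le_trans (Ab m); apply: le_measure; rewrite ?inE //.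
by move=> x Fx; apply: Fx => /=.
Qed.

(** One more step keeps a bound that is uniform in the starting point, and makes the number of steps
    positive. *)
Lemma cw_spread_inv (R : realType) (mu : CircMap R -> R) (w : circle_walk mu) q :
  (0 < q)%N -> exists (eta : R) K, [/\ 0 < eta, (0 < K)%N & forall x v,
    walk (cw_E w) (cw_a w) K (fun y => (hits v eta (cw_h w y))%:R) x <= q%:R^-1].
Proof.
move=> q0; have q1 : 0 < q%:R^-1 :> R by rewrite invr_gt0 ltr0n.
have [eta [n [eta0 sp]]] := cw_spread w q1; exists eta, n.+1; split => // x v.
rewrite -[leLHS]/(cw_E w (fun k => walk (cw_E w) (cw_a w) n
  (fun y => (hits v eta (cw_h w y))%:R) (cw_a w k x))).
rewrite -[leRHS](@expect_cst _ _ (cw_E w)); apply: expect_le => //.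
- by apply: walk_bnd_act; exact: bnd_bool.
- exact: bnd_cst.
Qed.

(** * Masses of arcs along one of the two walks, selected by [pr] *)

Section Side.
Variables (R : realType) (mu1 mu2 : CircMap R -> R).
Variables (w1 : circle_walk mu1) (w2 : circle_walk mu2).
Variable P : probability (Omega R) R.
Hypothesis Piid : is_iid_product mu1 mu2 P.
Variables (mu : CircMap R -> R) (w : circle_walk mu) (pr : nat * nat -> nat).
Hypothesis prE : forall f, sample_mean w1 w2 (fun k => f (pr k)) = cw_E w f.

Local Notation app := (fun (k : nat * nat) v => rcons v k).

Definition path n x := map pr (prefix w1 w2 n x).

Lemma walk_pr (X : Type) (act : nat -> X -> X) n f x :
  walk (sample_mean w1 w2) (fun k => act (pr k)) n f x = walk (cw_E w) act n f x.
Proof.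
elim: n x => [|n IH] x //.
rewrite -[RHS]/(cw_E w (fun k => walk (cw_E w) act n f (act k x))) -prE.
rewrite -[LHS]/(sample_mean w1 w2 (fun k =>
  walk (sample_mean w1 w2) (fun k => act (pr k)) n f (act (pr k) x))).
by congr (expect (sample_mean w1 w2) _); apply/funext => k; rewrite IH.
Qed.

Lemma run_pr (X : Type) (act : nat -> X -> X) x v :
  run (fun k => act (pr k)) x v = run act x (map pr v).
Proof. by elim: v x => [|k v IH] x //=. Qed.

Lemma walk_app_pr (X : Type) (act : nat -> X -> X) n (f : X -> R) x v :
  walk (sample_mean w1 w2) app n (fun v => f (run act x (map pr v))) v =
  walk (cw_E w) act n f (run act x (map pr v)).
Proof.
rewrite -walk_pr -run_pr -(@walk_map _ _ _ _ _ app (fun k => act (pr k))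
  (run (fun k => act (pr k)) x)); last by move=> k u; rewrite run_rcons.
by congr (walk _ _ _ _ _); apply/funext => u; rewrite run_pr.
Qed.

Section Arc.
Variables s t : R.
Hypothesis st : short (s, t).

Definition mass n x : R := cw_gap w (run (act2 (cw_a w)) (s, t) (path n x)).

Let visits eta : 0 < eta -> P.-negligible [set x | typical mu1 mu2 x /\
  forall i0, exists2 i, (i0 <= i)%N & eta <= mass i x <= cw_c w].
Proof.
move=> eta0; have [B BP] := cw_visits w eta0.
apply: (@borel_cantelli_prefix _ _ _ w1 w2 P Piid id (fun i v =>
  eta <= cw_gap w (run (act2 (cw_a w)) (s, t) (map pr v)) <= cw_c w) B) => N.
apply: le_trans (BP (s, t) N st); apply: ler_sum => i _ /=.
by rewrite (walk_app_pr (act2 (cw_a w)) i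
  (fun y => (eta <= cw_gap w y <= cw_c w)%R%:R) (s, t) [::]).
Qed.

Let jumps d : 0 < d -> P.-negligible [set x | typical mu1 mu2 x /\
  forall i0, exists2 i, (i0 <= i)%N & d <= `|mass i.+1 x - mass i x|].
Proof.
move=> d0; pose g v := cw_gap w (run (act2 (cw_a w)) (s, t) (map pr v)).
(* [take i] recovers the state before the last step, so that the event depends on a single word. *)
apply: (@negligibleS _ _ _ _ [set x | typical mu1 mu2 x /\ forall i0, exists2 i,
    (i0 <= i)%N & d <= `|g (prefix w1 w2 i.+1 x) - g (take i (prefix w1 w2 i.+1 x))|]).
  move=> x [tx inf]; split => // i0; have [i ii0 di] := inf i0; exists i => //.
  by rewrite {2}/prefix -map_take take_iota (minn_idPl _).
apply: (@borel_cantelli_prefix _ _ _ w1 w2 P Piid S (fun i v =>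
  d <= `|g v - g (take i v)|) (d ^- 2)) => N.
apply: le_trans (cw_jumps w N d0 st); apply: ler_sum => i _.
pose f y := cw_E w (fun k => (d <= `|cw_gap w (act2 (cw_a w) k y) - cw_gap w y|)%R%:R).
have fb : bnd f.
  apply: (@bnd_itv _ _ 0 1) => y; apply: expect_itv => k; exact: ind_itv.
rewrite -/f -[leRHS](walk_app_pr (act2 (cw_a w)) i f (s, t) [::]).
pose D v : R := (d <= `|g v - g (take i v)|)%R%:R.
have -> : walk (sample_mean w1 w2) app i.+1 D [::] =
    walk (sample_mean w1 w2) app i (walk (sample_mean w1 w2) app 1 D) [::].
  by rewrite -walk_add addn1.
apply: walk_app_le.
- apply: walk_bnd; exact: bnd_bool.
- exact: (bnd_comp (fun v => run (act2 (cw_a w)) (s, t) (map pr v)) fb).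
move=> u su; rewrite cat0s -[leLHS]/(sample_mean w1 w2 (fun k => D (rcons u k))).
rewrite /f -prE le_eqVlt; apply/orP; left; apply/eqP.
congr (expect (sample_mean w1 w2) _); apply/funext => k.
by rewrite /D -cats1 take_size_cat // /g map_cat cats1 run_rcons.
Qed.

(** Eventually the mass avoids each [[eta, c]] and jumps by less than [c / 2], so it cannot pass
    from above [c] to below [c / 2]: it stays above [c] or falls below every [eta]. *)
Lemma mass_dichotomy : P.-negligible [set x | typical mu1 mu2 x /\
  ~ ((exists n0, forall n, (n0 <= n)%N -> cw_c w < mass n x) \/
     (forall eta, 0 < eta -> exists n0, forall n, (n0 <= n)%N -> mass n x < eta))].
Proof.
have /andP[c0 c1] := cw_c01 w.
have c2 : 0 < cw_c w / 2 by lra.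
have NV : P.-negligible (\bigcup_m [set x | typical mu1 mu2 x /\
    forall i0, exists2 i, (i0 <= i)%N & invS R m <= mass i x <= cw_c w]).
  by apply: negligible_bigcup => m; apply: visits; exact: invS_gt0.
apply: negligibleS (negligibleU NV (jumps c2)) => x [tx nd].
apply: contrapT => nU; apply: nd.
have ev m : exists n0, forall n, (n0 <= n)%N -> ~~ (invS R m <= mass n x <= cw_c w).
  apply: contrapT => ne; apply: nU; left; exists m => //; split => // i0.
  apply: contrapT => nn; apply: ne; exists i0 => n ni; apply/negP => h.
  by apply: nn; exists n.
have [n1 jmp] : exists n0, forall n, (n0 <= n)%N -> `|mass n.+1 x - mass n x| < cw_c w / 2.
  apply: contrapT => ne; apply: nU; right; split => // i0.
  apply: contrapT => nn; apply: ne; exists i0 => n ni; rewrite ltNge; apply/negP => h.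
  by apply: nn; exists n.
have [m0 m0c] : exists m, invS R m < cw_c w / 2 by have [m] := uoo_ex (uoo_invS c2); exists m.
have [n2 ev0] := ev m0.
pose N := maxn n1 n2.
have step n : (N <= n)%N -> cw_c w < mass n x -> cw_c w < mass n.+1 x.
  rewrite geq_max => /andP[nn1 nn2] cm; have := jmp n nn1.
  have := ev0 n.+1 (leqW nn2); rewrite negb_and -!ltNge ltr_norml => /orP[]; lra.
have [[n [Nn cn]]|none] := pselect (exists n, (N <= n)%N /\ cw_c w < mass n x).
  left; exists n => m /subnKC <-; elim: (m - n)%N => [|k IH]; first by rewrite addn0.
  by rewrite addnS; apply: step => //; rewrite (leq_trans Nn) // leq_addr.
right=> eta eta0.
have [m me] : exists m, invS R m < eta by have [m] := uoo_ex (uoo_invS eta0); exists m.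
have [n3 ev3] := ev m; exists (maxn N n3) => n; rewrite geq_max => /andP[Nn n3n].
have := ev3 n n3n; rewrite negb_and -!ltNge => /orP[|cn]; first by move/lt_trans; apply.
by exfalso; apply: none; exists n.
Qed.

End Arc.

Lemma hits_frequency (eta : R) K q s v : (0 < q)%N -> (0 < K)%N ->
  (forall x v, walk (cw_E w) (cw_a w) K (fun y => (hits v eta (cw_h w y))%:R) x
     <= q%:R^-1) ->
  P.-negligible [set x | typical mu1 mu2 x /\
    ~ freq_le 5 q (fun n => hits v eta (cw_h w (run (cw_a w) s (path n x))))].
Proof.
move=> q0 K0 sp.
apply: negligibleS (@frequency_le _ _ _ w1 w2 P Piid R (fun k => cw_a w (pr k)) s
  (fun y => hits v eta (cw_h w y)) K q q0 K0 _); last by move=> y; rewrite walk_pr.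
move=> x [tx nf]; split => // n0; apply: contrapT => ne; apply: nf.
exists n0 => n nn; rewrite leqNgt; apply/negP => h; apply: ne; exists n => //.
by move: h; under eq_bigr do rewrite /path -run_pr.
Qed.

End Side.

(** * Ping-pong *)

Section PingPong.
Variables (R : realType) (N : nat).
Hypothesis N4 : (4 <= N)%N.

Let N0 : 0 < N%:R :> R.
Proof. by rewrite ltr0n; lia. Qed.

Let N4R : 4 <= N%:R :> R.
Proof. by rewrite (ler_nat R 4). Qed.

Definition grid (i : nat) : R := i%:R / N%:R.

Lemma gridD i m : grid (i + m * N) = grid i + m%:R.
Proof. by rewrite /grid natrD natrM mulrDl mulfK // gt_eqF. Qed.

Lemma grid_modn i : grid i = grid (i %% N) + (i %/ N)%:R.
Proof. by rewrite {1}(divn_eq i N) addnC gridD. Qed.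

Lemma gridS i : grid i.+1 = grid i + N%:R^-1.
Proof. by rewrite /grid -natr1 mulrDl mul1r. Qed.

(** The cell [b] with a margin of one cell on each side. *)
Definition arcU (b : nat) : set (S1 R) :=
  [set cis u | u in `]grid b - N%:R^-1, grid b + 2 * N%:R^-1[].

(** Only the image of the right end of the cell matters: a point outside [unionU] is compared with
    the last bad cell on its left. *)
Definition arcV (F : R -> R) (b : nat) : set (S1 R) :=
  [set cis u | u in `]F (grid b.+1) - N%:R^-1, F (grid b.+1) + N%:R^-1[].

Definition unionU (B : pred nat) := \bigcup_(b in [set b | (b < N)%N && B b]) arcU b.
Definition unionV F (B : pred nat) := \bigcup_(b in [set b | (b < N)%N && B b]) arcV F b.

Let Ninv : 0 < N%:R^-1 :> R.
Proof. by rewrite invr_gt0. Qed.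

Let Ninv4 : 4 * N%:R^-1 <= 1 :> R.
Proof. by rewrite ler_pdivrMr // mul1r. Qed.

Lemma open_unionU B : open (unionU B).
Proof. by apply: bigcup_open => b _; apply: open_arc; have := Ninv; have := Ninv4; lra. Qed.

Lemma open_unionV F B : open (unionV F B).
Proof. by apply: bigcup_open => b _; apply: open_arc; have := Ninv; have := Ninv4; lra. Qed.

Section Cover.
Variables (f : CircMap R) (F : R -> R) (B : pred nat).
Hypothesis F1 : degree_one F.
Hypothesis Ff : forall t, cis (F t) = f (cis t).
Hypothesis small : forall i, (i < N)%N -> ~~ B i -> F (grid i.+1) - F (grid i) < N%:R ^- 2.

Let small_mod i : ~~ B (i %% N)%N -> F (grid i.+1) - F (grid i) < N%:R ^- 2.
Proof.
move=> Bi; have iN : (i %% N < N)%N by rewrite ltn_mod; lia.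
have e1 : grid i.+1 = grid (i %% N).+1 + (i %/ N)%:R.
  by rewrite !gridS {1}grid_modn addrAC.
by have := small iN Bi; rewrite e1 [grid i]grid_modn !(degree_oneDn F1); lra.
Qed.

Let small_sum s m : (forall l, (s <= l < s + m)%N -> ~~ B (l %% N)%N) ->
  F (grid (s + m)) - F (grid s) <= m%:R * N%:R ^- 2.
Proof.
elim: m => [|m IH] nb; first by rewrite addn0 subrr mul0r.
have {}IH : F (grid (s + m)) - F (grid s) <= m%:R * N%:R ^- 2.
  by apply: IH => l ls; apply: nb; lia.
have /small_mod : ~~ B ((s + m) %% N)%N by apply: nb; lia.
by rewrite addnS -natr1 mulrDl mul1r; lra.
Qed.

Let N2E : N%:R ^- 2 = N%:R^-1 * N%:R^-1 :> R.
Proof. by rewrite expr2 invfM. Qed.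

(** If every cell were good, the image of a full period would have length at most [1 / N]. *)
Let bad_ex : exists2 b, (b < N)%N & B b.
Proof.
apply: contrapT => nb.
have := @small_sum 0 N; rewrite add0n => /(_ _) h.
have {h} : F (grid N) - F (grid 0) <= N%:R * N%:R ^- 2.
  apply: h => l lN; apply/negP => Bl; apply: nb; exists (l %% N)%N => //.
  by rewrite ltn_mod; lia.
have -> : grid N = grid 0 + 1 by rewrite -(gridD 0 1) add0n mul1n.
rewrite (proj2 F1) N2E mulrA mulfV ?gt_eqF // mul1r.
by have := Ninv4; lra.
Qed.

(** Fewer than [N] good cells separate the point from the last bad cell on its left, each with image
    shorter than [1 / N ^ 2]. So the image of the point lies less than [1 / N] to the right of that
    of the end of the bad cell. *)
Lemma lift_cover y : ~ unionU B y -> unionV F B (f y).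
Proof.
have [u0 <-] := cis_surj y; have [z uz] := frac_part u0.
pose u := u0 + z%:~R; rewrite -(cisDz u0 z) -/u => nU.
have [i iN gi] : exists2 i, (i < N)%N & grid i <= u < grid i.+1.
  have uN0 : 0 <= u * N%:R by rewrite mulr_ge0 ?(ltW N0) // /u; lra.
  have /andP[i1 i2] := truncn_itv uN0; exists (Num.truncn (u * N%:R)).
    rewrite -(ltr_nat R); apply: (le_lt_trans i1).
    by rewrite -[ltRHS]mul1r ltr_pM2r // /u; lra.
  by rewrite /grid ler_pdivrMr // ltr_pdivlMr // i1 i2.
clearbody u; clear uz.
have nBi : ~~ B i.
  apply/negP => Bi; apply: nU; exists i; first by rewrite /= iN.
  by exists u => //; rewrite /= in_itv /=; move: gi; rewrite gridS; have := Ninv; lra.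
have [b0 b0N Bb0] := bad_ex.
(* A period is added so that the search to the left stays in the natural numbers. *)
have ex : exists b, (b <= i + N)%N && B (b %% N)%N.
  by exists b0; rewrite modn_small // Bb0 andbT; lia.
have [b' /andP[b'le Bb'] b'max] := ex_maxnP ex (fun b h => proj1 (andP h)).
have ib' : (i < b')%N.
  rewrite ltnNge; apply/negP => b'i; have := b'max (b' + N)%N.
  by rewrite modnDr Bb' andbT leq_add2r => /(_ b'i); lia.
have b'lt : (b' < i + N)%N.
  rewrite ltn_neqAle b'le andbT; apply/negP => /eqP e.
  by move: Bb'; rewrite e modnDr modn_small // (negbTE nBi).
have nb l : (b'.+1 <= l < b'.+1 + (i + N - b'))%N -> ~~ B (l %% N)%N.
  move=> lb; apply/negP => Bl; have := b'max l; rewrite Bl andbT => h.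
  by have := h ltac:(clear -lb ib'; lia); clear -lb ib'; lia.
have := small_sum nb.
have -> : (b'.+1 + (i + N - b') = (i + N).+1)%N by lia.
have gs : grid (i + N) = grid i + 1 by rewrite -(gridD i 1) mul1n.
rewrite gridS gs => sm.
have l1 : F (grid b'.+1) <= F (u + 1).
  apply: degree_one_le => //; apply: (@le_trans _ _ (grid (i + N))).
    by rewrite /grid ler_pM2r // ler_nat.
  by rewrite gs; lra.
have l2 : F (u + 1) <= F (grid i + 1 + N%:R^-1).
  by apply: degree_one_le => //; move: gi; rewrite gridS; lra.
have l3 : (i + N - b')%:R * N%:R ^- 2 < N%:R^-1 :> R.
  rewrite N2E mulrA -[ltRHS]mul1r ltr_pM2r // ltr_pdivrMr // mul1r ltr_nat.
  by clear -ib' iN; lia.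
pose b := (b' %% N)%N; exists b; first by rewrite /= Bb' andbT ltn_mod; clear -N4; lia.
have gb : grid b'.+1 = grid b.+1 + (b' %/ N)%:R by rewrite gridS grid_modn -/b gridS addrAC.
exists (F (u + 1) - (b' %/ N)%:R); last first.
  have := cisDz (F (u + 1)) (- (b' %/ N)%:Z); rewrite mulrNz => ->.
  by rewrite Ff cisD1.
rewrite /= in_itv /=; move: l1 sm; rewrite gb (degree_oneDn F1).
by have := Ninv; lra.
Qed.

End Cover.

Lemma arcs_disjoint (I J : Type) (A : set I) (A' : set J) (l r : I -> R) (l' r' : J -> R) :
  (forall i j, A i -> A' j -> forall (z : int) u, l i < u < r i ->
     ~ (l' j < u + z%:~R < r' j)) ->
  \bigcup_(i in A) [set cis u | u in `]l i, r i[] `&`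
  \bigcup_(j in A') [set cis u | u in `]l' j, r' j[] = set0.
Proof.
move=> dj; apply/seteqP; split=> // x [[i Ai [u /= uI ux]] [j Aj [v /= vJ vx]]].
have [z vz] : exists z : int, v = u + z%:~R by apply: cis_inj; rewrite vx.
move: uI vJ; rewrite !in_itv /= vz => uI vJ.
exact: (dj i j Ai Aj z u).
Qed.

(** Points of [arcU] lie within [2 / N] of [grid b], those of [arcV] within [1 / N] of
    [F (grid b.+1)]; arcs that meet have these centres closer than [3 / N], so [6 / N] leaves
    room. *)
Lemma ping_pong_of_lifts (f g : CircMap R) (F G : R -> R) (B C : pred nat) :
  degree_one F -> (forall t, cis (F t) = f (cis t)) ->
  degree_one G -> (forall t, cis (G t) = g (cis t)) ->
  (forall i, (i < N)%N -> ~~ B i -> F (grid i.+1) - F (grid i) < N%:R ^- 2) ->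
  (forall i, (i < N)%N -> ~~ C i -> G (grid i.+1) - G (grid i) < N%:R ^- 2) ->
  (forall b b', (b < N)%N -> (b' < N)%N -> B b -> B b' || C b' ->
    ~~ hits (grid b') (6 * N%:R^-1) (F (grid b.+1))) ->
  (forall b b', (b < N)%N -> (b' < N)%N -> C b -> B b' || C b' ->
    ~~ hits (grid b') (6 * N%:R^-1) (G (grid b.+1))) ->
  (forall b b', (b < N)%N -> (b' < N)%N -> B b -> C b' ->
    ~~ hits (G (grid b'.+1)) (6 * N%:R^-1) (F (grid b.+1))) ->
  (forall i j, (i < N)%N -> (j < N)%N -> B i -> C j -> forall z : int,
    ~ (- 3 * N%:R^-1 < grid i - grid j + z%:~R < 3 * N%:R^-1)) ->
  ping_pong f g.
Proof.
move=> F1 Ff G1 Gg smF smG nF nG nFG nBC.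
have nh (v e y : R) (z : int) : ~~ hits v e y -> ~ (`|y + z%:~R - v| <= e).
  by move=> /negP nh h; apply: nh; apply/asboolP; exists z.
exists (unionU B), (unionU C), (unionV F B), (unionV G C); split; [|split; [|split]].
- by split; [exact: open_unionU..|exact: open_unionV|exact: open_unionV].
- split; apply: arcs_disjoint => i j /= /andP[iN Bi] /andP[jN Cj] z u hu.
  + move=> hv; apply: (nBC i j iN jN Bi Cj z); have := Ninv; lra.
  + move=> hv; have := nF j i jN iN Cj; rewrite Bi => /(_ isT) /(nh _ _ _ (- z)).
    by rewrite mulrNz; apply; rewrite ler_norml; have := Ninv; lra.
  + move=> hv; have := nG j i jN iN Cj; rewrite Bi => /(_ isT) /(nh _ _ _ (- z)).
    by rewrite mulrNz; apply; rewrite ler_norml; have := Ninv; lra.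
- split; apply: arcs_disjoint => i j /= /andP[iN Bi] /andP[jN Cj] z u hu.
  + move=> hv; have := nF j i jN iN Cj; rewrite Bi orbT => /(_ isT) /(nh _ _ _ (- z)).
    by rewrite mulrNz; apply; rewrite ler_norml; have := Ninv; lra.
  + move=> hv; have := nG j i jN iN Cj; rewrite Bi orbT => /(_ isT) /(nh _ _ _ (- z)).
    by rewrite mulrNz; apply; rewrite ler_norml; have := Ninv; lra.
  + move=> hv; have := nFG i j iN jN Bi Cj => /(nh _ _ _ z).
    by apply; rewrite ler_norml; have := Ninv; lra.
- split=> _ [y /= nU <-]; exact: lift_cover.
Qed.

End PingPong.

Lemma hits_le (R : realType) (v r r' y : R) : r <= r' -> hits v r y -> hits v r' y.
Proof. by move=> rr' /asboolP[z h]; apply/asboolP; exists z; exact: le_trans rr'. Qed.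

(** * Heavy and light cells of the grid *)

Section SideGrid.
Variables (R : realType) (mu1 mu2 : CircMap R -> R).
Variables (w1 : circle_walk mu1) (w2 : circle_walk mu2).
Variables (mu : CircMap R -> R) (w : circle_walk mu) (pr : nat * nat -> nat).
Variable N : nat.
Hypothesis N4 : (4 <= N)%N.

Definition walk_lift n x s := run (cw_a w) s (path w1 w2 pr n x).

Local Notation F := walk_lift.
Local Notation h := (cw_h w).
Local Notation t_ := (grid R N).

Let N0 : 0 < N%:R :> R.
Proof. by rewrite ltr0n; lia. Qed.

Lemma walk_lift_degree_one n x : degree_one (F n x).
Proof.
rewrite /walk_lift; elim: (path _ _ _ _ _) => [|k v IH]; first exact: degree_one_id.
exact: (degree_one_comp IH (cw_a1 w k)).
Qed.

Let hF n x := degree_one_comp (cw_h1 w) (walk_lift_degree_one n x).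

Lemma short_grid i : short (t_ i, t_ i.+1).
Proof.
rewrite /short /= gridS; have : 0 < N%:R^-1 :> R by rewrite invr_gt0.
have : N%:R^-1 <= 1 :> R by rewrite invf_le1 // ler1n; lia.
lra.
Qed.

Definition cell_mass i n x := mass w1 w2 w pr (t_ i) (t_ i.+1) n x.

Lemma cell_massE i n x : cell_mass i n x = h (F n x (t_ i.+1)) - h (F n x (t_ i)).
Proof.
rewrite /cell_mass /mass run_act2 /cw_gap gap_short //=.
have /andP[s0 s1] := short_grid i; rewrite /= in s0 s1.
by apply: (degree_one_diff (hF n x) (n := 1)); lra.
Qed.

Definition heavy x i := exists n0, forall n, (n0 <= n)%N -> cw_c w < cell_mass i n x.

Definition heavies x := [seq i <- iota 0 N | `[< heavy x i >]].

(** At a common late time the masses of all cells add up to 1. *)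
Lemma size_heavies x : (size (heavies x) <= Num.truncn (cw_c w)^-1)%N.
Proof.
have /andP[c0 _] := cw_c01 w.
have ex i : exists n0, heavy x i -> forall n, (n0 <= n)%N -> cw_c w < cell_mass i n x.
  have [[n0 h]|nh] := pselect (heavy x i); first by exists n0.
  by exists 0%N.
have [n0 n0P] := choice ex.
pose n := \max_(i < N) n0 i.
have tot : \sum_(0 <= i < N) cell_mass i n x = 1.
  under eq_bigr do rewrite cell_massE.
  rewrite telescope_sumr //.
  have -> : t_ N = t_ 0 + 1 by rewrite -(gridD R N4 0 1) add0n mul1n.
  by rewrite (proj2 (walk_lift_degree_one n x)) (proj2 (cw_h1 w)); ring.
rewrite truncn_ge_nat; last by rewrite invr_ge0 ltW.
rewrite -[leRHS]mul1r ler_pdivlMr // -[leRHS]tot mulr_natl.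
rewrite /heavies size_filter -sum1_count.
have -> : cw_c w *+ (\sum_(i <- iota 0 N | `[< heavy x i >]) 1) =
    \sum_(i <- iota 0 N | `[< heavy x i >]) cw_c w.
  by elim: (iota 0 N) => [|i l IH]; rewrite ?big_nil ?mulr0n // !big_cons;
    case: ifP => // _; rewrite mulrnDr mulr1n IH.
rewrite [leRHS](_ : _ = \sum_(i <- iota 0 N) cell_mass i n x); last first.
  by rewrite /index_iota subn0.
rewrite big_mkcond /= [leLHS]big_seq [leRHS]big_seq.
apply: ler_sum => i; rewrite mem_iota add0n => /andP[_ iN].
case: asboolP => [hi|_].
  by apply: ltW; apply: n0P => //; exact: (leq_bigmax (Ordinal iN)).
rewrite cell_massE; have /andP[s0 s1] := short_grid i; rewrite /= in s0 s1.
by have /andP[] := degree_one_diff (hF n x) (s := t_ i) (t := t_ i.+1) (n := 1)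
  ltac:(lra) ltac:(lra).
Qed.

Definition fine (l : nat) : R := l%:R / (N * N)%:R.

(** A long image contains a point of the mesh [1 / N ^ 2]. If its mass is below [eta], the [h]-value
    of its left end is close to one of [N * N] fixed values modulo 1, which non-concentration makes
    rare. *)
Lemma light_cell x i eta : 0 < eta ->
  (forall eta, 0 < eta -> exists n0, forall n, (n0 <= n)%N -> cell_mass i n x < eta) ->
  exists n0, forall n, (n0 <= n)%N -> N%:R ^- 2 <= F n x (t_ i.+1) - F n x (t_ i) ->
  has (fun l => hits (h (fine l)) eta (h (F n x (t_ i)))) (iota 0 (N * N)).
Proof.
move=> eta0 /(_ _ eta0)[n0 light]; exists n0 => n nn long.
have NN : 0 < (N * N)%:R :> R by rewrite ltr0n; lia.
pose k := Num.ceil (F n x (t_ i) * (N * N)%:R).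
have /andP[k1 k2] := ceil_itv (F n x (t_ i) * (N * N)%:R); rewrite -/k in k1 k2.
have kN : F n x (t_ i) <= k%:~R / (N * N)%:R <= F n x (t_ i.+1).
  rewrite ler_pdivlMr // k2 /= ler_pdivrMr //.
  have : N%:R ^- 2 * (N * N)%:R = 1 :> R by rewrite natrM -expr2 mulVf // expf_neq0 // gt_eqF.
  have := ler_wpM2r (ltW NN) long; rewrite mulrBl => A B; rewrite B in A.
  by move: k1; rewrite intrD; lra.
have NNz : (N * N)%:Z != 0 by lia.
pose z := (k %/ (N * N)%:Z)%Z; pose l := `|(k %% (N * N)%:Z)%Z|%N.
have m0 := modz_ge0 k NNz; have mlt := ltz_pmod k (_ : 0 < (N * N)%:Z).
have lE : l%:Z = (k %% (N * N)%:Z)%Z by rewrite /l gez0_abs.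
have kE : k = z * (N * N)%:Z + l%:Z by rewrite lE; exact: divz_eq.
apply/hasP; exists l; first by rewrite mem_iota add0n /=; have := mlt ltac:(lia); lia.
apply/asboolP; exists (- z).
have kq : k%:~R / (N * N)%:R = fine l + z%:~R :> R.
  rewrite kE intrD intrM mulrDl -[(N * N)%:Z%:~R]/((N * N)%:R : R) mulfK ?gt_eqF //.
  by rewrite addrC.
have /andP[/(degree_one_le (cw_h1 w)) A /(degree_one_le (cw_h1 w)) B] := kN.
have := light n nn; rewrite cell_massE => C.
move: A B; rewrite kq (degree_oneDz (cw_h1 w)) mulrNz => A B.
by rewrite ler_norml; lra.
Qed.

End SideGrid.

(** [fcomp] at [n] composes [n.+1] maps, hence the prefix of length [n.+1]. *)
Lemma fcomp_lift1 (R : realType) (mu1 mu2 : CircMap R -> R) (w1 : circle_walk mu1)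
  (w2 : circle_walk mu2) x n t : typical mu1 mu2 x ->
  cis (walk_lift w1 w2 w1 fst n.+1 x t) = fcomp x.1 n (cis t).
Proof.
move=> tx; rewrite /walk_lift /path.
elim: n => [|n IH].
  rewrite prefixS map_rcons run_rcons /=.
  by have [x1 _] := tx 0%N; have [_ ->] := cw_step w1 x1.
rewrite prefixS map_rcons run_rcons /=.
by have [x1 _] := tx n.+1; have [_ ->] := cw_step w1 x1; rewrite IH.
Qed.

Lemma fcomp_lift2 (R : realType) (mu1 mu2 : CircMap R -> R) (w1 : circle_walk mu1)
  (w2 : circle_walk mu2) x n t : typical mu1 mu2 x ->
  cis (walk_lift w1 w2 w2 snd n.+1 x t) = fcomp x.2 n (cis t).
Proof.
move=> tx; rewrite /walk_lift /path.
elim: n => [|n IH].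
  rewrite prefixS map_rcons run_rcons /=.
  by have [_ x2] := tx 0%N; have [_ ->] := cw_step w2 x2.
rewrite prefixS map_rcons run_rcons /=.
by have [_ x2] := tx n.+1; have [_ ->] := cw_step w2 x2; rewrite IH.
Qed.

Section SideFrequency.
Variables (R : realType) (mu1 mu2 : CircMap R -> R).
Variables (w1 : circle_walk mu1) (w2 : circle_walk mu2).
Variable P : probability (Omega R) R.
Hypothesis Piid : is_iid_product mu1 mu2 P.
Variables (mu : CircMap R -> R) (w : circle_walk mu) (pr : nat * nat -> nat).
Hypothesis prE : forall f, sample_mean w1 w2 (fun k => f (pr k)) = cw_E w f.

Local Notation F := (walk_lift w1 w2 w pr).

Lemma near_frequency q : (0 < q)%N -> exists2 r : R, 0 < r & forall s v,
  P.-negligible [set x | typical mu1 mu2 x /\ ~ freq_le 6 q (fun n => hits v r (F n x s))].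
Proof.
move=> q0; have [eta [K [eta0 K0 sp]]] := cw_spread_inv w q0.
have [r r0 hr] := cw_h_unif w eta0; exists r => // s v.
apply: negligibleS (hits_frequency Piid prE s (cw_h w v) q0 K0 sp) => x [tx nf].
split => // f; apply: nf; apply: freq_sub f; exists 0%N => n _ /=.
exact: (hits_image (cw_h1 w) hr).
Qed.

Variable N : nat.
Hypothesis N4 : (4 <= N)%N.

Local Notation t_ := (grid R N).

Definition long_light n x := has (fun i =>
  ~~ `[< heavy w1 w2 w pr N x i >] && (N%:R ^- 2 <= F n x (t_ i.+1) - F n x (t_ i))) (iota 0 N).

(** There are [m] pairs of a cell and a mesh point, so non-concentration is used with [m * q] and
    the union still has frequency [5 / q]. The sixth unit pays for the times before the light cells
    are small. *)
Lemma long_light_frequency q : (0 < q)%N ->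
  P.-negligible [set x | typical mu1 mu2 x /\ ~ freq_le 6 q (long_light ^~ x)].
Proof.
move=> q0; pose m := (N * (N * N))%N.
have m0 : (0 < m)%N by rewrite /m !muln_gt0; apply/and3P; split; lia.
have mq0 : (0 < m * q)%N by rewrite muln_gt0 m0.
have [eta [K [eta0 K0 sp]]] := cw_spread_inv w mq0.
pose Q i l n x := hits (cw_h w (fine R N l)) eta (cw_h w (F n x (t_ i))).
pose D i := [set x | typical mu1 mu2 x /\
  ~ ((exists n0, forall n, (n0 <= n)%N -> cw_c w < cell_mass w1 w2 w pr N i n x) \/
     (forall eta, 0 < eta -> exists n0, forall n, (n0 <= n)%N ->
       cell_mass w1 w2 w pr N i n x < eta))].
have nD : P.-negligible (\bigcup_i D i).
  by apply: negligible_bigcup => i; apply: (mass_dichotomy Piid prE); exact: short_grid.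
have nQ : P.-negligible (\bigcup_i \bigcup_l [set x | typical mu1 mu2 x /\
    ~ freq_le 5 (m * q) (fun n => Q i l n x)]).
  apply: negligible_bigcup => i; apply: negligible_bigcup => l.
  exact: (hits_frequency Piid prE (t_ i) (cw_h w (fine R N l)) mq0 K0 sp).
apply: negligibleS (negligibleU nD nQ) => x [tx nf].
apply: contrapT => nU; apply: nf.
apply: (@freq_sub _ _ _ (fun n => has (fun i => has (fun l => Q i l n x) (iota 0 (N * N)))
  (iota 0 N))).
  have ex i : exists n0, forall n, (n0 <= n)%N -> ~ heavy w1 w2 w pr N x i ->
      N%:R ^- 2 <= F n x (t_ i.+1) - F n x (t_ i) ->
      has (fun l => Q i l n x) (iota 0 (N * N)).
    have [hv|nh] := pselect (heavy w1 w2 w pr N x i); first by exists 0%N.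
    have lt : forall eta, 0 < eta -> exists n0, forall n, (n0 <= n)%N ->
        cell_mass w1 w2 w pr N i n x < eta.
      apply: contrapT => nl; apply: nU; left; exists i => //; split => // -[|//].
      exact: nh.
    by have [n0 n0P] := light_cell N4 eta0 lt; exists n0 => n nn _; exact: n0P.
  have [n0 n0P] := choice ex; exists (\max_(i < N) n0 i) => n nn /hasP[i].
  move=> iN /andP[/asboolP nh long]; apply/hasP; exists i => //; apply: n0P => //.
  move: iN; rewrite mem_iota add0n => /andP[_ iN].
  by apply: leq_trans nn; exact: (leq_bigmax (Ordinal iN)).
apply: (freq_cancel m0).
have -> : (m * 5 = size (iota 0 N) * (size (iota 0 (N * N)) * 5))%N.
  by rewrite !size_iota /m -mulnA.
apply: freq_has => i _; apply: freq_has => l _.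
by apply: contrapT => nf; apply: nU; right; exists i => //; exists l.
Qed.

End SideFrequency.

(** * The two walks together *)

Section TwoWalks.
Variables (R : realType) (mu1 mu2 : CircMap R -> R).
Variables (w1 : circle_walk mu1) (w2 : circle_walk mu2).
Variable P : probability (Omega R) R.
Hypothesis Piid : is_iid_product mu1 mu2 P.

Local Notation F1 := (walk_lift w1 w2 w1 fst).
Local Notation F2 := (walk_lift w1 w2 w2 snd).

Lemma run_pact (X Y : Type) (a : nat -> X -> X) (b : nat -> Y -> Y) x v :
  run (pact a b) x v = (run a x.1 (map fst v), run b x.2 (map snd v)).
Proof. by elim: v x => [|k v IH] [x y] //=; rewrite IH. Qed.

(** At a given time the walks are independent, and non-concentration of the first is uniform in the
    target. *)
Lemma meet_frequency q : (0 < q)%N -> exists2 r : R, 0 < r & forall s s',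
  P.-negligible [set x | typical mu1 mu2 x /\
    ~ freq_le 6 q (fun n => hits (F2 n x s') r (F1 n x s))].
Proof.
move=> q0; have [eta [K [eta0 K0 sp]]] := cw_spread_inv w1 q0.
have [r r0 hr] := cw_h_unif w1 eta0; exists r => // s s'.
pose C (y : R * R) := hits y.2 r y.1.
apply: negligibleS (@frequency_le _ _ _ w1 w2 P Piid _ (pact (cw_a w1) (cw_a w2)) (s, s')
  C K q q0 K0 _).
  move=> x [tx nf]; split => // n0; apply: contrapT => ne; apply: nf.
  apply: (@freq_weaken 5) => //.
  exists n0 => n nn; rewrite leqNgt; apply/negP => h; apply: ne; exists n => //.
  by move: h; under [in X in _ -> X]eq_bigr do rewrite run_pact.
move=> y; apply: walk_pact_slice; first exact: bnd_bool.
move=> u v; apply: le_trans (sp u (cw_h w1 v)); apply: walk_le; [exact: bnd_bool..|].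
move=> t; rewrite ler_nat /C /=; have := @hits_image _ _ _ _ v t (cw_h1 w1) hr.
by case: (hits v r t) => // ->.
Qed.

Variable N : nat.
Hypothesis N4 : (4 <= N)%N.

Local Notation t_ := (grid R N).
Local Notation heavy1 := (heavy w1 w2 w1 fst N).
Local Notation heavy2 := (heavy w1 w2 w2 snd N).

Lemma gap_grid (mu : CircMap R -> R) (w : circle_walk mu) i :
  cw_gap w (t_ i, t_ i.+1) = cw_h w (t_ i.+1) - cw_h w (t_ i).
Proof.
rewrite /cw_gap gap_short //=; have /andP[s0 s1] := short_grid R N4 i.
by rewrite /= in s0 s1; apply: (degree_one_diff (cw_h1 w) (n := 1)); lra.
Qed.

Lemma gap_grid_ge0 (mu : CircMap R -> R) (w : circle_walk mu) i : 0 <= cw_gap w (t_ i, t_ i.+1).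
Proof.
rewrite gap_grid subr_ge0; apply: (degree_one_le (cw_h1 w)); rewrite gridS lerDl.
by rewrite invr_ge0.
Qed.

(** If both cells are heavy, both gaps exceed their constants at all large times; at each single
    time independence and Markov give the product. *)
Lemma both_heavy i j : exists A, [/\ measurable A,
  [set x | [/\ typical mu1 mu2 x, heavy1 x i & heavy2 x j]] `<=` A &
  (P A <= (cw_gap w1 (t_ i, t_ i.+1) / cw_c w1 * (cw_gap w2 (t_ j, t_ j.+1) / cw_c w2))%:E)%E].
Proof.
pose g1 y : R := (cw_c w1 <= cw_gap w1 y)%R%:R.
pose g2 y : R := (cw_c w2 <= cw_gap w2 y)%R%:R.
pose act := pact (act2 (cw_a w1)) (act2 (cw_a w2)).
pose x0 := ((t_ i, t_ i.+1), (t_ j, t_ j.+1)).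
pose D v := let y := run act x0 v in
  (cw_c w1 <= cw_gap w1 y.1) && (cw_c w2 <= cw_gap w2 y.2).
have /andP[c1 _] := cw_c01 w1; have /andP[c2 _] := cw_c01 w2.
have [A AP] := choice (fun n => prefix_event w1 w2 Piid n D).
exists (\bigcup_m \bigcap_(n in [set n | (m <= n)%N]) A n); split.
- apply: bigcup_measurable => m _; apply: bigcap_measurable; first by exists m => /=.
  by move=> n _; have [] := AP n.
- move=> x [tx [n1 h1] [n2 h2]]; exists (maxn n1 n2) => // n /=.
  rewrite geq_max => /andP[/h1 m1 /h2 m2]; have [_ + _] := AP n; apply; split => //.
  by rewrite /D /= run_pact /= (ltW m1) (ltW m2).
apply: prob_liminf_le => n; first by have [] := AP n.
have [_ _ le] := AP n; apply: le_trans le _; rewrite lee_fin.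
have -> : walk (sample_mean w1 w2) (fun k => rcons^~ k) n (fun v => (D v)%:R) [::] =
    walk (sample_mean w1 w2) act n (fun y => g1 y.1 * g2 y.2) x0.
  rewrite -[x0]/(run act x0 [::]).
  rewrite -(@walk_map _ _ _ _ _ (fun k v => rcons v k) act (run act x0)); last first.
    by move=> k u; rewrite run_rcons.
  by congr (walk _ _ _ _ _); apply/funext => v; rewrite /D /g1 /g2 /= -natrM mulnb.
rewrite walk_pact; [|exact: bnd_bool..].
have ge0 (mu : CircMap R -> R) (w : circle_walk mu) (y : R * R) :
    0 <= walk (cw_E w) (act2 (cw_a w)) n (fun y => (cw_c w <= cw_gap w y)%R%:R) y.
  rewrite -[leLHS](walk_cst (cw_E w) (act2 (cw_a w)) n 0 y).
  by apply: walk_le; [exact: bnd_cst|exact: bnd_bool|].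
by apply: ler_pM; [exact: ge0|exact: ge0|..]; apply: cw_markov => //; exact: short_grid.
Qed.

End TwoWalks.

(** A distance below three mesh units leaves five neighbours modulo [N]; adding [N] makes the
    natural subtraction of 2 exact. *)
Lemma grid_close (R : realType) (N i j : nat) (z : int) : (4 <= N)%N ->
  (i < N)%N -> (j < N)%N ->
  - 3 * N%:R^-1 < grid R N i - grid R N j + z%:~R < 3 * N%:R^-1 ->
  exists2 d, (d < 5)%N & j = ((i + d + N - 2) %% N)%N.
Proof.
move=> N4 iN jN close.
have N0 : 0 < N%:R :> R by rewrite ltr0n; lia.
have : - 3 < i%:Z - j%:Z + z * N%:Z < 3.
  rewrite -(ltr_int R) -[X in _ && X](ltr_int R).
  have -> : (i%:Z - j%:Z + z * N%:Z)%:~R = (grid R N i - grid R N j + z%:~R) * N%:R.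
    rewrite mulrDl mulrBl /grid !divfK ?gt_eqF // intrD intrB intrM; congr (_ + _).
  have -> : (- 3)%:~R = - 3 * N%:R^-1 * N%:R :> R by rewrite divfK ?gt_eqF.
  have -> : 3%:~R = 3 * N%:R^-1 * N%:R :> R by rewrite divfK ?gt_eqF.
  by rewrite !ltr_pM2r.
clear close N0 => close.
have zE : z = 1 \/ z = 0 \/ z = -1 by nia.
have [d dE] : exists d : nat, d%:Z = 2 - (i%:Z - j%:Z + z * N%:Z).
  by exists `|2 - (i%:Z - j%:Z + z * N%:Z)%R|%N; lia.
exists d; first lia.
case: zE => [|[]] ze; subst z.
- have -> : (i + d + N - 2 = j)%N by lia.
  by rewrite modn_small.
- have -> : (i + d + N - 2 = 1 * N + j)%N by lia.
  by rewrite modnMDl modn_small.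
- have -> : (i + d + N - 2 = 2 * N + j)%N by lia.
  by rewrite modnMDl modn_small.
Qed.

(** * Frequency of the ping-pong times *)

Section PingPongFrequency.
Variables (R : realType) (mu1 mu2 : CircMap R -> R).
Variables (w1 : circle_walk mu1) (w2 : circle_walk mu2).
Variable P : probability (Omega R) R.
Hypothesis Piid : is_iid_product mu1 mu2 P.

Local Notation F1 := (walk_lift w1 w2 w1 fst).
Local Notation F2 := (walk_lift w1 w2 w2 snd).

Section Grid.
Variable N : nat.
Hypothesis N4 : (4 <= N)%N.

Local Notation t_ := (grid R N).
Local Notation heavy1 := (heavy w1 w2 w1 fst N).
Local Notation heavy2 := (heavy w1 w2 w2 snd N).

Definition heavy_near x := exists i j, [/\ (i < N)%N, (j < N)%N, heavy1 x i, heavy2 x j &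
  exists z : int, - 3 * N%:R^-1 < t_ i - t_ j + z%:~R < 3 * N%:R^-1].

(** The bound of [both_heavy] is summed over the five neighbours [j] of each [i]: the masses of the
    cells [i] add up to 1, those of the cells [j] are at most [e]. *)
Lemma heavy_near_prob e : 0 < e -> (forall j, cw_gap w2 (t_ j, t_ j.+1) <= e) ->
  exists A, [/\ measurable A,
  [set x | typical mu1 mu2 x /\ heavy_near x] `<=` A &
  (P A <= (5 / (cw_c w1 * cw_c w2) * e)%:E)%E].
Proof.
move=> e0 small.
have /andP[c1 _] := cw_c01 w1; have /andP[c2 _] := cw_c01 w2.
have [A AP] := choice (fun ij : nat * nat => both_heavy w1 w2 Piid N4 ij.1 ij.2).
pose J i d := ((i + d + N - 2) %% N)%N.
pose U i := \big[setU/set0]_(d < 5) A (i, J i d).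
have mU i : measurable (U i) by apply: bigsetU_measurable => d _; have [] := AP (i, J i d).
exists (\big[setU/set0]_(i < N) U i); split.
- exact: bigsetU_measurable.
- move=> x [tx [i [j [iN jN hi hj [z close]]]]].
  have [d d5 jE] := grid_close N4 iN jN close.
  apply: (bigsetU_sup (F := U) iN); apply: (bigsetU_sup (F := fun d => A (i, J i d)) d5).
  by have [_ + _] := AP (i, J i d); apply; split => //=; rewrite /J -jE.
have UP i : (P (U i) <= (5 / (cw_c w1 * cw_c w2) * e * cw_gap w1 (t_ i, t_ i.+1))%:E)%E.
  apply: (@le_trans _ _ (\sum_(d < 5) P (A (i, J i d)))%E).
    by apply: (Boole_inequality P (A := fun d => A (i, J i d))) => d _; have [] := AP (i, J i d).
  have -> : (5 / (cw_c w1 * cw_c w2) * e * cw_gap w1 (t_ i, t_ i.+1))%:E = (\sum_(d < 5)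
      (cw_gap w1 (t_ i, t_ i.+1) / cw_c w1 * (e / cw_c w2))%:E)%E.
    rewrite sumEFin sumr_const card_ord -mulr_natl; congr (_%:E); field.
    by rewrite !gt_eqF.
  apply: lee_sum => d _; have [_ _ /=] := AP (i, J i d) => /le_trans; apply.
  rewrite lee_fin; apply: ler_wpM2l.
    by rewrite divr_ge0 ?(ltW c1) //; exact: gap_grid_ge0.
  by rewrite ler_pM2r ?invr_gt0.
apply: (@le_trans _ _ (\sum_(i < N) P (U i))%E); first exact: (Boole_inequality P).
apply: (@le_trans _ _ (\sum_(i < N)
  (5 / (cw_c w1 * cw_c w2) * e * cw_gap w1 (t_ i, t_ i.+1))%:E)%E).
  by apply: lee_sum => i _; exact: UP.
rewrite sumEFin -mulr_sumr lee_fin.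
suff -> : \sum_(i < N) cw_gap w1 (t_ i, t_ i.+1) = 1 by rewrite mulr1.
rewrite -(big_mkord xpredT (fun i => cw_gap w1 (t_ i, t_ i.+1))).
under eq_bigr do rewrite gap_grid //.
rewrite (telescope_sumr (fun i => cw_h w1 (t_ i))) //.
have -> : t_ N = t_ 0 + 1 by rewrite -(gridD R N4 0 1) add0n mul1n.
by rewrite (proj2 (cw_h1 w1)); ring.
Qed.

Lemma heaviesP (mu : CircMap R -> R) (w : circle_walk mu) pr x i :
  (i < N)%N -> `[< heavy w1 w2 w pr N x i >] -> i \in heavies w1 w2 w pr N x.
Proof. by move=> iN hi; rewrite mem_filter hi mem_iota. Qed.

Local Notation heavies1 := (heavies w1 w2 w1 fst N).
Local Notation heavies2 := (heavies w1 w2 w2 snd N).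
Local Notation e := (6 * N%:R^-1).

(** Apart from [long_light], only pairs of heavy cells are tested, so the number of conditions does
    not grow with [N]. *)
Definition clash x n := [|| long_light w1 w2 w1 fst N n x, long_light w1 w2 w2 snd N n x,
  has (fun b => has (fun b' => hits (t_ b') e (F1 n x (t_ b.+1))) (heavies1 x ++ heavies2 x))
    (heavies1 x),
  has (fun b => has (fun b' => hits (t_ b') e (F2 n x (t_ b.+1))) (heavies1 x ++ heavies2 x))
    (heavies2 x) |
  has (fun b => has (fun b' => hits (F2 n x (t_ b'.+1)) e (F1 n x (t_ b.+1))) (heavies2 x))
    (heavies1 x)].

Lemma clash_or_ping_pong x n : typical mu1 mu2 x -> ~ heavy_near x ->
  ~~ clash x n.+1 -> ping_pong (fcomp x.1 n) (fcomp x.2 n).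
Proof.
move=> tx nn; rewrite !negb_or => /and5P[L1 L2 H1 H2 H12].
apply: (ping_pong_of_lifts N4 (F := F1 n.+1 x) (G := F2 n.+1 x)
  (B := fun i => `[< heavy1 x i >]) (C := fun i => `[< heavy2 x i >])).
- exact: walk_lift_degree_one.
- by move=> t; exact: fcomp_lift1.
- exact: walk_lift_degree_one.
- by move=> t; exact: fcomp_lift2.
- move=> i iN nh; rewrite ltNge; apply/negP => long; apply: (negP L1).
  by apply/hasP; exists i; rewrite ?mem_iota // nh.
- move=> i iN nh; rewrite ltNge; apply/negP => long; apply: (negP L2).
  by apply/hasP; exists i; rewrite ?mem_iota // nh.
- move=> b b' bN bN' hb hb'; apply/negP => ht; apply: (negP H1).
  apply/hasP; exists b; first exact: heaviesP.
  apply/hasP; exists b' => //; rewrite mem_cat; apply/orP.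
  by case/orP: hb' => ?; [left|right]; exact: heaviesP.
- move=> b b' bN bN' hb hb'; apply/negP => ht; apply: (negP H2).
  apply/hasP; exists b; first exact: heaviesP.
  apply/hasP; exists b' => //; rewrite mem_cat; apply/orP.
  by case/orP: hb' => ?; [left|right]; exact: heaviesP.
- move=> b b' bN bN' hb hb'; apply/negP => ht; apply: (negP H12).
  by apply/hasP; exists b; [exact: heaviesP|apply/hasP; exists b' => //; exact: heaviesP].
- move=> i j iN jN /asboolP hi /asboolP hj z close; apply: nn.
  by exists i, j; split => //; exists z.
Qed.

End Grid.

Let M1 := Num.truncn (cw_c w1)^-1.
Let M2 := Num.truncn (cw_c w2)^-1.

(** Independent of [N] and [q]. A pair of heavy cells costs 7: six for the closeness event and one
    from [freq_sub]. *)
Definition clash_rate :=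
  (6 + (6 + (M1 * ((M1 + M2) * 7) + (M2 * ((M1 + M2) * 7) + M1 * (M2 * 7)))))%N.

Lemma clash_frequency q : (0 < q)%N -> exists2 r : R, 0 < r & forall N, (4 <= N)%N ->
  6 * N%:R^-1 <= r ->
  P.-negligible [set x | typical mu1 mu2 x /\ ~ freq_le clash_rate q (clash N x)].
Proof.
move=> q0.
have E1 f : sample_mean w1 w2 (fun k => f k.1) = cw_E w1 f by exact: pmean_fst.
have E2 f : sample_mean w1 w2 (fun k => f k.2) = cw_E w2 f by exact: pmean_snd.
have [r1 r10 h1] := near_frequency Piid E1 q0.
have [r2 r20 h2] := near_frequency Piid E2 q0.
have [r3 r30 h3] := meet_frequency w1 w2 Piid q0.
exists (Num.min r1 (Num.min r2 r3)); first by rewrite !lt_min r10 r20.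
move=> N N4; rewrite !le_min => /and3P[e1 e2 e3].
(* One null set serves all pairs of cells, since the heavy ones depend on the sample. *)
have all_pairs e r (Q : nat -> nat -> R -> Omega R -> nat -> bool) : e <= r ->
    (forall b b' x n, Q b b' e x n -> Q b b' r x n) ->
    (forall b b', P.-negligible [set x | typical mu1 mu2 x /\ ~ freq_le 6 q (Q b b' r x)]) ->
    P.-negligible [set x | typical mu1 mu2 x /\ ~ forall b b', freq_le 7 q (Q b b' e x)].
  move=> er mono nQ.
  have : P.-negligible (\bigcup_b \bigcup_b'
      [set x | typical mu1 mu2 x /\ ~ freq_le 6 q (Q b b' r x)]).
    by apply: negligible_bigcup => b; apply: negligible_bigcup => b'; exact: nQ.
  apply: negligibleS => x [tx nf]; apply: contrapT => nU; apply: nf => b b'.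
  apply: (@freq_sub _ _ _ (Q b b' r x)); first by exists 0%N => n _; exact: mono.
  by apply: contrapT => nf; apply: nU; exists b => //; exists b'.
pose t := grid R N.
have n1 := all_pairs _ _ (fun b b' e x n => hits (t b') e (F1 n x (t b.+1))) e1
  (fun _ _ _ _ => hits_le e1) (fun b b' => h1 _ _).
have n2 := all_pairs _ _ (fun b b' e x n => hits (t b') e (F2 n x (t b.+1))) e2
  (fun _ _ _ _ => hits_le e2) (fun b b' => h2 _ _).
have n3 := all_pairs _ _ (fun b b' e x n => hits (F2 n x (t b'.+1)) e (F1 n x (t b.+1))) e3
  (fun _ _ _ _ => hits_le e3) (fun b b' => h3 _ _).
have n4 := long_light_frequency Piid E1 N4 q0.
have n5 := long_light_frequency Piid E2 N4 q0.
apply: negligibleS (negligibleU n1 (negligibleU n2 (negligibleU n3 (negligibleU n4 n5)))).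
move=> x [tx nf]; apply: contrapT.
move=> /not_orP[x1 /not_orP[x2 /not_orP[x3 /not_orP[x4 x5]]]]; apply: nf.
have dbl (Q : nat -> nat -> nat -> bool) (L L' : seq nat) s s' : (size L <= s)%N ->
    (size L' <= s')%N -> (forall b b', freq_le 7 q (Q b b')) ->
    freq_le (s * (s' * 7)) q (fun n => has (fun b => has (fun b' => Q b b' n) L') L).
  move=> Ls Ls' fQ; apply: (@freq_weaken (size L * (size L' * 7))).
    by rewrite !leq_mul.
  by apply: freq_has => b _; apply: freq_has => b' _; exact: fQ.
have sz1 : (size (heavies w1 w2 w1 fst N x) <= M1)%N by exact: size_heavies.
have sz2 : (size (heavies w1 w2 w2 snd N x) <= M2)%N by exact: size_heavies.
have sz12 : (size (heavies w1 w2 w1 fst N x ++ heavies w1 w2 w2 snd N x) <= M1 + M2)%N.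
  by rewrite size_cat leq_add.
apply: freq_or; first by apply: contrapT => nf; apply: x4.
apply: freq_or; first by apply: contrapT => nf; apply: x5.
by apply: freq_or; [|apply: freq_or]; apply: dbl => //; apply: contrapT => nf;
  [apply: x1|apply: x2|apply: x3].
Qed.

(** The radii [r] and [r'] depend on [q]; then the mesh is refined until [6 / N] is below both. [A]
    contains the paths for which heavy cells of the two walks are close. *)
Lemma ping_pong_frequency q : (0 < q)%N -> exists A B, [/\ measurable A,
  (P A <= (5 / (cw_c w1 * cw_c w2) * q%:R^-1)%:E)%E, P.-negligible B &
  forall x, typical mu1 mu2 x -> ~ A x -> ~ B x ->
    freq_le clash_rate.*2.+1 q (fun n => ~~ `[< ping_pong (fcomp x.1 n) (fcomp x.2 n) >])].
Proof.
move=> q0; have [r r0 hr] := clash_frequency q0.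
have qi : 0 < q%:R^-1 :> R by rewrite invr_gt0 ltr0n.
have [r' r'0 hr'] := cw_h_unif w2 qi.
pose m := Num.min r r'; have m0 : 0 < m by rewrite lt_min r0.
pose N := (Num.truncn (6 / m) + 4)%N.
have N4 : (4 <= N)%N by rewrite leq_addl.
have N0 : 0 < N%:R :> R by rewrite ltr0n (leq_trans _ N4).
have : 6 * N%:R^-1 <= m.
  rewrite ler_pdivrMr // mulrC -ler_pdivrMr //; apply: ltW; apply: (lt_le_trans (truncnS_gt _)).
  by rewrite ler_nat /N -addn1 leq_add2l.
rewrite le_min => /andP[Nr Nr'].
have small j : cw_gap w2 (grid R N j, grid R N j.+1) <= q%:R^-1.
  rewrite gap_grid //; apply: le_trans (ltW (hr' (grid R N j))).
  have Ni : 0 < N%:R^-1 :> R by rewrite invr_gt0.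
  by apply: lerB; apply: (degree_one_le (cw_h1 w2)); rewrite ?gridS; lra.
have [A [mA subA PA]] := heavy_near_prob N4 qi small.
exists A, [set x | typical mu1 mu2 x /\ ~ freq_le clash_rate q (clash N x)]; split => //.
  exact: hr.
move=> x tx nA nB.
have fr : freq_le clash_rate q (clash N x) by apply: contrapT => nf; apply: nB.
(* Time [n] of [fcomp] is time [n.+1] of the lifts: the shift doubles the rate and [freq_sub] adds
   one. *)
apply: (freq_sub _ (freq_shift fr)); exists 0%N => n _ /asboolPn nP.
apply: contrapT => /negP nc; apply: nP; apply: (@clash_or_ping_pong N) => // hn.
by apply: nA; apply: subA.
Qed.

End PingPongFrequency.

Lemma le_inv_null (R : realType) (x : \bar R) (b : R) : (0 <= x)%E -> 0 <= b ->
  (forall q, (0 < q)%N -> (x <= (b * q%:R^-1)%:E)%E) -> x = 0%E.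
Proof.
move=> x0 b0 xb; apply/eqP; rewrite eq_le x0 andbT; apply/lee_addgt0Pr => e e0.
rewrite add0e; pose q := (Num.truncn (b / e)).+1.
apply: (le_trans (xb q isT)); rewrite lee_fin ler_pdivrMr ?ltr0n // mulrC -ler_pdivrMr //.
by apply: ltW; exact: truncnS_gt.
Qed.

Theorem theoremB (R : realType) (G1 G2 : set (CircMap R)) (mu1 mu2 : CircMap R -> R) :
  countable G1 -> countable G2 ->
  homeo_plus_subgroup G1 -> homeo_plus_subgroup G2 ->
  ~ has_invariant_probability G1 -> ~ has_invariant_probability G2 ->
  prob_on G1 mu1 -> prob_on G2 mu2 ->
  nondegenerate_on G1 mu1 -> nondegenerate_on G2 mu2 ->
  forall P : probability (Omega R) R, is_iid_product mu1 mu2 P ->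
  {ae P, forall x : Omega R,
     density_one R (fun n => ping_pong (fcomp x.1 n) (fcomp x.2 n))}.
Proof.
move=> c1 c2 s1 s2 n1 n2 p1 p2 g1 g2 P Piid.
have [w1 _] := circle_walk_exists c1 s1 n1 p1 g1.
have [w2 _] := circle_walk_exists c2 s2 n2 p2 g2.
have /andP[d1 _] := cw_c01 w1; have /andP[d2 _] := cw_c01 w2.
pose good q AB := [/\ measurable AB.1,
  (P AB.1 <= (5 / (cw_c w1 * cw_c w2) * q.+1%:R^-1)%:E)%E, P.-negligible AB.2 &
  forall x, typical mu1 mu2 x -> ~ AB.1 x -> ~ AB.2 x ->
    freq_le (clash_rate w1 w2).*2.+1 q.+1
      (fun n => ~~ `[< ping_pong (fcomp x.1 n) (fcomp x.2 n) >])].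
have ex q : exists AB, good q AB.
  by have [A [B AB]] := ping_pong_frequency w1 w2 Piid (ltn0Sn q); exists (A, B).
have [AB ABP] := choice ex.
have nB : P.-negligible (\bigcup_q (AB q).2).
  by apply: negligible_bigcup => q; have [] := ABP q.
(* The bounds [O(1 / q)] are not summable, but lying in the exceptional sets for all large [q] has
   probability 0. Every other path avoids them for arbitrarily large [q], which suffices for density
   one. *)
pose C q0 := \bigcap_(q in [set q | (q0 <= q)%N]) (AB q).1.
have nA : P.-negligible (\bigcup_q C q).
  apply: negligible_bigcup => q0.
  have mC : measurable (C q0).
    by apply: bigcap_measurable => [|q _]; [exists q0 => /=|have [] := ABP q].
  apply/negligibleP => //; apply: (@le_inv_null _ _ (5 / (cw_c w1 * cw_c w2))) => //.
    by rewrite divr_ge0 // mulr_ge0 // ltW.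
  move=> [//|q] _; have [mA PA _ _] := ABP (maxn q0 q).
  apply: (@le_trans _ _ (P (AB (maxn q0 q)).1)).
    apply: le_measure; rewrite ?inE // => x; apply => /=; exact: leq_maxl.
  apply: (le_trans PA); rewrite lee_fin ler_wpM2l //.
    by rewrite divr_ge0 // mulr_ge0 // ltW.
  by rewrite lef_pV2 ?posrE ?ltr0n // ler_nat ltnS leq_maxr.
apply: negligibleS (negligibleU (typical_negligible w1 w2 Piid) (negligibleU nB nA)).
move=> x /= nd; apply: contrapT => /not_orP[/contrapT tx /not_orP[xB xC]]; apply: nd.
apply: (@density_one_of_freq _ _ (clash_rate w1 w2).*2.+1) => q0.
have [q qq0 nAq] : exists2 q, (q0 <= q)%N & ~ (AB q).1 x.
  apply: contrapT => ne; apply: xC; exists q0 => // q /= qq0; apply: contrapT => nq.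
  by apply: ne; exists q.
exists q.+1; first by rewrite ltnS.
have [_ _ _] := ABP q; apply => //; by move=> Bq; apply: xB; exists q.
Qed.
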